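(* Let $d\ge 2$, let $m\ge 1$ be an integer, and let $F$ be the common distribution function of the i.i.d. non-negative edge passage times $t(e)$ on $\mathbf{Z}^d$. Suppose that $F(0)<p_c$ and $\mathbf{E}(t(e))^{2m}<\infty$. Then for every vector $u\in\mathbf{R}^d$ there exists a constant $C=C(d,u,F,m)$ such that for all integers $n\ge 2$, $$\mathbf{E}\big[T(\mathbf{0},nu)-\mathbf{E}T(\mathbf{0},nu)\big]^{2m}\le C\,n^m(\log n)^{10m}.$$
   Context: First passage percolation on $\mathbf{Z}^d$: regard $\mathbf{Z}^d$ as a graph with an edge between each pair of vertices at Euclidean distance $1$. To each edge $e$ assign independently a non-negative random passage time $t(e)$ with common distribution function $F$, i.e. $\mathbf{P}(t(e)\le x)=F(x)$; $\mathbf{P}$ is the product measure and $\mathbf{E}$ its expectation. For a finite nearest-neighbour path $\gamma$ with edges $e_1,\dots,e_k$ put $T(\gamma)=\sum_{i=1}^k t(e_i)$. For $x,y\in\mathbf{Z}^d$, $T(x,y)=\inf T(\gamma)$ over all finite paths $\gamma$ from $x$ to $y$. For $x,y\in\mathbf{R}^d$, $T(x,y)=T(x',y')$, where $x',y'$ are the points of $\mathbf{Z}^d$ nearest to $x,y$ (ties broken by taking the smallest nearest point in a fixed order on $\mathbf{Z}^d$). $p_c$ is the critical probability of Bernoulli bond percolation on $\mathbf{Z}^d$, $\mathbf{0}$ is the origin, and $\log$ is the natural logarithm. *)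

(* Defs.v *)
From HB Require Import structures.
From mathcomp Require Import all_boot all_order all_algebra.
From mathcomp Require Import finmap.
From mathcomp Require Import all_classical all_reals all_analysis.

Set Implicit Arguments.
Unset Strict Implicit.
Unset Printing Implicit Defensive.
Import Order.TTheory GRing.Theory Num.Theory.
Import numFieldNormedType.Exports.
Local Open Scope classical_set_scope.
Local Open Scope ring_scope.

(* The square of the Euclidean distance. It is used instead of the norm of the
   library, which on 'rV_d is the sup norm. *)
Definition sqdist (A : pzRingType) (d : nat) (x y : 'rV[A]_d) : A :=
  \sum_(i < d) (x 0 i - y 0 i) ^+ 2.

Definition adj (d : nat) : rel 'rV[int]_d := fun x y => sqdist x y == 1.

(* An edge is the unordered pair of its endpoints. Families indexed by edges
   are functions on all of {fset 'rV[int]_d}; only their values on [edges d]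
   are ever constrained or used. *)
Definition edges (d : nat) : set {fset 'rV[int]_d} :=
  [set e | exists x y, adj x y /\ e = [fset x; y]%fset].

Definition path_edges (d : nat) (x : 'rV[int]_d) (p : seq 'rV[int]_d) :
    seq {fset 'rV[int]_d} :=
  pairmap (fun a b => [fset a; b]%fset) x p.

Section independence.
Context {disp : measure_display} {Omega : measurableType disp} {R : realType}.
Variables (P : probability Omega R) (I : choiceType).

Definition indep_events (A : set I) (E : I -> set Omega) : Prop :=
  (forall i, A i -> measurable (E i)) /\
  (forall J : {fset I}, [set` J] `<=` A ->
    P (\bigcap_(i in [set` J]) E i) = (\prod_(i <- J) P (E i))%E).

Definition indep_RVs (A : set I) (X : I -> {RV P >-> R}) : Prop :=
  forall B : I -> set R, (forall i, A i -> measurable (B i)) ->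
    indep_events A (fun i => X i @^-1` B i).

End independence.

Definition open_cluster (d : nat) (Omega : Type)
    (opn : {fset 'rV[int]_d} -> set Omega) (w : Omega) : set 'rV[int]_d :=
  [set x | exists p, [/\ path (@adj d) 0 p, last 0 p = x &
                        forall e, e \in path_edges 0 p -> opn e w]].

(* [opn e] is the event that e is open. *)
Definition bernoulli_percolation (R : realType) (d : nat) (p : R)
    (disp : measure_display) (Omega : measurableType disp)
    (P : probability Omega R) (opn : {fset 'rV[int]_d} -> set Omega) : Prop :=
  indep_events P (@edges d) opn /\ (forall e, edges e -> P (opn e) = p%:E).

(* sup {p | theta(p) = 0}, where theta(p) is the probability that the open
   cluster of the origin is infinite. The law of the open edges is determined by
   p, so theta(p) may be computed in any realization of percolation. *)
Definition p_c (R : realType) (d : nat) : R :=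
  sup [set p : R | 0 <= p <= 1 /\
    exists (disp : measure_display) (Omega : measurableType disp)
           (P : probability Omega R) (opn : {fset 'rV[int]_d} -> set Omega),
      bernoulli_percolation p P opn /\
      P [set w | infinite_set (open_cluster opn w)] = 0%E].

Section first_passage.
Context {R : realType} {d : nat} {Omega : Type}.
Variable t : {fset 'rV[int]_d} -> Omega -> R.

Definition path_time (x : 'rV[int]_d) (p : seq 'rV[int]_d) (w : Omega) : R :=
  \sum_(e <- path_edges x p) t e w.

Definition passage_time (x y : 'rV[int]_d) (w : Omega) : R :=
  inf [set path_time x p w | p in [set p | path (@adj d) x p /\ last x p = y]].

End first_passage.

Definition is_nearest (R : realType) (d : nat) (x : 'rV[R]_d) (z : 'rV[int]_d) :
    Prop :=
  forall z' : 'rV[int]_d,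
    sqdist x (map_mx intr z) <= sqdist x (map_mx intr z').

Definition nearest_point (R : realType) (d : nat) (le : rel 'rV[int]_d)
    (x : 'rV[R]_d) : 'rV[int]_d :=
  xget 0 [set z | is_nearest x z /\ forall z', is_nearest x z' -> le z z'].

Definition passage_timeR (R : realType) (d : nat) (Omega : Type)
    (le : rel 'rV[int]_d) (t : {fset 'rV[int]_d} -> Omega -> R)
    (x y : 'rV[R]_d) : Omega -> R :=
  passage_time t (nearest_point le x) (nearest_point le y).

Definition iid_passage_times (R : realType) (d : nat) (F : R -> R)
    (disp : measure_display) (Omega : measurableType disp)
    (P : probability Omega R) (t : {fset 'rV[int]_d} -> {RV P >-> R}) : Prop :=
  [/\ indep_RVs (@edges d) t,
      forall e, edges e -> forall x, cdf (t e) x = (F x)%:E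
    & forall e, edges e -> forall w, 0 <= t e w].

(* Main.v *)
Require Import Defs.
From mathcomp Require Import all_boot all_order all_algebra.
From mathcomp Require Import finmap ring lra zify.
From mathcomp Require Import all_classical all_reals all_analysis.
From mathcomp Require Import measurable_realfun.

(** No logarithm is needed: [E (T - E T)^(2m) <= C n^m].

    Write [Z = T - E T]. The Efron-Stein inequality for [Z^k] compares [T] with
    its value after resampling one edge [e]; an upward move is at most the new
    passage time of [e], and only if [e] lies on the geodesic. Hence
    [E Z^(2k) <= (E Z^k)^2 + C E(G Z^(2k-2)) + C E G], where [G] is the number of
    edges of the geodesic, and induction on [k], with Cauchy-Schwarz for the
    first term and Young's inequality for the second, reduces the claim to
    [E G^k <= C n^k].

    For the latter, open each edge [e] with probability [exp(- la t(e))]. For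
    large [la] the mean density is at most some [p1] in [(F(0), p_c)], and
    [E exp(- la T(g))], maximised over self-avoiding paths [g] of length [k], is
    at most the probability that there is an open self-avoiding path of length
    [k] from the origin. This decays exponentially in [k]: below [p_c] there is a
    finite set [S] with [phi(S) < 1] (the argument of Duminil-Copin and Tassion,
    through Russo's formula), and the van den Berg-Kesten inequality, applied at
    the successive exits of the path from translates of [S], gives the decay.

    All of this takes place in finite product spaces: the passage times are
    rounded up to multiples of [1/K] and capped at [K], and only paths of length
    at most [K] are allowed. The theorem follows by letting [K] go to infinity
    with dominated convergence for the mean and Fatou's lemma for the moment. *)

Set Implicit Arguments.
Unset Strict Implicit.
Unset Printing Implicit Defensive.
Import Order.TTheory GRing.Theory Num.Theory.
Import numFieldNormedType.Exports.
Local Open Scope classical_set_scope.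
Local Open Scope ring_scope.

(** * Finite product expectations *)

(** The difficulty is the correlation between a passage time and the geodesic. In the Efron-Stein
    sum each pair of values of an edge is therefore estimated from the configuration with the
    smaller [T]: its geodesic does not see the other value, which is independent of it, so only
    moments of the edge law enter. Nothing is truncated on the way, hence no logarithm appears; at
    the end (log n)^(10m) is merely bounded below by (log 2)^(10m). A long geodesic has one of two
    causes. Either [T] is at least a fixed multiple of its length, which the moments of the time
    along a fixed path control, or [T] is small for that length, and then exp(- la T) is large while
    its mean is exponentially small. The final constant may depend on [F] but neither on [K] nor on
    the probability space. So the finite estimates hold for an arbitrary finite law, with their
    constants chosen before it, and the discretised laws are read off one reference variable with
    distribution function [F]. *)

Record law (R : realType) (X : Type) := Law {
  law_idx : finType;
  law_wt : law_idx -> R;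
  law_val : law_idx -> X;
  law_ge0 : forall v, 0 <= law_wt v;
  law_sum : \sum_v law_wt v = 1 }.

Section Resampling.
Variables (R : realType) (K : eqType) (X : Type).
Implicit Types (x y : K -> X) (e : K) (s : seq K) (f g : (K -> X) -> R).
Implicit Types (mu nu : law R X).

Definition upd x e v : K -> X := fun e' => if e' == e then v else x e'.

Definition E1 mu e f : (K -> X) -> R :=
  fun x => \sum_v law_wt v * f (upd x e (law_val (l := mu) v)).

(* Integrates out the coordinates in [s] only, so that the result is still a
   function of the configuration; this makes conditioning and marginals plain
   compositions of operators. *)
Definition Ex mu s f : (K -> X) -> R := foldr (E1 mu) f s.

Definition indep f e := forall x v, f (upd x e v) = f x.

Definition dep s f := forall x y, {in s, x =1 y} -> f x = f y.

Lemma upd_same x e v : upd x e v e = v.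
Proof. by rewrite /upd eqxx. Qed.

Lemma upd_neq x e v e' : e' != e -> upd x e v e' = x e'.
Proof. by rewrite /upd => /negPf ->. Qed.

Lemma upd_upd x e v w : upd (upd x e v) e w = upd x e w.
Proof. by apply/funext => e'; rewrite /upd; case: eqP. Qed.

Lemma updC x e e' v w : e != e' -> upd (upd x e v) e' w = upd (upd x e' w) e v.
Proof.
move=> ee'; apply/funext => e''; rewrite /upd.
by case: eqP => // ->; rewrite eq_sym (negPf ee').
Qed.

Lemma E1_cst mu e c : E1 mu e (fun=> c) = fun=> c.
Proof. by apply/funext => x; rewrite /E1 -mulr_suml law_sum mul1r. Qed.

Lemma E1D mu e f g : E1 mu e (fun x => f x + g x) = fun x => E1 mu e f x + E1 mu e g x.
Proof.
apply/funext => x; rewrite /E1 -big_split /=.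
by apply: eq_bigr => v _; rewrite mulrDr.
Qed.

Lemma E1Z mu e c f : E1 mu e (fun x => c * f x) = fun x => c * E1 mu e f x.
Proof.
apply/funext => x; rewrite /E1 mulr_sumr.
by apply: eq_bigr => v _; rewrite mulrCA.
Qed.

Lemma E1_indepM mu e f g : indep f e ->
  E1 mu e (fun x => f x * g x) = fun x => f x * E1 mu e g x.
Proof.
move=> fe; apply/funext => x; rewrite /E1 mulr_sumr.
by apply: eq_bigr => v _; rewrite fe mulrCA.
Qed.

Lemma E1_indep mu e f : indep f e -> E1 mu e f = f.
Proof.
move=> fe; apply/funext => x; rewrite /E1.
by under eq_bigr do rewrite fe; rewrite -mulr_suml law_sum mul1r.
Qed.

Lemma indep_E1_same mu e f : indep (E1 mu e f) e.
Proof. by move=> x v; apply: eq_bigr => w _; rewrite upd_upd. Qed.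

Lemma E1_idem mu e f : E1 mu e (E1 mu e f) = E1 mu e f.
Proof. exact/E1_indep/indep_E1_same. Qed.

Lemma indep_E1 mu e e' f : indep f e -> indep (E1 mu e' f) e.
Proof.
have [->|ee' fe] := eqVneq e e'; first by move=> _; exact: indep_E1_same.
by move=> x v; apply: eq_bigr => w _; rewrite updC // fe.
Qed.

Lemma E1C mu nu e e' f : e != e' -> E1 mu e (E1 nu e' f) = E1 nu e' (E1 mu e f).
Proof.
move=> ee'; apply/funext => x; rewrite /E1.
under eq_bigr do rewrite mulr_sumr.
rewrite exchange_big; apply: eq_bigr => v _; rewrite mulr_sumr.
by apply: eq_bigr => w _; rewrite mulrCA updC.
Qed.

Lemma E1C_same mu e e' f : E1 mu e (E1 mu e' f) = E1 mu e' (E1 mu e f).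
Proof. by have [->//|] := eqVneq e e'; exact: E1C. Qed.

Lemma Ex_cst mu s c : Ex mu s (fun=> c) = fun=> c.
Proof. by elim: s => //= e s ->; rewrite E1_cst. Qed.

Lemma ExD mu s f g : Ex mu s (fun x => f x + g x) = fun x => Ex mu s f x + Ex mu s g x.
Proof. by elim: s => //= e s ->; rewrite E1D. Qed.

Lemma ExZ mu s c f : Ex mu s (fun x => c * f x) = fun x => c * Ex mu s f x.
Proof. by elim: s => //= e s ->; rewrite E1Z. Qed.

Lemma ExN mu s f : Ex mu s (fun x => - f x) = fun x => - Ex mu s f x.
Proof.
have -> : (fun x => - f x) = (fun x => -1 * f x) by apply/funext => x; rewrite mulN1r.
by rewrite ExZ; apply/funext => x; rewrite mulN1r.
Qed.

Lemma ExB mu s f g : Ex mu s (fun x => f x - g x) = fun x => Ex mu s f x - Ex mu s g x.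
Proof. by rewrite ExD ExN. Qed.

Lemma Ex_sum mu s (I : Type) (r : seq I) (P : pred I) (F : I -> (K -> X) -> R) :
  Ex mu s (fun x => \sum_(i <- r | P i) F i x) =
  fun x => \sum_(i <- r | P i) Ex mu s (F i) x.
Proof.
elim: r => [|i r IH].
  under eq_fun do rewrite big_nil.
  by rewrite Ex_cst; apply/funext => x; rewrite big_nil.
under eq_fun do rewrite big_cons.
apply/funext => x; rewrite big_cons; case: ifP => _; last by rewrite IH.
by rewrite ExD IH.
Qed.

Lemma Ex_E1 mu s e f : Ex mu s (E1 mu e f) = E1 mu e (Ex mu s f).
Proof. by elim: s => //= e' s ->; rewrite E1C_same. Qed.

Lemma Ex_E1C mu nu s e f : e \notin s -> Ex mu s (E1 nu e f) = E1 nu e (Ex mu s f).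
Proof.
elim: s => //= e' s IH; rewrite in_cons negb_or => /andP[ee' es].
by rewrite IH // E1C // eq_sym.
Qed.

Lemma ExC mu s s' f : Ex mu s (Ex mu s' f) = Ex mu s' (Ex mu s f).
Proof. by elim: s' => //= e s' IH; rewrite Ex_E1 IH. Qed.

Lemma indep_Ex mu s e f : indep f e -> indep (Ex mu s f) e.
Proof. by move=> fe; elim: s => //= e' s; exact: indep_E1. Qed.

(** Independence as a product rule. Which factor ignores a coordinate may change from one coordinate
    to the next, so [s] need not be split into two blocks. *)
Lemma Ex_prod mu s f g : (forall e, e \in s -> indep f e \/ indep g e) ->
  Ex mu s (fun x => f x * g x) = fun x => Ex mu s f x * Ex mu s g x.
Proof.
elim: s => //= e s IH fg; rewrite IH => [|e' e's]; last first.
  by apply: fg; rewrite in_cons e's orbT.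
have [fe|ge] := fg e (mem_head _ _).
  rewrite E1_indepM; last exact: indep_Ex.
  by rewrite (E1_indep _ (indep_Ex _ _ fe)).
rewrite (E1_indep _ (indep_Ex _ _ ge)).
under eq_fun do rewrite mulrC.
rewrite E1_indepM; last exact: indep_Ex.
by apply/funext => x; rewrite mulrC.
Qed.

Lemma Ex_dep_cst mu s f : dep s f -> forall x y, Ex mu s f x = Ex mu s f y.
Proof.
(* Generalised to a list [r] on which [x] and [y] agree: averaging over [e] makes them agree at [e]
   as well, so [e] moves to [r]. *)
suff H r : forall f, dep (s ++ r) f -> forall x y, {in r, x =1 y} ->
    Ex mu s f x = Ex mu s f y.
  by move=> fs x y; apply: (H [::]) => //; rewrite cats0.
elim: s r => [|e s IH] r {}f fs x y xy; first exact: fs.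
rewrite /= /E1; apply: eq_bigr => v _; congr (_ * _).
apply: (IH (e :: r)) => [z t zt|e'].
  apply: fs => e' e's; apply: zt; move: e's.
  by rewrite !(mem_cat, in_cons) => /orP[/orP[]|] ->; rewrite ?orbT.
rewrite in_cons /upd; case: eqVneq => //= _; exact: xy.
Qed.

(** Integrating over both lists gives the same result in either order, and each inner integral is
    already constant. *)
Lemma Ex_marginal mu s s' f x y : dep s f -> dep s' f -> Ex mu s f x = Ex mu s' f y.
Proof.
move=> fs fs'.
have H r : dep r f -> exists c, Ex mu r f = fun=> c.
  move=> fr; exists (Ex mu r f x); apply/funext => z; exact: Ex_dep_cst.
have [c Ec] := H _ fs; have [c' Ec'] := H _ fs'.
by have := ExC mu s s' f; rewrite Ec Ec' !Ex_cst => /(congr1 (fun h => h x)).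
Qed.

(* The guard [G] is needed when [f <= g] only holds for admissible configurations. *)
Lemma Ex_le_on mu s (G : X -> Prop) f g :
  (forall v, G (law_val (l := mu) v)) ->
  (forall x, (forall e, G (x e)) -> f x <= g x) ->
  forall x, (forall e, G (x e)) -> Ex mu s f x <= Ex mu s g x.
Proof.
move=> Gv fg; elim: s => //= e s IH x Gx; apply: ler_sum => v _.
apply: ler_wpM2l; first exact: law_ge0.
by apply: IH => e'; rewrite /upd; case: ifP.
Qed.

Lemma Ex_le mu s f g : (forall x, f x <= g x) -> forall x, Ex mu s f x <= Ex mu s g x.
Proof. by move=> fg x; apply: (@Ex_le_on _ _ (fun=> True)). Qed.

Lemma Ex_ge0 mu s f x : (forall x, 0 <= f x) -> 0 <= Ex mu s f x.
Proof.
move=> f0; have -> : 0 = Ex mu s (fun=> 0) x by rewrite Ex_cst.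
exact: Ex_le.
Qed.

Lemma E1_le mu e f g : (forall x, f x <= g x) -> forall x, E1 mu e f x <= E1 mu e g x.
Proof. exact: (@Ex_le mu [:: e]). Qed.

End Resampling.

(** Change of variables along an injection of index sets; it yields the translation invariance of
    percolation. *)
Lemma Ex_transport (R : realType) (K K' : eqType) (X : Type) (mu : law R X)
    (h : K -> K') (hI : injective h) (s : seq K) (f : (K -> X) -> R) (x : K' -> X) :
  Ex mu (map h s) (fun y => f (y \o h)) x = Ex mu s f (x \o h).
Proof.
elim: s x => //= e s IH x; apply: eq_bigr => v _; rewrite IH; congr (_ * Ex _ _ _ _).
by apply/funext => e'; rewrite /upd /= (inj_eq hI).
Qed.

(** * The Efron-Stein inequality *)

Lemma normrXB_le (R : realDomainType) (k : nat) (a b M : R) :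
  `|a| <= M -> `|b| <= M -> `|a ^+ k - b ^+ k| <= `|a - b| * (M ^+ k.-1 *+ k).
Proof.
move=> aM bM; have M0 : 0 <= M := le_trans (normr_ge0 a) aM.
rewrite subrXX normrM ler_wpM2l // (le_trans (ler_norm_sum _ _ _)) //.
have -> : M ^+ k.-1 *+ k = \sum_(i < k) M ^+ k.-1 by rewrite sumr_const card_ord.
apply: ler_sum => i _; rewrite normrM !normrX.
have -> : M ^+ k.-1 = M ^+ (k.-1 - i) * M ^+ i.
  by rewrite -exprD; congr (_ ^+ _); have := ltn_ord i; lia.
by rewrite ler_pM ?exprn_ge0 // lerXn2r // nnegrE.
Qed.

Lemma exprD_le (R : realDomainType) (n : nat) (a b : R) : 0 <= a -> 0 <= b ->
  (a + b) ^+ n <= 2 ^+ n * (a ^+ n + b ^+ n).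
Proof.
wlog ab : a b / a <= b => [H|] a0 b0.
  by case: (leP a b) => [|/ltW] h; [|rewrite addrC [_ ^+ n + _]addrC]; exact: H.
apply: (@le_trans _ _ ((2 * b) ^+ n)).
  rewrite lerXn2r ?nnegrE ?addr_ge0 ?mulr_ge0 //; lra.
by rewrite exprMn ler_wpM2l ?exprn_ge0 // lerDr exprn_ge0.
Qed.

(** Only the lower value [b] and the increment [delta] occur on the right: [delta] will be a fresh
    passage time, which is averaged independently of [b]. *)
Lemma sqr_exprB_le (R : realDomainType) (k : nat) (a b delta : R) :
  b <= a -> a <= b + delta ->
  (a ^+ k.+1 - b ^+ k.+1) ^+ 2 <=
    (k.+1 ^ 2 * 4 ^ k)%:R * (delta ^+ 2 * b ^+ (2 * k) + delta ^+ (2 * k.+1)).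
Proof.
move=> ba ab; have d0 : 0 <= delta by lra.
have aM : `|a| <= `|b| + delta by rewrite ler_norml; have := ler_norm b; have := ler_norm (- b);
  rewrite normrN; lra.
have bM : `|b| <= `|b| + delta by lra.
have H := normrXB_le k.+1 aM bM.
have Mk : 0 <= (`|b| + delta) ^+ k by rewrite exprn_ge0 // addr_ge0.
have {}H : `|a ^+ k.+1 - b ^+ k.+1| <= delta * (k.+1%:R * (`|b| + delta) ^+ k).
  apply: le_trans H _; rewrite mulr_natl ler_wpM2r ?mulrn_wge0 //.
  by rewrite ger0_norm; lra.
rewrite -[leLHS]ger0_norm ?sqr_ge0 // normrX.
apply: (@le_trans _ _ ((delta * (k.+1%:R * (`|b| + delta) ^+ k)) ^+ 2)).
  by rewrite lerXn2r // nnegrE mulr_ge0 // mulr_ge0.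
have E : ((`|b| + delta) ^+ k) ^+ 2 <= 4 ^+ k * (b ^+ (2 * k) + delta ^+ (2 * k)).
  have -> : (4 : R) = 2 ^+ 2 by ring.
  rewrite -!exprM mulnC; apply: le_trans (exprD_le _ (normr_ge0 b) d0) _.
  by rewrite [ `|b| ^+ _]exprM -normrX ger0_norm ?sqr_ge0 // -exprM.
have -> : (k.+1 ^ 2 * 4 ^ k)%:R * (delta ^+ 2 * b ^+ (2 * k) + delta ^+ (2 * k.+1)) =
    delta ^+ 2 * (k.+1%:R ^+ 2 * (4 ^+ k * (b ^+ (2 * k) + delta ^+ (2 * k)))).
  by rewrite mulnS exprD natrM !natrX; ring.
by rewrite !exprMn; do 2 (rewrite ler_wpM2l ?exprn_ge0 //).
Qed.

Section Variance.
Variables (R : realType) (K : eqType) (X : Type) (mu : law R X).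
Implicit Types (x : K -> X) (e : K) (s : seq K) (f g : (K -> X) -> R).

Lemma Ex_sqr_ge s f x : (Ex mu s f x) ^+ 2 <= Ex mu s (fun y => f y ^+ 2) x.
Proof.
set c := Ex mu s f x.
have : 0 <= Ex mu s (fun y => (f y - c) ^+ 2) x by apply: Ex_ge0 => y; exact: sqr_ge0.
have -> : (fun y => (f y - c) ^+ 2) = (fun y => f y ^+ 2 + ((- (2 * c)) * f y + c ^+ 2)).
  by apply/funext => y; ring.
rewrite !ExD ExZ Ex_cst -/c; lra.
Qed.

Lemma Ex_CauchySchwarz s f g x :
  (Ex mu s (fun y => f y * g y) x) ^+ 2 <=
    Ex mu s (fun y => f y ^+ 2) x * Ex mu s (fun y => g y ^+ 2) x.
Proof.
set b := Ex mu s (fun y => f y * g y) x; set a := Ex mu s _ x; set c := Ex mu s _ x.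
have H t : 0 <= a - 2 * t * b + t ^+ 2 * c.
  have : 0 <= Ex mu s (fun y => (f y - t * g y) ^+ 2) x.
    by apply: Ex_ge0 => y; exact: sqr_ge0.
  have -> : (fun y => (f y - t * g y) ^+ 2) =
      (fun y => f y ^+ 2 + ((- (2 * t)) * (f y * g y) + t ^+ 2 * g y ^+ 2)).
    by apply/funext => y; ring.
  rewrite !ExD !ExZ -/a -/b -/c; lra.
have c0 : 0 <= c by apply: Ex_ge0 => y; exact: sqr_ge0.
have [c_gt0|] := ltP 0 c.
  have := H (b / c).
  have -> : a - 2 * (b / c) * b + (b / c) ^+ 2 * c = (a * c - b ^+ 2) / c by field; lra.
  by rewrite pmulr_lge0 ?invr_gt0 // subr_ge0.
move=> c_le0; have c00 : c = 0 by lra.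
have [->|b0] := eqVneq b 0; first by rewrite expr0n /= c00 mulr0.
(* With [c = 0] the quadratic is affine in [t], and this [t] would give it the value -1. *)
have := H ((a + 1) / (2 * b)); rewrite c00 mulr0 addr0.
by have -> : a - 2 * ((a + 1) / (2 * b)) * b = -1; [field | lra].
Qed.

Lemma var_pairs (I : finType) (w a : I -> R) : \sum_v w v = 1 ->
  \sum_v w v * a v ^+ 2 - (\sum_v w v * a v) ^+ 2 =
  \sum_v \sum_u w v * (w u * (2^-1 * (a v - a u) ^+ 2)).
Proof.
move=> w1; set S1 := \sum_v w v * a v; set S2 := \sum_v w v * a v ^+ 2.
have -> : \sum_v \sum_u w v * (w u * (2^-1 * (a v - a u) ^+ 2)) =
    \sum_v w v * (2^-1 * a v ^+ 2 + 2^-1 * S2 - a v * S1).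
  apply: eq_bigr => v _; rewrite -mulr_sumr; congr (_ * _).
  transitivity (\sum_u (w u * (2^-1 * a v ^+ 2) + 2^-1 * (w u * a u ^+ 2) - a v * (w u * a u))).
    by apply: eq_bigr => u _; field.
  by rewrite sumrB big_split /= -mulr_suml -!mulr_sumr w1 mul1r.
transitivity (\sum_v (2^-1 * (w v * a v ^+ 2) + w v * (2^-1 * S2) - w v * a v * S1)).
  rewrite sumrB big_split /= -!mulr_suml -!mulr_sumr w1 mul1r -/S1 -/S2; lra.
by apply: eq_bigr => v _; ring.
Qed.

Lemma Ex_upd s f e v x : e \notin s ->
  Ex mu s (fun y => f (upd y e v)) x = Ex mu s f (upd x e v).
Proof.
elim: s x => //= e' s IH x; rewrite in_cons negb_or => /andP[ee' es].
by apply: eq_bigr => w _; rewrite IH // updC // eq_sym.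
Qed.

Lemma Ex_absorb s e f : e \in s -> Ex mu s (E1 mu e f) = Ex mu s f.
Proof.
elim: s => //= e' s IH; rewrite in_cons => /predU1P[<-|es]; last by rewrite IH.
by rewrite Ex_E1 E1_idem.
Qed.

Definition var1 e f x := E1 mu e (fun y => f y ^+ 2) x - (E1 mu e f x) ^+ 2.

Lemma var1_pairs e f x : var1 e f x =
  \sum_v \sum_u law_wt v * (law_wt u * (2^-1 *
    (f (upd x e (law_val (l := mu) v)) - f (upd x e (law_val (l := mu) u))) ^+ 2)).
Proof. exact: (var_pairs _ (law_sum mu)). Qed.

Lemma indep_var1 e f : indep (var1 e f) e.
Proof. by move=> x v; rewrite /var1 !indep_E1_same. Qed.

(** Jensen's inequality, applied to each squared difference of two copies at [e]. *)
Lemma var1_Ex_le s e f x : e \notin s -> var1 e (Ex mu s f) x <= Ex mu s (var1 e f) x.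
Proof.
move=> es; rewrite var1_pairs (_ : var1 e f = fun x => \sum_v \sum_u law_wt v * (law_wt u * (2^-1 *
    (f (upd x e (law_val (l := mu) v)) - f (upd x e (law_val (l := mu) u))) ^+ 2))); last first.
  by apply/funext => y; exact: var1_pairs.
rewrite Ex_sum; apply: ler_sum => v _; rewrite Ex_sum; apply: ler_sum => u _.
rewrite !ExZ; do 2 (apply: ler_wpM2l; first exact: law_ge0).
rewrite ler_wpM2l // -!Ex_upd //.
apply: le_trans (Ex_sqr_ge s _ x); rewrite ExB; exact: lexx.
Qed.

(** Total variance along [s]: the variance splits into that of the average over the tail, as a
    function of [e], and the mean of the variance over the tail. *)
Lemma efron_stein s f x : uniq s ->
  Ex mu s (fun y => f y ^+ 2) x - (Ex mu s f x) ^+ 2 <= \sum_(e <- s) Ex mu s (var1 e f) x.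
Proof.
elim: s x => [|e s IH] x; first by rewrite big_nil /= subrr.
move=> /= /andP[es us]; rewrite big_cons.
have -> : E1 mu e (Ex mu s (fun y => f y ^+ 2)) x - E1 mu e (Ex mu s f) x ^+ 2 =
    var1 e (Ex mu s f) x +
    E1 mu e (fun y => Ex mu s (fun z => f z ^+ 2) y - (Ex mu s f y) ^+ 2) x.
  rewrite /var1 (E1D mu e _ (fun y => - (Ex mu s f y ^+ 2))).
  have -> : E1 mu e (fun y => - (Ex mu s f y ^+ 2)) = fun y => - E1 mu e (fun y => Ex mu s f y ^+
    2) y.
    exact: (@ExN _ _ _ mu [:: e]).
  ring.
apply: lerD.
  rewrite E1_indep; first exact: var1_Ex_le.
  exact/indep_Ex/indep_var1.
have := @Ex_sum _ _ _ mu [:: e] _ s xpredT (fun e' => Ex mu s (var1 e' f)).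
move=> /(congr1 (fun h => h x)) /= <-.
by apply: E1_le => y; exact: IH.
Qed.

End Variance.

(** * Moments from one-edge resampling *)

Section MomentStep.
Variables (R : realType) (K : eqType) (X : Type) (mu : law R X).
Variables (vl : X -> R) (f : (K -> X) -> R) (geo : (K -> X) -> seq K).
Hypothesis vl0 : forall v, 0 <= vl v.
Hypothesis f_upd : forall x e v, f (upd x e v) <= f x + vl v * (e \in geo x)%:R.

Definition law_moment (j : nat) : R := \sum_v law_wt v * vl (law_val (l := mu) v) ^+ j.

Definition geo_count (s : seq K) (x : K -> X) : R := \sum_(e <- s) (e \in geo x)%:R.

Lemma geo_count_ge0 s x : 0 <= geo_count s x.
Proof. by apply: sumr_ge0 => e _; exact: ler0n. Qed.

(** Of two copies at [e], the larger value of [f] is reached from the smaller by inserting a new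
    value at [e]. The increment is at most that value and vanishes unless [e] is in [geo] of the
    lower copy, so averaging over the new value produces only moments. *)
Lemma var1_pow_le (c : R) (k : nat) e x :
  var1 mu e (fun y => (f y - c) ^+ k.+1) x <=
  E1 mu e (fun y => (e \in geo y)%:R * ((k.+1 ^ 2 * 4 ^ k)%:R *
    (law_moment 2 * (f y - c) ^+ (2 * k) + law_moment (2 * k.+1)))) x.
Proof.
rewrite var1_pairs.
set C := (_ * _)%:R; pose xx (v : law_idx mu) := upd x e (law_val (l := mu) v).
pose Q (v u : law_idx mu) : R := (e \in geo (xx u))%:R * (C *
  (vl (law_val (l := mu) v) ^+ 2 * (f (xx u) - c) ^+ (2 * k) +
   vl (law_val (l := mu) v) ^+ (2 * k.+1))).
have Q0 v u : 0 <= Q v u.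
  rewrite mulr_ge0 // mulr_ge0 // addr_ge0 ?[0 <= vl _ ^+ (2 * _)]exprn_ge0 //.
  by rewrite mulr_ge0 ?sqr_ge0 // exprM exprn_ge0 // sqr_ge0.
have aux v u : f (xx u) <= f (xx v) ->
    ((f (xx v) - c) ^+ k.+1 - (f (xx u) - c) ^+ k.+1) ^+ 2 <= Q v u.
  move=> uv; have := f_upd (xx u) e (law_val (l := mu) v).
  rewrite /xx upd_upd -/(xx u) -/(xx v) => vu.
  apply: (@le_trans _ _ _ _ _ (sqr_exprB_le (delta := vl (law_val (l := mu) v) * (e \in geo (xx
    u))%:R) k _ _)).
  - by rewrite lerD2r.
  - by rewrite addrAC lerD2r.
  by rewrite /Q; case: (_ \in _);
    rewrite ?mulr1 ?mul1r // !mulr0 mul0r !expr0n /= mul0r addr0 mulr0.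
(* Whichever of the two is lower, one of the two terms bounds the difference and the other is
   nonnegative; no indicator of the order remains. *)
have pair v u : 2^-1 * ((f (xx v) - c) ^+ k.+1 - (f (xx u) - c) ^+ k.+1) ^+ 2 <=
    2^-1 * Q v u + 2^-1 * Q u v.
  rewrite -mulrDr ler_wpM2l //; case: (leP (f (xx u)) (f (xx v))) => [uv|/ltW vu].
    by have := aux _ _ uv; have := Q0 u v; lra.
  by rewrite -sqrrN opprB; have := aux _ _ vu; have := Q0 v u; lra.
have -> : E1 mu e (fun y => (e \in geo y)%:R * (C *
    (law_moment 2 * (f y - c) ^+ (2 * k) + law_moment (2 * k.+1)))) x =
    \sum_v \sum_u law_wt v * (law_wt u * Q v u).
  rewrite exchange_big /E1; apply: eq_bigr => u _ /=.
  rewrite -/(xx u) /Q /law_moment.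
  transitivity (law_wt u * \sum_v law_wt v * ((e \in geo (xx u))%:R * (C *
  (vl (law_val (l := mu) v) ^+ 2 * (f (xx u) - c) ^+ (2 * k) +
   vl (law_val (l := mu) v) ^+ (2 * k.+1))))).
    congr (_ * _); rewrite mulr_suml -big_split /= !mulr_sumr.
    by apply: eq_bigr => v _; ring.
  by rewrite mulr_sumr; apply: eq_bigr => v _; ring.
have -> : \sum_v \sum_u law_wt v * (law_wt u * Q v u) =
    \sum_v \sum_u law_wt v * (law_wt u * (2^-1 * Q v u + 2^-1 * Q u v)).
  set S := LHS.
  have E : \sum_v \sum_u law_wt v * (law_wt u * Q u v) = S.
    by rewrite exchange_big; apply: eq_bigr => v _; apply: eq_bigr => u _; rewrite mulrCA.
  have -> : \sum_v \sum_u law_wt v * (law_wt u * (2^-1 * Q v u + 2^-1 * Q u v)) = 2^-1 * S + 2^-1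
    * S.
    rewrite -{2}E /S !mulr_sumr -big_split; apply: eq_bigr => v _ /=.
    by rewrite !mulr_sumr -big_split; apply: eq_bigr => u _ /=; ring.
  lra.
apply: ler_sum => v _; apply: ler_sum => u _.
do 2 (apply: ler_wpM2l; first exact: law_ge0).
exact: pair.
Qed.

Lemma moment_step (c : R) (k : nat) s x : uniq s ->
  Ex mu s (fun y => (f y - c) ^+ (2 * k.+1)) x <=
  (Ex mu s (fun y => (f y - c) ^+ k.+1) x) ^+ 2 + (k.+1 ^ 2 * 4 ^ k)%:R *
    (law_moment 2 * Ex mu s (fun y => geo_count s y * (f y - c) ^+ (2 * k)) x +
     law_moment (2 * k.+1) * Ex mu s (geo_count s) x).
Proof.
move=> us; rewrite -lerBlDl.
have -> : (fun y => (f y - c) ^+ (2 * k.+1)) = (fun y => ((f y - c) ^+ k.+1) ^+ 2).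
  by apply/funext => y; rewrite mulnC exprM.
apply: le_trans (efron_stein _ _ _ us) _.
have -> : (k.+1 ^ 2 * 4 ^ k)%:R *
    (law_moment 2 * Ex mu s (fun y => geo_count s y * (f y - c) ^+ (2 * k)) x +
     law_moment (2 * k.+1) * Ex mu s (geo_count s) x) =
   Ex mu s (fun y => (k.+1 ^ 2 * 4 ^ k)%:R *
    (law_moment 2 * (geo_count s y * (f y - c) ^+ (2 * k)) +
     law_moment (2 * k.+1) * geo_count s y)) x by rewrite ExZ ExD !ExZ.
have -> : (fun y => (k.+1 ^ 2 * 4 ^ k)%:R *
    (law_moment 2 * (geo_count s y * (f y - c) ^+ (2 * k)) +
     law_moment (2 * k.+1) * geo_count s y)) =
   fun y => \sum_(e <- s) (e \in geo y)%:R * ((k.+1 ^ 2 * 4 ^ k)%:R *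
    (law_moment 2 * (f y - c) ^+ (2 * k) + law_moment (2 * k.+1))).
  by apply/funext => y; rewrite -mulr_suml -/(geo_count s y); ring.
rewrite Ex_sum !big_seq; apply: ler_sum => e es.
(* The average over [e] is put back inside, because the one-edge bound holds only after averaging
   over [e]. *)
rewrite -[leRHS](congr1 (fun h => h x) (Ex_absorb mu _ es)).
by apply: Ex_le => y; exact: var1_pow_le.
Qed.

End MomentStep.

(** Either [2 * a <= b] and the first term suffices, or [b < 2 * a] and the second does. The
    coefficient 1/2 lets the moment recursion absorb the power of [b]. *)
Lemma mulrX_young (R : realFieldType) (k : nat) (a b : R) : 0 <= a -> 0 <= b ->
  a * b ^+ k <= 2^-1 * b ^+ k.+1 + 2 ^+ k * a ^+ k.+1.
Proof.
move=> a0 b0; have [ab|ba] := leP (2 * a) b.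
  apply: (@le_trans _ _ (2^-1 * b ^+ k.+1)); last first.
    by rewrite lerDl mulr_ge0 ?exprn_ge0.
  by rewrite exprS mulrA ler_wpM2r ?exprn_ge0 //; lra.
apply: (@le_trans _ _ (2 ^+ k * a ^+ k.+1)); last first.
  by rewrite lerDr mulr_ge0 ?exprn_ge0 ?invr_ge0.
rewrite exprS mulrCA ler_wpM2l // -exprMn lerXn2r // ?nnegrE ?mulr_ge0 //.
exact: ltW.
Qed.

(** [C] is chosen before the law, so one constant serves all levels of discretisation. In the base
    case the squared mean vanishes by centring. *)
Lemma moment_bound (R : realType) (K : eqType) (A D : R) (m : nat) : 0 <= A -> 0 <= D ->
  exists C : R, 0 <= C /\ forall (X : Type) (mu : law R X) (vl : X -> R)
    (f : (K -> X) -> R) (geo : (K -> X) -> seq K) (s : seq K) (x : K -> X) (n : R),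
  (forall v, 0 <= vl v) ->
  (forall x e v, f (upd x e v) <= f x + vl v * (e \in geo x)%:R) ->
  (forall j, (1 <= j <= m.+1)%N -> law_moment mu vl (2 * j) <= A) ->
  uniq s -> 1 <= n ->
  (forall j, (1 <= j <= m.+1)%N -> Ex mu s (fun y => geo_count R geo s y ^+ j) x <= D * n ^+ j) ->
  Ex mu s (fun y => (f y - Ex mu s f x) ^+ (2 * m.+1)) x <= C * n ^+ m.+1.
Proof.
move=> A0 D0.
elim: m {-2}m (leqnn m) => [|m0 IH] m mm0.
  move: mm0; rewrite leqn0 => /eqP ->.
  exists (A * D + A * D); split; first by rewrite addr_ge0 // mulr_ge0.
  move=> X mu vl f geo s x n vl0 fu Am us n1 HD.
  apply: le_trans (moment_step mu vl0 fu (Ex mu s f x) 0 x us) _.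
  have -> : Ex mu s (fun y => (f y - Ex mu s f x) ^+ 1) x = 0.
    have -> : (fun y => (f y - Ex mu s f x) ^+ 1) = (fun y => f y - Ex mu s f x).
      by apply/funext => y; rewrite expr1.
    by rewrite ExB Ex_cst subrr.
  rewrite expr0n /= add0r mul1r expr1 mulrDl -!mulrA.
  have -> : (fun y => geo_count R geo s y * (f y - Ex mu s f x) ^+ (2 * 0)) = geo_count R geo s.
    by apply/funext => y; rewrite muln0 expr0 mulr1.
  have := HD 1%N isT; rewrite (_ : (fun y => geo_count R geo s y ^+ 1) = geo_count R geo s);
    last first.
    by apply/funext => y; rewrite expr1.
  rewrite expr1 => HN; have := Am 1%N isT => HA.
  have E0 : 0 <= Ex mu s (geo_count R geo s) x by apply: Ex_ge0 => y; exact: geo_count_ge0.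
  have M0 : 0 <= law_moment mu vl (2 * 1).
    by apply: sumr_ge0 => v _; rewrite mulr_ge0 ?law_ge0 ?exprn_ge0.
  by apply: lerD; exact: ler_pM.
have [->|] := eqVneq m 0%N; first exact: IH.
rewrite -lt0n => m_gt0; case: m m_gt0 mm0 => // m _ mm0.
have [C1 [C10 HC1]] := IH 0%N (leq0n _).
have [Cm [Cm0 HCm]] := IH m mm0.
pose c : R := (m.+2 ^ 2 * 4 ^ m.+1)%:R.
(* The factor 2 pays for moving half of [L] to the left-hand side. *)
pose C := 2 * (Cm * C1 + 2 ^+ m.+1 * (c * A) ^+ m.+2 * D + c * A * D).
have c0 : 0 <= c := ler0n _ _.
have cA0 : 0 <= c * A by rewrite mulr_ge0.
have cAm : 0 <= (c * A) ^+ m.+2 by rewrite exprn_ge0.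
have m20 : 0 <= 2 ^+ m.+1 :> R by rewrite exprn_ge0.
exists C; split; first by repeat (first [done | apply: addr_ge0 | apply: mulr_ge0]).
move=> X mu vl f geo s x n vl0 fu Am us n1 HD.
have := moment_step mu vl0 fu (Ex mu s f x) m.+1 x us; rewrite -/c.
set Z := fun y => f y - Ex mu s f x; set N := geo_count R geo s.
set L := Ex mu s (fun y => _ ^+ (2 * m.+2)) x => step.
have n0 : 0 <= n by lra.
have N0 y : 0 <= N y := geo_count_ge0 _ _ _ _.
(* Cauchy-Schwarz for [Z ^+ m.+1] and [Z]: the two induction hypotheses give n^(m+1) and n, whose
   product is the required power. *)
have H1 : (Ex mu s (fun y => (f y - Ex mu s f x) ^+ m.+2) x) ^+ 2 <= Cm * C1 * n ^+ m.+2.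
  have -> : (fun y => (f y - Ex mu s f x) ^+ m.+2) = (fun y => Z y ^+ m.+1 * Z y).
    by apply/funext => y; rewrite exprSr.
  apply: le_trans (Ex_CauchySchwarz _ _ _ _ _) _.
  rewrite exprSr mulrACA.
  have -> : (fun y => (Z y ^+ m.+1) ^+ 2) = (fun y => Z y ^+ (2 * m.+1)).
    by apply/funext => y; rewrite mulnC exprM.
  apply: ler_pM.
  - by apply: Ex_ge0 => y; rewrite exprM exprn_ge0 // sqr_ge0.
  - by apply: Ex_ge0 => y; exact: sqr_ge0.
  - have Am' j : (1 <= j <= m.+1)%N -> law_moment mu vl (2 * j) <= A.
      by move=> /andP[j1 jm]; apply: Am; rewrite j1 ltnW.
    have HD' j : (1 <= j <= m.+1)%N -> Ex mu s (fun y => N y ^+ j) x <= D * n ^+ j.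
      by move=> /andP[j1 jm]; apply: HD; rewrite j1 ltnW.
    exact: (HCm _ _ _ _ _ _ _ _ vl0 fu Am' us n1 HD').
  - have Am' j : (1 <= j <= 1)%N -> law_moment mu vl (2 * j) <= A.
      by move=> /andP[j1 jm]; apply: Am; rewrite j1 (leq_trans jm).
    have HD' j : (1 <= j <= 1)%N -> Ex mu s (fun y => N y ^+ j) x <= D * n ^+ j.
      by move=> /andP[j1 jm]; apply: HD; rewrite j1 (leq_trans jm).
    by have := HC1 _ _ _ _ _ _ _ _ vl0 fu Am' us n1 HD'; rewrite muln1 expr1.
have M20 j : 0 <= law_moment mu vl j.
  by apply: sumr_ge0 => v _; rewrite mulr_ge0 ?law_ge0 ?exprn_ge0.
have EN0 : 0 <= Ex mu s N x by apply: Ex_ge0.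
have H3 : law_moment mu vl (2 * m.+2) * Ex mu s N x <= A * (D * n ^+ m.+2).
  apply: ler_pM => //; first by apply: Am; rewrite leqnn.
  have := HD 1%N isT; rewrite (_ : (fun y => geo_count R geo s y ^+ 1) = N); last first.
    by apply/funext => y; rewrite expr1.
  move=> /le_trans; apply; rewrite ler_wpM2l // expr1 exprS.
  by rewrite ler_peMr // exprn_ege1.
(* Young's inequality with b = Z^2 and a = c A N; its power of b is the part absorbed in [L]. *)
have H2 : c * (law_moment mu vl 2 * Ex mu s (fun y => N y * Z y ^+ (2 * m.+1)) x) <=
    2^-1 * L + 2 ^+ m.+1 * (c * A) ^+ m.+2 * D * n ^+ m.+2.
  apply: (@le_trans _ _ (Ex mu s (fun y => 2^-1 * (Z y ^+ (2 * m.+2)) +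
     2 ^+ m.+1 * (c * A) ^+ m.+2 * (N y ^+ m.+2)) x)).
    have -> : c * (law_moment mu vl 2 * Ex mu s (fun y => N y * Z y ^+ (2 * m.+1)) x) =
        Ex mu s (fun y => c * (law_moment mu vl 2 * (N y * Z y ^+ (2 * m.+1)))) x.
      by rewrite !ExZ.
    apply: Ex_le => y; have Zy : 0 <= Z y ^+ (2 * m.+1) by rewrite exprM exprn_ge0 // sqr_ge0.
    apply: (@le_trans _ _ (c * (A * (N y * Z y ^+ (2 * m.+1))))).
      rewrite ler_wpM2l // ler_wpM2r //; first by rewrite mulr_ge0.
      exact: Am 1%N isT.
    have := @mulrX_young _ m.+1 (c * A * N y) (Z y ^+ 2) (mulr_ge0 cA0 (N0 y)) (sqr_ge0 _).
    by rewrite -!exprM !exprMn !mulrA.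
  rewrite ExD !ExZ lerD2l -[leRHS]mulrA ler_wpM2l //; last by apply: HD; rewrite leqnn.
  by rewrite mulr_ge0.
rewrite -/Z -/N mulrDr in step.
have H3' := ler_wpM2l c0 H3.
have : L <= 2^-1 * L + (Cm * C1 + 2 ^+ m.+1 * (c * A) ^+ m.+2 * D + c * A * D) * n ^+ m.+2.
  apply: le_trans step _; apply: le_trans (lerD H1 (lerD H2 H3')) _.
  rewrite le_eqVlt; apply/orP; left; apply/eqP; ring.
by rewrite /C; lra.
Qed.

(** * Lattice paths *)

Section Lattice.
Variable d : nat.
Local Notation vtx := 'rV[int]_d.
Local Notation edge := {fset vtx}.
Implicit Types (x y z : vtx) (p q : seq vtx) (e : edge).

Lemma adj_shift a x y : adj (a + x) (a + y) = adj x y.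
Proof.
rewrite /adj /sqdist; congr (_ == _); apply: eq_bigr => i _.
by rewrite !mxE; congr (_ ^+ 2); ring.
Qed.

(** The entries of a unit step lie in {-1, 0, 1}, coded by ['I_3]; filtering these finitely many
    rows gives an explicit list. *)
Definition unit_steps : seq vtx :=
  [seq y <- codom (fun v : 'rV['I_3]_d => map_mx (fun i : 'I_3 => i%:Z - 1) v) | adj 0 y].

Definition nbrs x : seq vtx := undup [seq x + y | y <- unit_steps].

Lemma mem_unit_steps y : (y \in unit_steps) = adj 0 y.
Proof.
rewrite mem_filter andb_idr // => y1.
have yi i : (`|y 0%R i| <= 1)%N.
  have := y1; rewrite /adj /sqdist (bigD1 i) //= => /eqP H.
  have : 0 <= \sum_(j < d | j != i) ((0 : vtx) 0 j - y 0 j) ^+ 2.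
    by apply: sumr_ge0 => j _; exact: sqr_ge0.
  move: H; rewrite mxE sub0r sqrrN expr2; set S := \sum_(_ < _ | _) _ => H S0.
  move: H S0; move: (y 0 i) S => a S H S0; nia.
apply/codomP; exists (\row_i inord `|y 0 i + 1|).
apply/rowP => i; have E (a : int) : (`|a| <= 1)%N -> a = (absz (a + 1))%:Z - 1 by lia.
by rewrite !mxE inordK; [exact: E | have := yi i; lia].
Qed.

Lemma mem_nbrs x y : (y \in nbrs x) = adj x y.
Proof.
rewrite mem_undup -{2}(addr0 x) -[in RHS](subrK x y) [y - x + x]addrC adj_shift -mem_unit_steps.
by rewrite -{1}(subrK x y) addrC mem_map //; exact: addrI.
Qed.

Lemma path_edges_cat x p q :
  path_edges x (p ++ q) = path_edges x p ++ path_edges (last x p) q.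
Proof. exact: pairmap_cat. Qed.

Lemma mem_path_edges x p e v : e \in path_edges x p -> v \in e -> v \in x :: p.
Proof.
elim: p x => //= y p IH x; rewrite in_cons => /predU1P[->|eyp ve].
  by rewrite !inE => /orP[->|->]; rewrite ?orbT.
by rewrite in_cons IH ?orbT.
Qed.

(** The first edge contains the starting vertex, which no later edge of a self-avoiding path
    meets. *)
Lemma path_edges_uniq x p : uniq (x :: p) -> uniq (path_edges x p).
Proof.
elim: p x => //= y p IH x /andP[xyp yp]; rewrite IH // andbT.
apply: contra xyp => /mem_path_edges; apply.
by rewrite !inE eqxx.
Qed.

Lemma path_edges_edges x p e : path (@adj d) x p -> e \in path_edges x p -> edges e.
Proof.
elim: p x => //= y p IH x /andP[xy yp]; rewrite in_cons => /predU1P[->|]; last exact: IH.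
by exists x, y.
Qed.

Fixpoint walks n x : seq (seq vtx) :=
  if n is m.+1 then flatten [seq [seq y :: p | p <- walks m y] | y <- nbrs x]
  else [:: [::]].

Lemma mem_walks n x p : (p \in walks n x) = path (@adj d) x p && (size p == n).
Proof.
elim: n x p => [|n IH] x p /=; first by rewrite inE; case: p => //= *; rewrite andbF.
apply/flattenP/idP => [[_ /mapP[y yx ->] /mapP[q qy ->]]|].
  by move: qy; rewrite IH /= eqSS => /andP[-> ->]; rewrite -mem_nbrs yx.
case: p => [|y p] /=; first by [].
rewrite eqSS -andbA => /and3P[xy yp pn].
exists [seq y :: q | q <- walks n y]; last by apply: map_f; rewrite IH yp.
by apply/mapP; exists y => //; rewrite mem_nbrs.
Qed.

(** Loops are erased from the far end: if the new first vertex already lies on the erased tail,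
    everything before that visit is dropped. The same [q] serves all nonnegative weights. *)
Lemma loop_erase x p : path (@adj d) x p -> exists q,
  [/\ path (@adj d) x q, uniq (x :: q), last x q = last x p, (size q <= size p)%N &
   forall (R : numDomainType) (t : edge -> R), (forall e, 0 <= t e) ->
     \sum_(e <- path_edges x q) t e <= \sum_(e <- path_edges x p) t e].
Proof.
elim: p x => [|y p IH] x /=; first by exists [::].
move=> /andP[xy /IH[q [yq uq lq sq tq]]].
have [xyq|xyq] := boolP (x \in y :: q); last first.
  exists (y :: q); split => //=.
  - by rewrite xy.
  - by rewrite xyq.
  - by move=> R t t0; rewrite !big_cons lerD2l tq.
have [q1 [q2 E]] : exists q1 q2, y :: q = q1 ++ x :: q2.
  by case/splitPr: xyq => q1 q2; exists q1, q2.
exists q2; move: uq; rewrite E cat_uniq => /and3P[_ _ uq2].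
have : path (@adj d) x (y :: q) by rewrite /= xy.
rewrite E cat_path /= => /and3P[_ _ xq2]; split => //.
- by rewrite -lq -[last y q]/(last x (y :: q)) E last_cat.
- apply: leq_trans (leqW sq); rewrite -ltnS -[(size q).+1]/(size (y :: q)) E size_cat /=; lia.
move=> R t t0; rewrite big_cons; apply: (@le_trans _ _ (\sum_(e <- path_edges y q) t e));
  last first.
  by apply: le_trans (tq R t t0) _; rewrite lerDr.
case: q1 E => [|y' q1] /= [-> ->] //.
by rewrite path_edges_cat /= big_cat big_cons /= addrA lerDr addr_ge0 // sumr_ge0.
Qed.

Lemma path_to z : exists p, [/\ path (@adj d) 0 p, last 0 p = z & size p = (\sum_i `|z 0%R i|)%N].
Proof.
have [n] := ubnP (\sum_i `|z 0%R i|)%N; elim: n z => // n IH z zn.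
have [->|z0] := eqVneq z 0.
  by exists [::]; split => //; rewrite big1 // => i _; rewrite mxE.
have [i zi] : exists i, z 0 i != 0.
  apply/existsP; apply: contraNT z0; rewrite negb_exists => /forallP H.
  by apply/eqP/rowP => i; have := H i; rewrite negbK mxE => /eqP.
have [u uE] : exists u : vtx, forall j, u 0 j = if j == i then sgz (z 0 i) else 0.
  by exists (\row_j if j == i then sgz (z 0 i) else 0) => j; rewrite mxE.
have sgz_step (a : int) : a != 0 -> absz a = (absz (a - sgz a)).+1.
  by case: (sgzP a) => a0 a1; lia.
have E : (\sum_j `|z 0%R j| = (\sum_j `|(z - u)%R 0%R j|).+1)%N.
  rewrite (bigD1 i) //= [in RHS](bigD1 i) //= -addSn; congr (_ + _)%N.
    by rewrite !mxE uE eqxx; exact: sgz_step.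
  by apply: eq_bigr => j ji; rewrite !mxE uE (negPf ji) subr0.
have [|p [p1 p2 p3]] := IH (z - u); first by rewrite -ltnS -E.
exists (rcons p z); split; last by rewrite size_rcons p3 E.
  rewrite rcons_path p1 p2 /= /adj /sqdist (bigD1 i) //= big1 => [|j ji].
    rewrite addr0 !mxE uE eqxx addrAC subrr sub0r sqrrN.
    by move: zi; case: sgzP.
  rewrite !mxE uE (negPf ji); ring.
by rewrite last_rcons.
Qed.

End Lattice.

(** * The van den Berg-Kesten inequality *)

Definition ind (R : realType) (P : Prop) : R := `[< P >]%:R.

Lemma ind_ge0 (R : realType) P : 0 <= ind R P.
Proof. exact: ler0n. Qed.

Lemma ind_le1 (R : realType) P : ind R P <= 1.
Proof. by rewrite /ind; case: asboolP. Qed.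

Lemma ind_le (R : realType) (P Q : Prop) : (P -> Q) -> ind R P <= ind R Q.
Proof. by move=> PQ; rewrite /ind ler_nat; case: asboolP => // p; rewrite asboolT //;
  exact: PQ. Qed.

Lemma ind_true (R : realType) (P : Prop) : P -> ind R P = 1.
Proof. by move=> p; rewrite /ind asboolT. Qed.

Lemma ind_false (R : realType) (P : Prop) : ~ P -> ind R P = 0.
Proof. by move=> p; rewrite /ind asboolF. Qed.

Lemma ind_eq (R : realType) (P Q : Prop) : (P <-> Q) -> ind R P = ind R Q.
Proof. by move=> [pq qp]; apply/le_anti/andP; split; exact: ind_le. Qed.

Lemma indM (R : realType) (P Q : Prop) : ind R (P /\ Q) = ind R P * ind R Q.
Proof. by rewrite /ind asbool_and -natrM mulnb. Qed.

Lemma ind_le_sum (R : realType) (I : eqType) (r : seq I) (c : pred I) (P : Prop) (Q : I -> Prop) :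
  (P -> exists i, [/\ i \in r, c i & Q i]) -> ind R P <= \sum_(i <- r | c i) ind R (Q i).
Proof.
move=> H; have [/H[i [ir ci qi]]|nP] := pselect P; last first.
  by rewrite ind_false //; apply: sumr_ge0 => i _; exact: ind_ge0.
apply: le_trans (ind_le1 _ _) _; rewrite big_mkcond (big_rem i) //= ci ind_true // lerDl.
by apply: sumr_ge0 => j _; case: ifP => // _; exact: ind_ge0.
Qed.

Program Definition law_map (R : realType) (X Y : Type) (h : X -> Y) (mu : law R X) : law R Y :=
  @Law R Y (law_idx mu) (@law_wt _ _ mu) (h \o @law_val _ _ mu) _ _.
Next Obligation. by move=> *; exact: law_ge0. Qed.
Next Obligation. by move=> *; exact: law_sum. Qed.

Lemma Ex_map (R : realType) (K : eqType) (X Y : Type) (h : X -> Y) (mu : law R X)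
    (s : seq K) (f : (K -> Y) -> R) (x : K -> X) :
  Ex (law_map h mu) s f (h \o x) = Ex mu s (fun y => f (h \o y)) x.
Proof.
elim: s x => //= e s IH x; apply: eq_bigr => v _; rewrite -IH; congr (_ * Ex _ _ _ _).
by apply/funext => e'; rewrite /upd /=; case: ifP.
Qed.

Program Definition law_prod (R : realType) (X : Type) (mu : law R X) : law R (X * X) :=
  @Law R (X * X) (law_idx mu * law_idx mu)%type (fun v => law_wt v.1 * law_wt v.2)
    (fun v => (law_val v.1, law_val v.2)) _ _.
Next Obligation. by move=> *; rewrite mulr_ge0 // law_ge0. Qed.
Next Obligation.
move=> R X mu; rewrite -(pair_bigA _ (fun v w => law_wt v * law_wt w)) /=.
under eq_bigr do rewrite -mulr_sumr law_sum mulr1.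
exact: law_sum.
Qed.

Lemma E1_prod (R : realType) (K : eqType) (X : Type) (mu : law R X) (e : K)
    (f : (K -> X * X) -> R) z :
  E1 (law_prod mu) e f z = \sum_v \sum_w law_wt v *
    (law_wt w * f (upd z e (law_val (l := mu) v, law_val (l := mu) w))).
Proof.
rewrite /E1 pair_bigA /=; apply: eq_bigr => -[v w] _ /=.
by rewrite mulrA.
Qed.

Lemma Ex_law_prod (R : realType) (K : eqType) (X : Type) (mu : law R X)
    (s : seq K) (f g : (K -> X) -> R) (z : K -> X * X) :
  Ex (law_prod mu) s (fun z => f (fst \o z) * g (snd \o z)) z =
  Ex mu s f (fst \o z) * Ex mu s g (snd \o z).
Proof.
elim: s z => //= e s IH z.
have -> : Ex (law_prod mu) s (fun z => f (fst \o z) * g (snd \o z)) =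
    fun z => Ex mu s f (fst \o z) * Ex mu s g (snd \o z) by apply/funext.
rewrite E1_prod /E1 mulr_suml; apply: eq_bigr => v _.
rewrite mulr_sumr; apply: eq_bigr => w _.
have -> b c : fst \o upd z e (b, c) = upd (fst \o z) e b.
  by apply/funext => e'; rewrite /upd /=; case: ifP.
have -> b c : snd \o upd z e (b, c) = upd (snd \o z) e c.
  by apply/funext => e'; rewrite /upd /=; case: ifP.
ring.
Qed.

Section BK.
Variables (R : realType) (K : eqType) (mu : law R bool) (A B : seq K -> Prop).

(* Interpolates between disjoint occurrence in one configuration ([s] contains
   everything) and joint occurrence in two independent ones ([s] empty). *)
Let half_disjoint (s : seq K) (z : K -> bool * bool) : Prop :=
  exists k l, [/\ A k, B l, forall e, e \in s -> ~~ ((e \in k) && (e \in l)),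
    all (fst \o z) k & all (snd \o z) l].

(** All other coordinates being frozen, witnesses for the state where [e] is open cannot both use
    [e]. The copy whose witness avoids [e] may take any value there, so only the value of the other
    copy matters, and averaging over the idle one gives the inequality. *)
Let bk_step e s z :
  E1 (law_map (fun b => (b, b)) mu) e (fun z => ind R (half_disjoint (e :: s) z)) z <=
  E1 (law_prod mu) e (fun z => ind R (half_disjoint s z)) z.
Proof.
rewrite E1_prod /E1 /=.
pose F b := ind R (half_disjoint (e :: s) (upd z e (b, b))).
pose G b c := ind R (half_disjoint s (upd z e (b, c))).
have upd_all (k : seq K) (h : bool * bool -> bool) v w : e \notin k ->
    all (h \o upd z e v) k -> all (h \o upd z e w) k.
  move=> ek /allP H; apply/allP => e' e'k /=; have := H e' e'k.
  by rewrite /= !upd_neq //; apply: contraNneq ek => <-.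
have upd_all1 (k : seq K) b c c' : all (fst \o upd z e (b, c)) k ->
    all (fst \o upd z e (b, c')) k.
  by move=> /allP H; apply/allP => e' /H; rewrite /= /upd; case: ifP.
have upd_all2 (k : seq K) b b' c : all (snd \o upd z e (b, c)) k ->
    all (snd \o upd z e (b', c)) k.
  by move=> /allP H; apply/allP => e' /H; rewrite /= /upd; case: ifP.
have FG : (forall v w, F v <= G v w) \/ (forall v w, F w <= G v w).
  have [[k [l [Ak Bl kl kz lz]]]|nF] := pselect (half_disjoint (e :: s) (upd z e (true, true))).
    have kls e' : e' \in s -> ~~ ((e' \in k) && (e' \in l)).
      by move=> e's; apply: kl; rewrite in_cons e's orbT.
    have F0 b c : F false <= G b c.
      apply: ind_le => -[k' [l' [Ak' Bl' kl' kz' lz']]]; exists k', l'; split => //.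
      - by move=> e' e's; apply: kl'; rewrite in_cons e's orbT.
      - apply: (upd_all _ _ _ _ _ kz'); apply/negP => /(allP kz'); by rewrite /= upd_same.
      - apply: (upd_all _ _ _ _ _ lz'); apply/negP => /(allP lz'); by rewrite /= upd_same.
    have := kl e (mem_head _ _); rewrite negb_and => /orP[ek|el]; [right|left] => v w.
    - case: w; last exact: F0.
      apply: le_trans (ind_le1 _ _) _; rewrite /G ind_true //.
      by exists k, l; split => //; [exact: upd_all kz|exact: upd_all2 lz].
    - case: v; last exact: F0.
      apply: le_trans (ind_le1 _ _) _; rewrite /G ind_true //.
      by exists k, l; split => //; [exact: upd_all1 kz|exact: upd_all lz].
  (* If the event fails with [e] open, it fails by monotonicity for every value of [e], and [F] is
     zero. *)
  left => v w; rewrite /F ind_false ?ind_ge0 // => -[k [l [Ak Bl kl kz lz]]]; apply: nF.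
  exists k, l; split => //.
    by apply/allP => e' /(allP kz); rewrite /= /upd; case: ifP.
  by apply/allP => e' /(allP lz); rewrite /= /upd; case: ifP.
have -> : \sum_v law_wt v * ind R (half_disjoint (e :: s) (upd z e (law_val (l := mu) v, law_val
  (l := mu) v)))
    = \sum_v law_wt v * F (law_val (l := mu) v) by [].
case: FG => FG.
  apply: ler_sum => v _; rewrite -mulr_sumr ler_wpM2l ?law_ge0 //.
  rewrite -[leLHS]mul1r -(law_sum mu) mulr_suml; apply: ler_sum => w _.
  by rewrite ler_wpM2l ?law_ge0 ?FG.
rewrite exchange_big; apply: ler_sum => w _ /=.
under eq_bigr do rewrite mulrCA; rewrite -mulr_sumr ler_wpM2l ?law_ge0 //.
rewrite -[leLHS]mul1r -(law_sum mu) mulr_suml; apply: ler_sum => v _.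
by rewrite ler_wpM2l ?law_ge0 ?FG.
Qed.

Let bk_double s z : uniq s ->
  Ex (law_map (fun b => (b, b)) mu) s (fun z => ind R (half_disjoint s z)) z <=
  Ex (law_prod mu) s (fun z => ind R (half_disjoint [::] z)) z.
Proof.
elim: s z => //= e s IH z /andP[es us]; rewrite -Ex_E1.
apply: le_trans (Ex_le _ _ (bk_step e s) z) _.
by rewrite Ex_E1C //; apply: E1_le => y; exact: IH.
Qed.

(** Increasing events are given by families of witness lists: the event occurs when all elements of
    some list are open. Disjoint occurrence then means disjoint witnesses. *)
Lemma BK (s : seq K) (x : K -> bool) : uniq s ->
  Ex mu s (fun y => ind R (exists k l, [/\ A k, B l,
      forall e, e \in k -> e \notin l, all y k & all y l])) x <=
  Ex mu s (fun y => ind R (exists2 k, A k & all y k)) x *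
  Ex mu s (fun y => ind R (exists2 k, B k & all y k)) x.
Proof.
move=> us; have := bk_double ((fun b => (b, b)) \o x) us.
rewrite Ex_map => H.
apply: (@le_trans _ _ (Ex mu s (fun y => ind R (half_disjoint s ((fun b : bool => (b, b)) \o y)))
  x)).
  apply: Ex_le => y; apply: ind_le => -[k [l [Ak Bl kl ky ly]]]; exists k, l; split => //.
  by move=> e _; rewrite negb_and; case: (boolP (e \in k)) => //= /kl.
apply: le_trans H _.
have := @Ex_law_prod R K bool mu s (fun y => ind R (exists2 k, A k & all y k))
  (fun y => ind R (exists2 k, B k & all y k)) ((fun b : bool => (b, b)) \o x).
rewrite /= => <-; apply: Ex_le => z; rewrite -indM; apply: ind_le.
by move=> [k [l [Ak Bl _ kz lz]]]; split; [exists k|exists l].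
Qed.

End BK.

(** * Decay of open self-avoiding paths *)

Section MonotoneEvents.
Variables (R : realType) (K : eqType) (mu : law R bool).
Implicit Types (s : seq K) (f : (K -> bool) -> R).

Definition incr f := forall x y : K -> bool, (forall e, x e ==> y e) -> f x <= f y.

Lemma incr_Ex s f : incr f -> incr (Ex mu s f).
Proof.
move=> fi; elim: s => //= e s IH x y xy; apply: ler_sum => v _.
rewrite ler_wpM2l ?law_ge0 // IH // => e'; rewrite /upd; case: ifP => //.
by rewrite implybb.
Qed.

(** The base point of the expectations: whatever is not integrated counts as closed. *)
Definition closed_cfg : K -> bool := fun=> false.

(** Coordinates outside [s] are closed on the left; integrating over [s'] as well opens some of them
    at random, which can only help an increasing function. *)
Lemma Ex_closed_le s s' f : incr f -> dep s' f ->
  Ex mu s f closed_cfg <= Ex mu s' f closed_cfg.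
Proof.
move=> fi fs'.
have E : Ex mu s' f = fun=> Ex mu s' f closed_cfg.
  by apply/funext => x; exact: Ex_dep_cst.
apply: (@le_trans _ _ (Ex mu s' (Ex mu s f) closed_cfg)).
  have -> : Ex mu s f closed_cfg = Ex mu s' (fun=> Ex mu s f closed_cfg) closed_cfg by rewrite
    Ex_cst.
  by apply: Ex_le => x; exact: incr_Ex.
by rewrite ExC E Ex_cst.
Qed.

End MonotoneEvents.

Section Percolation.
Variable d : nat.
Local Notation vtx := 'rV[int]_d.
Local Notation edge := {fset vtx}.
Implicit Types (x y z : vtx) (p q : seq vtx) (e : edge) (w : edge -> bool).

Definition shift y e : edge := [fset (y + v)%R | v in e]%fset.

Lemma shift_pair y a b : shift y [fset a; b]%fset = [fset (y + a)%R; (y + b)%R]%fset.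
Proof.
apply/fsetP => v; rewrite !inE; apply/imfsetP/orP => /= [[u]|].
  by rewrite !inE => /orP[/eqP ->|/eqP ->] ->; rewrite eqxx; [left|right].
by case=> /eqP ->; [exists a|exists b] => //; rewrite !inE eqxx ?orbT.
Qed.

Lemma shift_inj y : injective (shift y).
Proof.
move=> e e' /fsetP E; apply/fsetP => v.
have H (e0 : edge) : (y + v \in shift y e0) = (v \in e0).
  apply/imfsetP/idP => /= [[u ue /addrI ->] //|ve]; by exists v.
by have := E (y + v); rewrite !H.
Qed.

Lemma path_edges_shift y x p :
  path_edges (y + x) [seq y + v | v <- p] = [seq shift y e | e <- path_edges x p].
Proof. by elim: p x => //= v p IH x; rewrite -IH -shift_pair. Qed.

Lemma path_shift y x p : path (@adj d) (y + x) [seq y + v | v <- p] = path (@adj d) x p.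
Proof. by elim: p x => //= v p IH x; rewrite IH adj_shift. Qed.

Definition saw_open y n w : Prop := exists p,
  [/\ path (@adj d) y p, uniq (y :: p), size p = n & all w (path_edges y p)].

Definition touching (S : {fset vtx}) : seq edge :=
  undup [seq [fset x; y]%fset | x <- S, y <- nbrs x].

Lemma mem_touching (S : {fset vtx}) x p e : path (@adj d) x p ->
  all (mem S) (belast x p) -> e \in path_edges x p -> e \in touching S.
Proof.
elim: p x => //= y p IH x /andP[xy yp] /andP[xS pS]; rewrite in_cons => /predU1P[->|];
  last exact: IH.
by rewrite mem_undup; apply/allpairsPdep; exists x, y; split; rewrite ?mem_nbrs.
Qed.

Definition exits_through (S : {fset vtx}) x z w : Prop := exists p,
  [/\ path (@adj d) 0 (rcons p z), all (mem S) (0 :: p), last 0 p = x &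
      all w (path_edges 0 (rcons p z))].

(* Duminil-Copin and Tassion's [phi_p(S)]: the factor [p] of the exit edge is part of
   the event. *)
Definition phi (R : realType) (mu : law R bool) (S : {fset vtx}) : R :=
  \sum_(x <- S) \sum_(z <- nbrs x | z \notin S)
    Ex mu (touching S) (fun w => ind R (exits_through S x z w)) (@closed_cfg _).

Lemma exits_through_incr (R : realType) S x z : incr (fun w => ind R (exits_through S x z w)).
Proof.
move=> w w' ww'; apply: ind_le => -[p [p1 p2 p3 p4]]; exists p; split => //.
by apply: sub_all p4 => e; exact/implyP.
Qed.

Lemma exits_through_dep (R : realType) S x z :
  dep (touching S) (fun w => ind R (exits_through S x z w)).
Proof.
suff H w w' : {in touching S, w =1 w'} -> exits_through S x z w -> exits_through S x z w'.
  by move=> w w' ww'; apply: ind_eq; split; apply: H => // e eS; rewrite ww'.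
move=> ww' [p [p1 p2 p3 p4]]; exists p; split => //.
apply/allP => e ep; rewrite -ww'; first exact: (allP p4).
by apply: mem_touching ep => //; rewrite belast_rcons.
Qed.

Lemma split_first (T : Type) (P : pred T) (s : seq T) : ~~ all P s ->
  exists s1 a s2, [/\ s = s1 ++ a :: s2, all P s1 & ~~ P a].
Proof.
elim: s => //= a s IH; rewrite negb_and; have [Pa /= /IH|nPa _] := boolP (P a).
  by move=> [s1 [b [s2 [-> s1P nPb]]]]; exists (a :: s1), b, s2; rewrite /= Pa.
by exists [::], a, s.
Qed.

Lemma path_edges_take y p n : path_edges y (take n p) = take n (path_edges y p).
Proof. by elim: p y n => [|v p IH] y [|n] //=; rewrite IH. Qed.

(** A path with at least #|S| edges has too many vertices to stay in the translate of [S]. It is cut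
    at its first exit, which takes at most #|S| steps, and the rest is shortened to n - #|S| edges.
    Self-avoidance makes the two pieces edge-disjoint, as required by [BK]. *)
Lemma saw_exit (S : {fset vtx}) y n w : 0 \in S -> (#|` S| <= n)%N -> saw_open y n w ->
  exists x, x \in S /\ exists z, [/\ z \in nbrs x, z \notin S &
  exists k l, [/\ exists p, [/\ path (@adj d) 0 (rcons p z), all (mem S) (0 :: p),
                                last 0 p = x & k = [seq shift y e | e <- path_edges 0 (rcons p z)]],
                  exists p, [/\ path (@adj d) (y + z) p, uniq ((y + z) :: p),
                                size p = (n - #|` S|)%N & l = path_edges (y + z) p],
                  forall e, e \in k -> e \notin l, all w k & all w l]].
Proof.
move=> S0 Sn [p' [p1' p2' p3' p4']].
have [p p'E] : exists p, p' = [seq y + v | v <- p].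
  exists [seq - y + v | v <- p']; rewrite -map_comp -[LHS]map_id.
  by apply: eq_map => v /=; rewrite addrA subrr add0r.
have p1 : path (@adj d) 0 p by rewrite -(path_shift y) addr0 -p'E.
have p2 : uniq (0 :: p) by rewrite -(map_inj_uniq (@addrI _ y)) /= addr0 -p'E.
have p3 : size p = n by rewrite -p3' p'E size_map.
have p4 : all w [seq shift y e | e <- path_edges 0 p].
  by rewrite -path_edges_shift addr0 -p'E.
have : ~~ all (mem S) p.
  apply/negP => pS; have : (size (0%R :: p) <= #|` S|)%N.
    by apply: uniq_leq_size => // v; rewrite in_cons => /predU1P[->|/(allP pS)].
  by rewrite /= p3 ltnNge Sn.
move=> /split_first[q [z [r [pE qS zS]]]].
have q0S : all (mem S) (0 :: q) by rewrite /= S0.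
have xS : last 0 q \in S by apply: (allP q0S); exact: mem_last.
move: p1; rewrite pE -cat_rcons cat_path last_rcons => /andP[qz zr].
exists (last 0 q); split => //; exists z; split => //.
  by rewrite mem_nbrs; move: qz; rewrite rcons_path => /andP[].
have := path_edges_uniq p2;
  rewrite pE -cat_rcons path_edges_cat last_rcons cat_uniq => /and3P[_ dis _].
move: p4; rewrite pE -cat_rcons path_edges_cat last_rcons map_cat all_cat => /andP[wk wl].
have qsz : (size q < #|` S|)%N.
  have /= : (size (0%R :: q) <= #|` S|)%N => //.
  apply: uniq_leq_size; last by move=> v; exact: (allP q0S).
  by move: p2; rewrite pE -cat_cons cat_uniq => /and3P[].
have rsz : (n - #|` S| <= size r)%N.
  by rewrite leq_subLR -p3 pE size_cat /= addnS -addSn leq_add2r.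
exists [seq shift y e | e <- path_edges 0 (rcons q z)],
   (path_edges (y + z) [seq y + v | v <- take (n - #|` S|) r]).
split => //.
- by exists q.
- exists [seq y + v | v <- take (n - #|` S|) r]; split => //.
  + by rewrite path_shift take_path.
  + rewrite -map_cons map_inj_uniq; last exact: addrI.
    apply: (@subseq_uniq _ _ (0 :: p)) => //; rewrite pE.
    apply: subseq_trans (suffix_subseq (0 :: q) _) => /=.
    by rewrite eqxx take_subseq.
  + by rewrite size_map size_takel.
- move=> e ek; rewrite path_edges_shift path_edges_take.
  apply/negP => /mapP[e1 /mem_take e1r eE]; move: ek; rewrite eE (mem_map (@shift_inj y)) => e1q.
  by move/hasPn: dis => /(_ e1 e1r); rewrite /= e1q.
- rewrite path_edges_shift path_edges_take map_take; apply/allP => e /mem_take; exact: (allP wl).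
Qed.

Lemma saw_decay (R : realType) (mu : law R bool) (S : {fset vtx}) (s : seq edge) k y n :
  0 \in S -> uniq s -> (k * #|` S| <= n)%N ->
  Ex mu s (fun w => ind R (saw_open y n w)) (@closed_cfg _) <= phi mu S ^+ k.
Proof.
move=> S0 us; elim: k y n => [|k IH] y n kn.
  rewrite expr0; apply: (@le_trans _ _ (Ex mu s (fun=> 1) (@closed_cfg _))).
    by apply: Ex_le => w; exact: ind_le1.
  by rewrite Ex_cst.
have Sn : (#|` S| <= n)%N by apply: leq_trans kn; rewrite mulSn leq_addr.
pose A x z k := exists p, [/\ path (@adj d) 0 (rcons p z), all (mem S) (0 :: p),
  last 0 p = x & k = [seq shift y e | e <- path_edges 0 (rcons p z)]].
pose B z l := exists p, [/\ path (@adj d) (y + z) p, uniq ((y + z) :: p),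
  size p = (n - #|` S|)%N & l = path_edges (y + z) p].
pose D x z w := exists k l, [/\ A x z k, B z l, forall e, e \in k -> e \notin l, all w k & all w l].
apply: (@le_trans _ _ (Ex mu s (fun w => \sum_(x <- S) \sum_(z <- nbrs x | z \notin S)
    ind R (D x z w)) (@closed_cfg _))).
  apply: Ex_le => w.
  apply: (@le_trans _ _ (\sum_(x <- S) ind R (exists z, [/\ z \in nbrs x, z \notin S & D x z w]))).
    apply: ind_le_sum => /(saw_exit S0 Sn)[x [xS H]]; exists x; split => //.
  by apply: ler_sum => x _; apply: ind_le_sum => -[z [zx zS H]]; exists z.
rewrite Ex_sum exprS /phi mulr_suml; apply: ler_sum => x _.
rewrite Ex_sum mulr_suml; apply: ler_sum => z _.
apply: le_trans (BK mu (A x z) (B z) _ us) _.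
apply: ler_pM; try by apply: Ex_ge0 => w; exact: ind_ge0.
  set g := fun w => ind R (exits_through S x z w).
  apply: (@le_trans _ _ (Ex mu s (fun w => g (w \o shift y)) (@closed_cfg _))).
    apply: Ex_le => w; apply: ind_le => -[_ [p [p1 p2 p3 ->]] wk].
    by exists p; split => //; move: wk; rewrite all_map.
  (* Translated edges missing from [s] count as closed, so integrating over exactly the translate of
     [touching S] can only increase the mean; by translation the result is a term of [phi]. *)
  apply: le_trans (@Ex_closed_le _ _ mu s (map (shift y) (touching S)) _ _ _) _.
  - by move=> w w' ww'; apply: exits_through_incr => e; exact: ww'.
  - move=> w w' ww'; apply: exits_through_dep => e eS /=; apply: ww'; exact: map_f.
  by rewrite Ex_transport //; exact: shift_inj.
apply: le_trans (IH (y + z) (n - #|` S|)%N _); last by rewrite leq_subRL // -mulSn.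
apply: Ex_le => w; apply: ind_le => -[_ [p [p1 p2 p3 ->]] wl].
by exists p.
Qed.

End Percolation.

(** * Sharpness of the phase transition *)

Section Russo.
Variables (R : realType) (K : eqType).
Implicit Types (s : seq K) (f : (K -> bool) -> R) (x : K -> bool) (p q : R).

Program Definition bern p (p01 : 0 <= p <= 1) : law R bool :=
  @Law R bool bool (fun b => if b then p else 1 - p) id _ _.
Next Obligation. by move=> p /andP[p0 p1] [] //; rewrite subr_ge0. Qed.
Next Obligation. by move=> p _; rewrite big_bool /=; lra. Qed.

(* [Ex] for a Bernoulli law, as a polynomial in a parameter not restricted to [0, 1]. *)
Definition Bx p s f : (K -> bool) -> R :=
  foldr (fun e f x => p * f (upd x e true) + (1 - p) * f (upd x e false)) f s.

Lemma Ex_bern p (p01 : 0 <= p <= 1) s f : Ex (bern p01) s f = Bx p s f.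
Proof.
elim: s => //= e s ->; apply/funext => x.
by rewrite /E1 big_bool.
Qed.

Definition pivot e f x := f (upd x e true) - f (upd x e false).

Lemma Bx_pivot p s e f x : e \notin s ->
  Bx p s (pivot e f) x = Bx p s f (upd x e true) - Bx p s f (upd x e false).
Proof.
elim: s x => //= e' s IH x; rewrite in_cons negb_or eq_sym => /andP[ee' es].
by rewrite !IH // !(updC _ _ _ ee'); lra.
Qed.

(** Product rule along [s]: differentiating the weights of [e] leaves the difference of the two
    values at [e], which is the mean of [pivot]. *)
Lemma russo p s f x : uniq s ->
  is_derive p 1 (fun p => Bx p s f x) (\sum_(e <- s) Bx p s (pivot e f) x).
Proof.
elim: s x => [|e s IH] x /=; first by rewrite big_nil => _; exact: is_derive_cst.
move=> /andP[es us].
have D1 := IH (upd x e true) us; have D0 := IH (upd x e false) us.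
apply: is_derive_eq.
rewrite big_cons big_split /= -!mulr_sumr.
have -> : p * Bx p s (pivot e f) (upd x e true) + (1 - p) * Bx p s (pivot e f) (upd x e false) =
   Bx p s f (upd x e true) - Bx p s f (upd x e false).
  by rewrite !Bx_pivot // !upd_upd; ring.
rewrite /GRing.scale /=; ring.
Qed.

Lemma Bx_le_incr p q s f x : 0 <= p -> p <= q -> q <= 1 -> incr f -> Bx p s f x <= Bx q s f x.
Proof.
move=> p0 pq q1 fi.
have p01 : 0 <= p <= 1 by apply/andP; split => //; lra.
have q01 : 0 <= q <= 1 by apply/andP; split => //; lra.
elim: s x => //= e s IH x.
have H : Bx p s f (upd x e false) <= Bx p s f (upd x e true).
  rewrite -(Ex_bern p01); apply: incr_Ex => // e'; rewrite /upd.
  by case: ifP => //; rewrite implybb.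
have H1 := IH (upd x e true); have H0 := IH (upd x e false).
nra.
Qed.

End Russo.

Section Sharpness.
Variables (R : realType) (d : nat).
Local Notation vtx := 'rV[int]_d.
Local Notation edge := {fset vtx}.
Implicit Types (x y z : vtx) (p q : seq vtx) (e : edge) (w : edge -> bool) (L S : {fset vtx}).

Definition escapes L x w : Prop := exists p,
  [/\ path (@adj d) x p, all (mem L) (belast x p), last x p \notin L & all w (path_edges x p)].

Lemma escapes_incr L x : incr (fun w => ind R (escapes L x w)).
Proof.
move=> w w' ww'; apply: ind_le => -[p [p1 p2 p3 p4]]; exists p; split => //.
by apply: sub_all p4 => e; exact/implyP.
Qed.

Lemma escapes_dep L x : dep (touching L) (fun w => ind R (escapes L x w)).
Proof.
suff H w w' : {in touching L, w =1 w'} -> escapes L x w -> escapes L x w'.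
  by move=> w w' ww'; apply: ind_eq; split; apply: H => // e eS; rewrite ww'.
move=> ww' [p [p1 p2 p3 p4]]; exists p; split => //.
apply/allP => e ep; rewrite -ww'; first exact: (allP p4).
exact: mem_touching ep.
Qed.

Lemma escapes_out L x w : x \notin L -> escapes L x w.
Proof. by exists [::]. Qed.

Lemma escapes_cons L x y w : adj x y -> w [fset x; y]%fset -> escapes L y w -> escapes L x w.
Proof.
move=> xy wxy [p [p1 p2 p3 p4]]; have [xL|] := boolP (x \in L); last exact: escapes_out.
by exists (y :: p); split => //=; rewrite ?xy ?wxy //= xL.
Qed.

Definition conn S x w : Prop := exists p,
  [/\ path (@adj d) 0 p, all (mem S) (0 :: p), last 0 p = x & all w (path_edges 0 p)].

(** The random set of Duminil-Copin and Tassion. It is found by exploring from outside [L], hence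
    without examining the edges inside it. *)
Definition trapped L w : {fset vtx} := [fset x in L | ~~ `[< escapes L x w >]]%fset.

Lemma trappedP L w x : reflect (x \in L /\ ~ escapes L x w) (x \in trapped L w).
Proof.
rewrite !inE /=; apply: (iffP andP) => -[xL H]; split => //.
  by move=> /asboolP; apply/negP.
by apply/negP => /asboolP.
Qed.

(** An open path to the outside of [L] never visits [S], so it does not use [e]. Both inclusions
    follow by induction from the far end of such a path. *)
Lemma trapped_upd L S w w' e : trapped L w = S -> {subset e <= S} ->
  (forall e', e' != e -> w e' = w' e') -> trapped L w' = S.
Proof.
move=> wS eS ww'.
have off x y : x \notin S \/ y \notin S -> w [fset x; y]%fset = w' [fset x; y]%fset.
  move=> H; apply: ww'; apply/negP => /eqP E.
  by case: H => /negP; apply; apply: eS; rewrite -E !inE eqxx ?orbT.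
have SL x : x \notin L -> x \notin S.
  by apply: contra; rewrite -wS => /trappedP[].
have out x : x \notin S -> escapes L x w.
  rewrite -wS => /trappedP H; apply: contrapT => nx.
  by apply: (nx); apply: escapes_out; apply/negP => xL; apply: H; split.
have esc x : escapes L x w -> x \notin S.
  by move=> xw; rewrite -wS; apply/trappedP => -[].
have A1 p x : path (@adj d) x p -> last x p \notin L -> all w' (path_edges x p) -> x \notin S.
  elim: p x => [|y p IH] x /=; first by move=> _ /SL.
  move=> /andP[xy yp] lp /andP[wxy wp]; have yS := IH y yp lp wp.
  apply: esc; apply: escapes_cons xy _ (out _ yS).
  by rewrite off //; right.
have A2 p x : path (@adj d) x p -> last x p \notin L -> all w (path_edges x p) -> escapes L x w'.
  elim: p x => [|y p IH] x /=; first by move=> _ /escapes_out.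
  move=> /andP[xy yp] lp /andP[wxy wp]; have yw' := IH y yp lp wp.
  apply: (escapes_cons xy _ yw'); rewrite -off //; right.
  have yin : escapes L y w.
    elim: p y yp lp wp {xy wxy yw' IH} => [|v p IH] y /=; first by move=> _ /escapes_out.
    by move=> /andP[yv vp] lp /andP[wyv wp]; apply: escapes_cons yv wyv (IH _ vp lp wp).
  exact: esc.
apply/fsetP => x; apply/trappedP/idP => [[xL xw']|xS].
  have := xw'; apply: contra_notT => xS.
  by have [p [p1 _ p3 p4]] := out _ xS; exact: A2 p1 p3 p4.
split; first by move: xS; rewrite -wS => /trappedP[].
move=> [p [p1 _ p3 p4]]; move: xS; apply/negP; exact: A1 p1 p3 p4.
Qed.

Lemma pivot_ge0 e (f : (edge -> bool) -> R) w : incr f -> 0 <= pivot e f w.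
Proof.
move=> fi; rewrite subr_ge0; apply: fi => e'; rewrite /upd.
by case: ifP => //; rewrite implybb.
Qed.

(** The origin reaches [x] inside the trapped set and [z] escapes, so opening the edge between them
    frees the origin; with the edge closed the origin stays trapped, as it is in [w]. *)
Lemma exit_pivotal L x z w : 0 \in trapped L w -> z \in nbrs x -> z \notin trapped L w ->
  conn (trapped L w) x w -> pivot [fset x; z]%fset (fun w => ind R (escapes L 0 w)) w = 1.
Proof.
move=> /trappedP[_ n0]; rewrite mem_nbrs => xz /trappedP zS [p [p1 p2 p3 p4]].
have wle b : (forall e, upd w [fset x; z]%fset false e ==> w e) /\
   (forall e, w e ==> upd w [fset x; z]%fset true e).
  by split => e; rewrite /upd; case: ifP => _; rewrite ?implybb ?implybT.
rewrite /pivot (ind_true R (P := escapes L 0 (upd w _ true))); last first.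
  have [r [r1 r2 r3 r4]] : escapes L z w.
    by apply: contrapT => nz; apply: zS; split => //; apply: contrapT => /negP/escapes_out/nz.
  exists (p ++ z :: r); rewrite cat_path p1 p3 /= xz r1; split => //.
  - have SL v : v \in 0 :: p -> v \in L by move=> /(allP p2)/trappedP[].
    rewrite belast_cat all_cat /= p3 r2 andbT; apply/andP; split.
      by apply/allP => v /mem_belast /SL.
    by apply: SL; rewrite -p3 mem_last.
  - by rewrite last_cat.
  - rewrite path_edges_cat all_cat p3 /= upd_same /=.
    by apply/andP; split; [move: p4|move: r4]; apply: sub_all => e; apply/implyP; case: (wle true).
rewrite ind_false ?subr0 // => -[p' [q1 q2 q3 q4]]; apply: n0; exists p'; split => //.
by apply: sub_all q4 => e; apply/implyP; case: (wle true).
Qed.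

(** A boundary edge has exactly one endpoint in [S], so distinct boundary pairs give distinct edges,
    and those whose inner endpoint is connected to the origin are pivotal. *)
Lemma sum_pivot_ge L S w : trapped L w = S -> 0 \in S ->
  \sum_(x <- S) \sum_(z <- nbrs x | z \notin S) ind R (conn S x w) <=
  \sum_(e <- touching L) pivot e (fun w => ind R (escapes L 0 w)) w.
Proof.
move=> wS S0; set f := fun w => _.
pose prs := [seq (x, z) | x <- S, z <- [seq z <- nbrs x | z \notin S]].
have prsP u : u \in prs -> [/\ u.1 \in S, u.2 \in nbrs u.1 & u.2 \notin S].
  by move=> /allpairsPdep[x [z [xS]]]; rewrite mem_filter => /andP[zS zx] ->.
have prs_uniq : uniq prs.
  apply: allpairs_uniq_dep; first exact: fset_uniq.
    by move=> x _; rewrite filter_uniq // undup_uniq.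
  by move=> [x z] [x' z'] _ _ /= [-> ->].
pose ed (u : vtx * vtx) := [fset u.1; u.2]%fset.
have ed_inj : {in prs &, injective ed}.
  move=> [x z] [x' z'] /prsP[/= xS _ zS] /prsP[/= xS' _ zS'] /fsetP E.
  have := E x; rewrite !inE eqxx /= => /esym/orP[/eqP xx'|/eqP xz']; last first.
    by move: zS'; rewrite -xz' xS.
  have := E z; rewrite !inE eqxx orbT => /esym/orP[/eqP zx'|/eqP zz']; last first.
    by rewrite xx' zz'.
  by move: zS; rewrite zx' xS'.
have -> : \sum_(x <- S) \sum_(z <- nbrs x | z \notin S) ind R (conn S x w) =
    \sum_(u <- prs) ind R (conn S u.1 w).
  rewrite big_allpairs_dep /=; apply: eq_bigr => x _.
  by rewrite big_filter.
apply: (@le_trans _ _ (\sum_(e <- map ed prs) pivot e f w)).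
  rewrite big_map !big_seq; apply: ler_sum => u /prsP[uS uz zS].
  have [cu|ncu] := pselect (conn S u.1 w); last first.
    by rewrite ind_false // pivot_ge0 //; exact: escapes_incr.
  apply: le_trans (ind_le1 _ _) _.
  by rewrite /f exit_pivotal // wS.
have us : uniq (map ed prs) by rewrite map_inj_in_uniq.
have sub : {subset map ed prs <= touching L}.
  move=> _ /mapP[u /prsP[uS uz zS] ->]; rewrite mem_undup; apply/allpairsPdep.
  by exists u.1, u.2; split => //; move: uS; rewrite -wS => /trappedP[].
rewrite [leRHS](bigID (mem (map ed prs))) /= -[X in X + _]big_filter.
have -> : \sum_(e <- [seq e <- touching L | e \in map ed prs]) pivot e f w =
    \sum_(e <- map ed prs) pivot e f w.
  apply: perm_big; apply: uniq_perm => //; first by rewrite filter_uniq // undup_uniq.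
  by move=> e; rewrite mem_filter /= andb_idr //; exact: sub.
by rewrite lerDl; apply: sumr_ge0 => e _; apply: pivot_ge0; exact: escapes_incr.
Qed.

Lemma conn_dep S x : dep (touching S) (fun w => ind R (conn S x w)).
Proof.
suff H w w' : {in touching S, w =1 w'} -> conn S x w -> conn S x w'.
  by move=> w w' ww'; apply: ind_eq; split; apply: H => // e eS; rewrite ww'.
move=> ww' [p [p1 p2 p3 p4]]; exists p; split => //.
apply/allP => e ep; rewrite -ww'; first exact: (allP p4).
apply: mem_touching ep => //; apply/allP => v /mem_belast; exact: (allP p2).
Qed.

Lemma dep_sub (s s' : seq edge) (f : (edge -> bool) -> R) :
  {subset s <= s'} -> dep s f -> dep s' f.
Proof. by move=> ss fs x y xy; apply: fs => e /ss /xy. Qed.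

Lemma touching_sub L S : (S `<=` L)%fset -> {subset touching S <= touching L}.
Proof.
move=> /fsubsetP SL e; rewrite !mem_undup => /allpairsPdep[x [y [xS xy ->]]].
by apply/allpairsPdep; exists x, y; split => //; exact: SL.
Qed.

(** An edge inside [S] does not influence whether the trapped set is [S], and any other edge does
    not influence connections within [S]: the two factors are independent. *)
Lemma Ex_trapped_conn (mu : law R bool) L S x w0 : (S `<=` L)%fset ->
  Ex mu (touching L) (fun w => ind R (trapped L w = S) * ind R (conn S x w)) w0 =
  Ex mu (touching L) (fun w => ind R (trapped L w = S)) w0 *
  Ex mu (touching S) (fun w => ind R (conn S x w)) (@closed_cfg _).
Proof.
move=> SL; rewrite Ex_prod; last first.
  move=> e _; have [eS|eS] := boolP (e `<=` S)%fset.
    left=> w v; apply: ind_eq; split => H; apply: trapped_upd H _ _; try exact/fsubsetP/eS.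
      by move=> e' ee'; rewrite upd_neq.
    by move=> e' ee'; rewrite upd_neq.
  right; suff H w w' : (forall e', e' != e -> w e' = w' e') -> conn S x w -> conn S x w'.
    by move=> w v; apply: ind_eq; split; apply: H => e' ee'; rewrite upd_neq.
  move=> ww' [p [p1 p2 p3 p4]]; exists p; split => //.
  apply/allP => e' ep; rewrite -ww'; first exact: (allP p4).
  apply: contraNneq eS => <-; apply/fsubsetP => v /(mem_path_edges ep); exact: (allP p2).
congr (_ * _); apply: Ex_marginal; last exact: conn_dep.
exact: dep_sub (touching_sub SL) (@conn_dep _ _).
Qed.

(** The differential inequality theta' >= 1 - theta for the escape probability. The event that the
    origin is trapped is decomposed according to the trapped set [S], and each [S] contributes its
    probability times at least [phi mu S]. *)
Lemma sum_pivot_expectation (mu : law R bool) L : 0 \in L ->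
  (forall S, 0 \in S -> (S `<=` L)%fset -> 1 <= phi mu S) ->
  1 - Ex mu (touching L) (fun w => ind R (escapes L 0 w)) (@closed_cfg _) <=
  \sum_(e <- touching L) Ex mu (touching L)
    (pivot e (fun w => ind R (escapes L 0 w))) (@closed_cfg _).
Proof.
move=> L0 phi1; set c := @closed_cfg _; set s := touching L.
have trL w : trapped L w \in fpowerset L.
  by rewrite fpowersetE; apply/fsubsetP => x /trappedP[].
have -> : 1 - Ex mu s (fun w => ind R (escapes L 0 w)) c =
    Ex mu s (fun w => \sum_(S <- fpowerset L | 0 \in S) ind R (trapped L w = S)) c.
  have -> : (fun w => \sum_(S <- fpowerset L | 0 \in S) ind R (trapped L w = S)) =
      (fun w => 1 - ind R (escapes L 0 w)).
    apply/funext => w; rewrite big_mkcond (big_fsetD1 _ (trL w)) /= ind_true // big_seq big1.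
      rewrite addr0; case: ifPn => [/trappedP[_ nw]|/trappedP nw].
        by rewrite ind_false // subr0.
      rewrite ind_true ?subrr //; apply: contrapT => nw'; exact: nw.
    move=> S; rewrite !inE => /andP[/eqP SE _]; case: ifP => // _.
    by rewrite ind_false // => E; exact/SE/esym.
  by rewrite ExB Ex_cst.
apply: (@le_trans _ _ (Ex mu s (fun w => \sum_(S <- fpowerset L | 0 \in S)
    \sum_(x <- S) \sum_(z <- nbrs x | z \notin S)
      (ind R (trapped L w = S) * ind R (conn S x w))) c)).
  rewrite !Ex_sum big_seq_cond [leRHS]big_seq_cond; apply: ler_sum => S /andP[].
  rewrite fpowersetE => SL S0; rewrite Ex_sum.
  have -> : \sum_(x <- S) Ex mu s (fun w => \sum_(z <- nbrs x | z \notin S)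
      (ind R (trapped L w = S) * ind R (conn S x w))) c =
    Ex mu s (fun w => ind R (trapped L w = S)) c * \sum_(x <- S) \sum_(z <- nbrs x | z \notin S)
      Ex mu (touching S) (fun w => ind R (conn S x w)) c.
    rewrite mulr_sumr; apply: eq_bigr => x _; rewrite Ex_sum mulr_sumr.
    by apply: eq_bigr => z _; exact: Ex_trapped_conn.
  rewrite ler_peMr //; first by apply: Ex_ge0 => w; exact: ind_ge0.
  (* [phi] also asks that the exit edge be open; forgetting this only increases the terms. *)
  apply: le_trans (phi1 S S0 SL) _; apply: ler_sum => x _; apply: ler_sum => z _.
  apply: Ex_le => w; apply: ind_le => -[p [p1 p2 p3 p4]]; exists p.
  move: p1 p4; rewrite rcons_path => /andP[p1 _]; rewrite -cats1 path_edges_cat all_cat.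
  by move=> /andP[p4 _]; split.
have := @Ex_sum _ _ _ mu s _ s xpredT (fun e => pivot e (fun w => ind R (escapes L 0 w))).
move=> /(congr1 (fun h => h c)) /= <-; apply: Ex_le => w.
have [T0|T0] := boolP (0 \in trapped L w); last first.
  rewrite big1 => [|S S0]; first by apply: sumr_ge0 => e _; apply: pivot_ge0; exact: escapes_incr.
  rewrite big1 // => x _; rewrite big1 // => z _; rewrite ind_false ?mul0r // => E.
  by move: T0; rewrite E S0.
apply: le_trans (sum_pivot_ge (erefl (trapped L w)) T0).
rewrite big_mkcond (big_fsetD1 _ (trL w)) /= T0 [X in _ + X]big_seq [X in _ + X]big1 ?addr0.
  apply: ler_sum => x _; apply: ler_sum => z _.
  by rewrite ind_true // mul1r.
move=> S; rewrite !inE => /andP[/eqP SE _]; case: ifP => // _.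
rewrite big1 // => x _; rewrite big1 // => z _; rewrite ind_false ?mul0r // => E.
exact/SE/esym.
Qed.

(** The mean value theorem and monotonicity give theta(p2) >= (p2 - p1) (1 - theta(p2)); solving for
    theta(p2) gives a lower bound independent of [L]. *)
Lemma sharpness L (p1 p2 : R) (h1 : 0 <= p1 <= 1) (h2 : 0 <= p2 <= 1) : p1 < p2 -> 0 \in L ->
  (forall S, 0 \in S -> (S `<=` L)%fset -> 1 <= phi (bern h1) S) ->
  (p2 - p1) / (1 + (p2 - p1)) <=
    Ex (bern h2) (touching L) (fun w => ind R (escapes L 0 w)) (@closed_cfg _).
Proof.
move=> p12 L0 phi1; set s := touching L; set f := fun w => _; set c := @closed_cfg _.
have us : uniq s by exact: undup_uniq.
pose th r := Bx r s f c; pose th' r := \sum_(e <- s) Bx r s (pivot e f) c.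
have dth (r : R) : is_derive r (1 : R) th (th' r) by exact: russo.
have [|r] := @MVT R th th' p1 p2 p12.
  by apply: derivable_within_continuous => r _; case: (dth r).
rewrite in_itv /= => /andP[p1r rp2] E.
have r01 : 0 <= r <= 1 by lra.
have H1 : 1 - th r <= th' r.
  rewrite /th /th'; under eq_bigr do rewrite -(Ex_bern r01).
  rewrite -(Ex_bern r01); apply: sum_pivot_expectation => // S S0 SL.
  apply: le_trans (phi1 S S0 SL) _; apply: ler_sum => x _; apply: ler_sum => z _.
  rewrite !Ex_bern; apply: Bx_le_incr; try lra.
  exact: exits_through_incr.
have H2 : th r <= th p2 by apply: Bx_le_incr; [lra..|exact: escapes_incr].
have H3 : 0 <= th p1 by rewrite /th -(Ex_bern h1); apply: Ex_ge0 => w; exact: ind_ge0.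
rewrite Ex_bern -/(th p2) ler_pdivrMr; last lra.
nra.
Qed.

End Sharpness.

(** * From passage times to percolation *)

Section Randomization.
Variables (R : realType) (K : eqType) (X : Type) (mu : law R X) (h : X -> R).
Hypothesis h01 : forall v, 0 <= h v <= 1.
Variables (p : R) (p01 : 0 <= p <= 1).
Hypothesis pE : p = \sum_v law_wt v * h (law_val (l := mu) v).

Let coord_convex (g : (K -> R) -> R) := forall (q : K -> R) e c, (forall e, 0 <= q e <= 1) ->
  0 <= c <= 1 -> g (upd q e c) <= c * g (upd q e 1) + (1 - c) * g (upd q e 0).

Let unit_upd (q : K -> R) e c : (forall e, 0 <= q e <= 1) -> 0 <= c <= 1 ->
  forall e', 0 <= upd q e c e' <= 1.
Proof. by move=> q01 c01 e'; rewrite /upd; case: ifP. Qed.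

Let coord_convex_E1 e' g : coord_convex g -> coord_convex (E1 (law_map h mu) e' g).
Proof.
move=> gc q e c q01 c01; have [->|ee'] := eqVneq e e'.
  rewrite !indep_E1_same; lra.
rewrite /E1 !mulr_sumr -big_split; apply: ler_sum => v _ /=.
rewrite !(updC _ _ _ ee').
apply: le_trans (ler_wpM2l (law_ge0 _) (gc _ _ _ _ c01)) _; first exact: unit_upd.
by rewrite mulrDr !mulrA ![_ * law_wt v]mulrC.
Qed.

(* A coordinatewise convex function can only increase in mean when the coordinates
   are replaced by Bernoulli variables of the same mean. *)
Let Ex_randomize s g : coord_convex g -> forall q, (forall e, 0 <= q e <= 1) ->
  Ex (law_map h mu) s g q <= Ex (law_map (fun b : bool => b%:R) (bern p01)) s g q.
Proof.
move=> gc; elim: s => //= e s IH q q01.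
have Gc : coord_convex (Ex (law_map h mu) s g).
  by elim: s {IH} => //= e' s; exact: coord_convex_E1.
set G := Ex (law_map h mu) s g in IH Gc *.
apply: (@le_trans _ _ (E1 (law_map (fun b : bool => b%:R) (bern p01)) e G q)).
  apply: (@le_trans _ _ (\sum_v law_wt v *
      (h (law_val (l := mu) v) * G (upd q e 1) + (1 - h (law_val (l := mu) v)) * G (upd q e 0)))).
    by apply: ler_sum => v _; rewrite ler_wpM2l ?law_ge0 //; exact: (Gc q e _ q01 (h01 _)).
  rewrite /E1 big_bool /= pE le_eqVlt; apply/orP; left; apply/eqP.
  under eq_bigr do rewrite mulrDr mulrBl mul1r mulrBr !mulrA.
  rewrite big_split sumrB /= -!mulr_suml law_sum; ring.
rewrite /E1 !big_bool /=.
apply: lerD; apply: ler_wpM2l; try (move: p01; lra).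
  by apply: IH; apply: unit_upd => //; rewrite ler01 lexx.
by apply: IH; apply: unit_upd => //; rewrite ler01 lexx.
Qed.

Let best (Q : seq (seq K)) (q : K -> R) : R := \big[Num.max/0]_(k <- Q) \prod_(e <- k) q e.

Let prod_upd (k : seq K) (q : K -> R) e c : uniq k ->
  \prod_(e' <- k) upd q e c e' =
  c * (\prod_(e' <- k) upd q e 1 e') + (1 - c) * (\prod_(e' <- k) upd q e 0 e').
Proof.
move=> uk; have [ek|ek] := boolP (e \in k); last first.
  have H c' : \prod_(e' <- k) upd q e c' e' = \prod_(e' <- k) q e'.
    rewrite !big_seq; apply: eq_bigr => e' e'k; rewrite upd_neq //.
    by apply: contraNneq ek => <-.
  by rewrite !H; ring.
have H c' : \prod_(e' <- k) upd q e c' e' = c' * \prod_(e' <- k | e' != e) q e'.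
  rewrite (bigD1_seq e) //= upd_same; congr (_ * _).
  by apply: eq_bigr => e' e'e; rewrite upd_neq.
by rewrite !H; ring.
Qed.

(** A product over a list without repetition is affine in each coordinate, and a maximum of affine
    functions is convex. *)
Let best_convex Q : (forall k, k \in Q -> uniq k) -> coord_convex (best Q).
Proof.
move=> Qu q e c q01 c01; rewrite [in leLHS]/best big_seq; apply: bigmax_le.
  have b0 q' : 0 <= best Q q' by rewrite /best bigmax_idl le_max lexx.
  by rewrite addr_ge0 // mulr_ge0 //; lra.
move=> k kQ; rewrite prod_upd; last exact: Qu.
have H q' : \prod_(e' <- k) q' e' <= best Q q'.
  exact: (le_bigmax_seq _ k xpredT (fun k => \prod_(e' <- k) q' e') kQ isT).
by apply: lerD; apply: ler_wpM2l; rewrite ?H //; lra.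
Qed.

(** For values in {0, 1} the maximum of the products is the indicator that some list of [Q] is
    entirely open. *)
Lemma Ex_best_le (Q : seq (seq K)) s (x : K -> X) :
  (forall k, k \in Q -> uniq k) -> (forall k e, k \in Q -> e \in k -> e \in s) ->
  Ex mu s (fun y => \big[Num.max/0]_(k <- Q) \prod_(e <- k) h (y e)) x <=
  Ex (bern p01) s (fun w => ind R (exists2 k, k \in Q & all w k)) (@closed_cfg _).
Proof.
move=> Qu Qs.
have dq : dep s (best Q).
  move=> q q' qq'; rewrite /best !big_seq; apply: eq_bigr => k kQ.
  by rewrite !big_seq; apply: eq_bigr => e ek; apply: qq'; exact: Qs ek.
have := Ex_map h mu s (best Q) x => <-.
apply: le_trans (Ex_randomize s (best_convex Qu) _) _; first by move=> e; exact: h01.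
rewrite (Ex_dep_cst _ dq _ ((fun b : bool => b%:R) \o @closed_cfg _)) Ex_map.
apply: Ex_le => w; rewrite /best big_seq; apply: bigmax_le => [|k kQ]; first exact: ind_ge0.
have [wk|/allPn[e ek we]] := boolP (all w k).
  rewrite ind_true; last by exists k.
  rewrite big_seq big1 // => e ek /=; by rewrite (allP wk).
by rewrite (big_rem e) //= (negPf we) mul0r ind_ge0.
Qed.

End Randomization.

(** * Passage times in finite volume *)

Lemma seq_argmin (R : realDomainType) (T : eqType) (f : T -> R) (s : seq T) (a : T) : a \in s ->
  exists p, p \in s /\ forall q, q \in s -> f p <= f q.
Proof.
elim: s a => // b s IH a _; case: s IH => [_|c s IH].
  by exists b; split => [|q]; rewrite !inE // => /eqP ->.
have [p [ps pm]] := IH c (mem_head _ _).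
have [bp|/ltW pb] := leP (f b) (f p).
  exists b; split => [|q]; first exact: mem_head.
  by rewrite in_cons => /predU1P[->//|/pm]; exact: le_trans.
exists p; split => [|q]; first by rewrite in_cons ps orbT.
by rewrite in_cons => /predU1P[->//|/pm].
Qed.

Section FiniteVolume.
Variables (R : realType) (d : nat).
Local Notation vtx := 'rV[int]_d.
Local Notation edge := {fset vtx}.
Implicit Types (z : vtx) (p q : seq vtx) (e : edge) (t : edge -> R).

Definition short_walks N : seq (seq vtx) := flatten [seq walks n 0 | n <- iota 0 N.+1].

Definition saws N z : seq (seq vtx) := [seq p <- short_walks N | uniq (0 :: p) && (last 0 p == z)].

Definition short_edges N : seq edge := undup (flatten [seq path_edges 0 p | p <- short_walks N]).

Lemma mem_short_walks N p : (p \in short_walks N) = path (@adj d) 0 p && (size p <= N)%N.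
Proof.
apply/flattenP/andP => [[_ /mapP[n + ->]]|[p1 pN]].
  by rewrite mem_iota add0n ltnS mem_walks => nN /andP[-> /eqP ->].
exists (walks (size p) 0); last by rewrite mem_walks p1 /=.
by apply/mapP; exists (size p) => //; rewrite mem_iota.
Qed.

Lemma mem_saws N z p : reflect
  [/\ path (@adj d) 0 p, (size p <= N)%N, uniq (0 :: p) & last 0 p = z] (p \in saws N z).
Proof.
rewrite mem_filter mem_short_walks; apply: (iffP andP).
  by move=> [/andP[pu /eqP pz] /andP[p1 pN]].
by move=> [p1 pN pu ->]; rewrite pu p1 pN eqxx.
Qed.

Lemma mem_short_edges N p e : path (@adj d) 0 p -> (size p <= N)%N ->
  e \in path_edges 0 p -> e \in short_edges N.
Proof.
move=> p1 pN ep; rewrite mem_undup; apply/flattenP; exists (path_edges 0 p) => //.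
by apply: map_f; rewrite mem_short_walks p1.
Qed.

Lemma short_edges_edges N e : e \in short_edges N -> edges e.
Proof.
rewrite mem_undup => /flattenP[_ /mapP[p + ->]]; rewrite mem_short_walks => /andP[p1 _].
exact: path_edges_edges.
Qed.

Definition walk_time t p : R := \sum_(e <- path_edges 0 p) t e.

(** One minimiser among finitely many paths, picked by choice; [[::]] is the default when no
    admissible path reaches [z]. *)
Definition geodesic N z t : seq vtx :=
  xget [::] [set p | p \in saws N z /\ forall q, q \in saws N z -> walk_time t p <= walk_time t q].

Definition fpp N z t : R := walk_time t (geodesic N z t).

Lemma geodesicP N z t p : p \in saws N z ->
  geodesic N z t \in saws N z /\ forall q, q \in saws N z -> fpp N z t <= walk_time t q.
Proof.
move=> /(seq_argmin (walk_time t))[q Hq].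
exact: (xgetPex [::] (P := [set p | p \in saws N z /\
  forall q, q \in saws N z -> walk_time t p <= walk_time t q]) (ex_intro _ q Hq)).
Qed.

Lemma walk_time_ge0 t p : (forall e, 0 <= t e) -> 0 <= walk_time t p.
Proof. by move=> t0; apply: sumr_ge0. Qed.

(** The old geodesic remains a competitor, and it crosses [e] at most once. *)
Lemma fpp_upd N z t p e c : p \in saws N z -> (forall e, 0 <= t e) -> 0 <= c ->
  fpp N z (upd t e c) <= fpp N z t + c * (e \in path_edges 0 (geodesic N z t))%:R.
Proof.
move=> pN t0 c0; have [gN _] := geodesicP t pN.
have [_ /(_ _ gN) H] := geodesicP (upd t e c) pN; apply: le_trans H _.
set g := geodesic N z t in gN *.
have /mem_saws[_ _ gu _] := gN; have eu := path_edges_uniq gu.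
rewrite /fpp -/g /walk_time; have [eg|eg] := boolP (e \in _); last first.
  rewrite mulr0 addr0 !big_seq; apply: ler_sum => e' e'g.
  by rewrite upd_neq //; apply: contraNneq eg => <-.
rewrite mulr1 (bigD1_seq e) //= [X in _ <= X + _](bigD1_seq e) //= upd_same.
rewrite addrAC [leRHS]addrC addrC.
have -> : \sum_(e' <- path_edges 0 g | e' != e) upd t e c e' = \sum_(e' <- path_edges 0 g | e' !=
  e) t e'.
  by apply: eq_bigr => e' e'e; rewrite upd_neq.
by have := t0 e; lra.
Qed.

End FiniteVolume.

Lemma upd_comp (R : realType) (K : eqType) (X : Type) (vl : X -> R) (x : K -> X) e v :
  vl \o upd x e v = upd (vl \o x) e (vl v).
Proof. by apply/funext => e'; rewrite /upd /=; case: ifP. Qed.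

Section GeodesicLength.
Variables (R : realType) (d : nat) (X : Type) (mu : law R X) (vl : X -> R).
Hypothesis vl0 : forall v, 0 <= vl v.
Local Notation vtx := 'rV[int]_d.
Local Notation edge := {fset vtx}.
Variables (N : nat) (z : vtx) (p0 : seq vtx).
Hypothesis p0N : p0 \in saws N z.
Local Notation s := (short_edges d N).
Implicit Types (x : edge -> X).

Let geo x := geodesic N z (vl \o x).

Lemma geo_count_le x : geo_count R (fun x => path_edges 0 (geo x)) s x <= (size (geo x))%:R.
Proof.
rewrite /geo_count -natr_sum ler_nat -big_mkcond /= sum1_count -size_filter.
rewrite -[leqRHS](size_pairmap (fun a b => [fset a; b]%fset) 0); apply: uniq_leq_size.
  by rewrite filter_uniq // undup_uniq.
by move=> e; rewrite mem_filter => /andP[].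
Qed.

(** When the geodesic has [k] edges, the exponential factorises along it, and the geodesic is one of
    the paths over which [Ex_best_le] maximises. *)
Lemma Ex_geodesic_size (la p : R) (p01 : 0 <= p <= 1) k x : 0 <= la -> (k <= N)%N ->
  p = \sum_v law_wt v * expR (- (la * vl (law_val (l := mu) v))) ->
  Ex mu s (fun x => ind R (size (geo x) = k) * expR (- (la * fpp N z (vl \o x)))) x <=
  Ex (bern p01) s (fun w => ind R (saw_open 0 k w)) (@closed_cfg _).
Proof.
move=> la0 kN pE; pose h v := expR (- (la * vl v)).
have h01 v : 0 <= h v <= 1.
  by rewrite expR_ge0 /= -(expR0 R) ler_expR oppr_le0 mulr_ge0.
pose Q := [seq path_edges 0 q | q <- [seq q <- walks k (0 : vtx) | uniq (0 :: q)]].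
have QP l : l \in Q -> exists q, [/\ path (@adj d) 0 q, size q = k, uniq (0 :: q) & l = path_edges
  0 q].
  by move=> /mapP[q]; rewrite mem_filter mem_walks => /and3P[qu q1 /eqP qk] ->; exists q.
have := @Ex_best_le R edge X mu h h01 p p01 pE Q s x.
move=> /(_ _ _)/le_trans H; apply: le_trans (H _ _ _ _) => {H}; last first.
- apply: Ex_le => w; apply: ind_le => -[l /QP[q [q1 q2 q3 ->]] wq].
  by exists q.
- move=> l e /QP[q [q1 q2 q3 ->]]; apply: mem_short_edges => //; by rewrite q2.
- by move=> l /QP[q [_ _ q3 ->]]; exact: path_edges_uniq.
apply: Ex_le => y; have [gk|ngk] := pselect (size (geo y) = k); last first.
  by rewrite ind_false // mul0r bigmax_idl le_max lexx.
rewrite ind_true // mul1r.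
have -> : expR (- (la * fpp N z (vl \o y))) = \prod_(e <- path_edges 0 (geo y)) h (y e).
  by rewrite /h -expR_sum /fpp /walk_time mulr_sumr sumrN.
have [/mem_saws[g1 _ gu _] _] := geodesicP (vl \o y) p0N.
apply: (le_bigmax_seq _ _ xpredT (fun l => \prod_(e <- l) h (y e)) _ isT).
by apply: map_f; rewrite mem_filter gu mem_walks g1 -gk /=.
Qed.

End GeodesicLength.

(** * Length of the geodesic and concentration *)

Lemma exprS_tangent (R : realDomainType) (a c : R) j : 0 <= a -> 0 <= c ->
  c ^+ j.+1 + j.+1%:R * c ^+ j * (a - c) <= a ^+ j.+1.
Proof.
move=> a0 c0; elim: j => [|j IH]; first by rewrite !expr1 expr0; lra.
rewrite [a ^+ _]exprS; apply: le_trans (ler_wpM2l a0 IH).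
rewrite -subr_ge0.
have -> : a * (c ^+ j.+1 + j.+1%:R * c ^+ j * (a - c)) - (c ^+ j.+2 + j.+2%:R * c ^+ j.+1 * (a -
  c)) =
    j.+1%:R * c ^+ j * (a - c) ^+ 2.
  by rewrite !exprS -[j.+2%:R]natr1; ring.
by rewrite mulr_ge0 ?sqr_ge0 // mulr_ge0 // exprn_ge0.
Qed.

(** Summing the tangent inequalities at the mean [c] cancels the linear terms. *)
Lemma power_mean (R : realFieldType) (I : Type) (r : seq I) (a : I -> R) j :
  (forall i, 0 <= a i) ->
  (\sum_(i <- r) a i) ^+ j.+1 <= (size r)%:R ^+ j * \sum_(i <- r) a i ^+ j.+1.
Proof.
move=> a0; have [r0|r0] := eqVneq (size r) 0%N.
  by rewrite (size0nil r0) !big_nil expr0n mulr0.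
set S := \sum_(i <- r) a i.
have l0 : 0 < (size r)%:R :> R by rewrite ltr0n lt0n.
have [c c0 SE] : exists2 c, 0 <= c & S = (size r)%:R * c.
  exists (S / (size r)%:R); first by rewrite divr_ge0 // sumr_ge0.
  by rewrite mulrC divfK // gt_eqF.
have cst (b : R) : \sum_(i <- r) b = (size r)%:R * b.
  by rewrite big_const_seq count_predT iter_addr_0 mulr_natl.
have H : (size r)%:R * c ^+ j.+1 <= \sum_(i <- r) a i ^+ j.+1.
  have -> : (size r)%:R * c ^+ j.+1 = \sum_(i <- r) (c ^+ j.+1 + j.+1%:R * c ^+ j * (a i - c)).
    by rewrite big_split -mulr_sumr sumrB /= -/S !cst -SE subrr mulr0 addr0.
  by apply: ler_sum => i _; exact: exprS_tangent.
by rewrite {1}SE exprMn exprSr -mulrA ler_wpM2l ?exprn_ge0 //.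
Qed.

(** The inequality b <= exp b for b = c k / (4 J), raised to the power J. *)
Lemma natX_le_expR (R : realType) (J k : nat) (c : R) : 0 < c ->
  k%:R ^+ J <= (4 * J%:R / c) ^+ J * expR (c * k%:R / 4).
Proof.
move=> c0; case: J => [|J].
  rewrite !expr0 mul1r -(expR0 R) ler_expR; apply: divr_ge0 => //.
  by rewrite mulr_ge0 // ltW.
set b : R := c * k%:R / 4 / J.+1%:R.
have b0 : 0 <= b by rewrite !mulr_ge0 ?invr_ge0 // ltW.
have J0 : J.+1%:R != 0 :> R by rewrite pnatr_eq0.
have -> : c * k%:R / 4 = J.+1%:R * b by rewrite [RHS]mulrC divfK.
rewrite expRM_natl -exprMn lerXn2r ?nnegrE //.
  by rewrite mulr_ge0 ?expR_ge0 // !mulr_ge0 // invr_ge0 ltW.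
have -> : k%:R = 4 * J.+1%:R / c * b.
  have c1 : c != 0 by rewrite gt_eqF.
  by rewrite /b; move: (J.+1%:R : R) J0 => J1 J0; field; rewrite c1 J0.
rewrite ler_wpM2l ?divr_ge0 ?mulr_ge0 //; first exact: ltW.
by have := expR_ge1Dx b; lra.
Qed.

Lemma sum_expr_le (R : realFieldType) (r : R) n : 0 <= r -> r < 1 ->
  \sum_(k < n) r ^+ k <= (1 - r)^-1.
Proof.
move=> r0 r1; have r1' : 0 < 1 - r by lra.
rewrite -[leRHS]mul1r ler_pdivlMr //.
have -> : (\sum_(k < n) r ^+ k) * (1 - r) = 1 - r ^+ n.
  elim: n => [|n IH]; first by rewrite big_ord0 mul0r expr0 subrr.
  by rewrite big_ord_recr /= mulrDl IH exprSr; ring.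
by have := exprn_ge0 n r0; lra.
Qed.

Section GeodesicMoment.
Variables (R : realType) (d : nat) (X : Type) (mu : law R X) (vl : X -> R).
Hypothesis vl0 : forall v, 0 <= vl v.
Local Notation vtx := 'rV[int]_d.
Local Notation edge := {fset vtx}.
Variables (N : nat) (z : vtx) (p0 : seq vtx).
Hypothesis p0N : p0 \in saws N z.
Local Notation s := (short_edges d N).
Implicit Types (x : edge -> X).

(** The minimum is at most the time along the fixed path [p0], whose edges are then averaged one by
    one. *)
Lemma Ex_fpp_moment j x :
  Ex mu s (fun y => fpp N z (vl \o y) ^+ j.+1) x <= (size p0)%:R ^+ j.+1 * law_moment mu vl j.+1.
Proof.
have [/mem_saws[p1 pN pu _]] := conj p0N p0N => _.
apply: (@le_trans _ _ (Ex mu s (fun y => (size p0)%:R ^+ j *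
    \sum_(e <- path_edges 0 p0) vl (y e) ^+ j.+1) x)).
  apply: Ex_le => y; have [gN /(_ _ p0N) H] := geodesicP (vl \o y) p0N.
  apply: (@le_trans _ _ (walk_time (vl \o y) p0 ^+ j.+1)).
    by rewrite lerXn2r // nnegrE walk_time_ge0 // => e; exact: vl0.
  rewrite -[size p0](size_pairmap (fun a b => [fset a; b]%fset) 0).
  by apply: power_mean => e; exact: vl0.
rewrite ExZ Ex_sum big_seq.
under eq_bigr => e ep.
  have es : e \in s by exact: mem_short_edges ep.
  rewrite -(Ex_absorb mu _ es).
  have -> : E1 mu e (fun y => vl (y e) ^+ j.+1) = fun=> law_moment mu vl j.+1.
    by apply/funext => y; apply: eq_bigr => v _; rewrite upd_same.
  rewrite Ex_cst.
over.
rewrite -big_seq big_const_seq count_predT size_pairmap iter_addr_0 -[law_moment _ _ _ *+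
  _]mulr_natl.
by rewrite mulrA -exprSr.
Qed.

(** Let a = c / (2 la) and let k be the length. If T >= a k, then k^(j+1) is controlled by a moment
    of [T]. Otherwise exp(c k / 2 - la T) >= 1, so this factor may be inserted. The decay exp(- c k)
    pays for exp(c k / 2) and, with a further exp(c k / 4), for the power of k; the remaining exp(-
    c k / 4) is summed as a geometric series. *)
Lemma Ex_geodesic_moment (la c E0 : R) j x : 0 < la -> 0 < c -> 0 <= E0 ->
  (forall k, (k <= N)%N ->
    Ex mu s (fun y => ind R (size (geodesic N z (vl \o y)) = k) *
      expR (- (la * fpp N z (vl \o y)))) x <= E0 * expR (- (c * k%:R))) ->
  Ex mu s (fun y => (size (geodesic N z (vl \o y)))%:R ^+ j.+1) x <=
  (2 * la / c) ^+ j.+1 * ((size p0)%:R ^+ j.+1 * law_moment mu vl j.+1) +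
  E0 * (4 * j.+1%:R / c) ^+ j.+1 * (1 - expR (- (c / 4)))^-1.
Proof.
move=> la0 c0 E00 dec; pose a := c / (2 * la).
have a0 : 0 < a by rewrite divr_gt0 // mulr_gt0.
have aE : la * a = c / 2 by rewrite /a; field; lra.
pose sz y := size (geodesic N z (vl \o y)).
apply: (@le_trans _ _ (Ex mu s (fun y => (2 * la / c) ^+ j.+1 * fpp N z (vl \o y) ^+ j.+1 +
    \sum_(k < N.+1) k%:R ^+ j.+1 * expR (c / 2 * k%:R) *
      (ind R (sz y = k) * expR (- (la * fpp N z (vl \o y))))) x)).
  apply: Ex_le => y; set T := fpp N z _.
  have T0 : 0 <= T by apply: walk_time_ge0 => e; exact: vl0.
  have [/mem_saws[_ gN _ _] _] := geodesicP (vl \o y) p0N.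
  have S0 : 0 <= \sum_(k < N.+1) k%:R ^+ j.+1 * expR (c / 2 * k%:R) *
      (ind R (sz y = k) * expR (- (la * T))).
    by apply: sumr_ge0 => k _; rewrite !mulr_ge0 ?expR_ge0 ?exprn_ge0 // ind_ge0.
  have P0 : 0 <= (2 * la / c) ^+ j.+1 * T ^+ j.+1.
    by rewrite mulr_ge0 // exprn_ge0 // divr_ge0 ?mulr_ge0 // ltW.
  have [Tbig|Tsmall] := leP (a * (sz y)%:R) T.
    apply: (@le_trans _ _ ((2 * la / c) ^+ j.+1 * T ^+ j.+1)); last by rewrite lerDl.
    have H : (sz y)%:R <= 2 * la / c * T.
      have -> : 2 * la / c = a^-1 by rewrite /a invf_div.
      by rewrite mulrC ler_pdivlMr // mulrC.
    by rewrite -exprMn lerXn2r ?nnegrE // (le_trans _ H).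
  rewrite -/(sz y) -[leLHS]add0r; apply: lerD => //.
  have szN : (sz y < N.+1)%N by [].
  rewrite (bigD1 (Ordinal szN)) //= ind_true // mul1r -[leLHS]addr0; apply: lerD; last first.
    by apply: sumr_ge0 => k _; rewrite !mulr_ge0 ?expR_ge0 ?exprn_ge0 // ind_ge0.
  rewrite -mulrA ler_peMr ?exprn_ge0 // -expRD.
  apply: (@le_trans _ _ (expR 0)); first by rewrite expR0.
  rewrite ler_expR.
  rewrite -aE -mulrA -mulrBr mulr_ge0 ?subr_ge0 //; exact: ltW.
rewrite ExD ExZ Ex_sum; apply: lerD.
  by rewrite ler_wpM2l ?Ex_fpp_moment // exprn_ge0 // divr_ge0 ?mulr_ge0 // ltW.
apply: (@le_trans _ _ (\sum_(k < N.+1) E0 * (4 * j.+1%:R / c) ^+ j.+1 * expR (- (c / 4)) ^+ k)).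
  apply: ler_sum => k _; rewrite ExZ.
  have kE : 0 <= k%:R ^+ j.+1 * expR (c / 2 * k%:R) by rewrite mulr_ge0 ?expR_ge0 ?exprn_ge0.
  apply: le_trans (ler_wpM2l kE (dec k _)) _; first by rewrite -ltnS.
  have H := natX_le_expR j.+1 k c0.
  rewrite -expRM_natl [leLHS]mulrCA -[leRHS]mulrA ler_wpM2l //.
  rewrite -[leLHS]mulrA -expRD; apply: le_trans (ler_wpM2r (expR_ge0 _) H) _.
  rewrite -[leLHS]mulrA -expRD ler_wpM2l //.
    by rewrite exprn_ge0 // divr_ge0 ?mulr_ge0 // ltW.
  by rewrite ler_expR; lra.
rewrite -mulr_sumr ler_wpM2l //.
  by rewrite mulr_ge0 // exprn_ge0 // divr_ge0 ?mulr_ge0 // ltW.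
by apply: sum_expr_le; rewrite ?expR_ge0 // expR_lt1; lra.
Qed.

End GeodesicMoment.

(** The law enters only through the moment bound [A] and the decay parameters, and the target only
    through [B]; the constant is thus uniform in the discretisation and in [n]. *)
Lemma fpp_concentration (R : realType) (d m : nat) (la c E0 A B : R) :
  0 < la -> 0 < c -> 0 <= E0 -> 0 <= A -> 0 <= B ->
  exists C : R, 0 <= C /\ forall (X : Type) (mu : law R X) (vl : X -> R) (N : nat)
    (z : 'rV[int]_d) (p0 : seq 'rV[int]_d) (x : {fset 'rV[int]_d} -> X) (n : R),
  let s := short_edges d N in
  let T (y : {fset 'rV[int]_d} -> X) := fpp N z (vl \o y) in
  (forall v, 0 <= vl v) ->
  (forall j, (1 <= j <= 2 * m.+1)%N -> law_moment mu vl j <= A) ->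
  p0 \in saws N z -> 1 <= n -> (size p0)%:R <= B * n ->
  (forall k, (k <= N)%N ->
    Ex mu s (fun y => ind R (size (geodesic N z (vl \o y)) = k) * expR (- (la * T y))) x <=
      E0 * expR (- (c * k%:R))) ->
  Ex mu s (fun y => (T y - Ex mu s T x) ^+ (2 * m.+1)) x <= C * n ^+ m.+1.
Proof.
move=> la0 c0 E00 A0 B0.
pose D j := (2 * la / c) ^+ j * (B ^+ j * A) +
  E0 * (4 * j%:R / c) ^+ j * (1 - expR (- (c / 4)))^-1.
have r1 : 0 <= (1 - expR (- (c / 4)))^-1.
  by rewrite invr_ge0 subr_ge0 ltW // expR_lt1; lra.
have D0 j : 0 <= D j.
  have l0 : 0 <= 2 * la / c by rewrite divr_ge0 ?mulr_ge0 // ltW.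
  have f0 : 0 <= 4 * j%:R / c by rewrite divr_ge0 ?mulr_ge0 // ltW.
  by rewrite addr_ge0 ?mulr_ge0 ?[0 <= _ ^+ _]exprn_ge0.
pose DD := \sum_(j < m.+2) D j.
have DD0 : 0 <= DD by apply: sumr_ge0.
have [C [C0 HC]] := @moment_bound R {fset 'rV[int]_d} A DD m A0 DD0.
exists C; split => // X mu vl N z p0 x n s T vl0 Am p0N n1 pn dec.
have n0 : 0 <= n by lra.
apply: (HC X mu vl T (fun y => path_edges 0 (geodesic N z (vl \o y)))) => //.
- move=> y e v; rewrite /T upd_comp; apply: fpp_upd p0N _ _ => //.
  by move=> e'; exact: vl0.
- by move=> j /andP[j1 jm]; apply: Am; rewrite muln_gt0 j1 leq_mul2l.
- exact: undup_uniq.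
case=> // j /andP[_ jm].
apply: (@le_trans _ _ (Ex mu s (fun y => (size (geodesic N z (vl \o y)))%:R ^+ j.+1) x)).
  apply: Ex_le => y; rewrite lerXn2r ?nnegrE ?geo_count_ge0 //.
  exact: geo_count_le.
apply: le_trans (Ex_geodesic_moment vl0 p0N j la0 c0 E00 dec) _.
apply: (@le_trans _ _ (D j.+1 * n ^+ j.+1)); last first.
  rewrite ler_wpM2r ?exprn_ge0 // /DD.
  have jm' : (j.+1 < m.+2)%N by [].
  by rewrite (bigD1 (Ordinal jm')) //= lerDl sumr_ge0.
rewrite /D [leRHS]mulrDl; apply: lerD.
  rewrite -[leRHS]mulrA ler_wpM2l ?exprn_ge0 //; first by rewrite divr_ge0 ?mulr_ge0 // ltW.
  rewrite [leRHS]mulrAC -exprMn; apply: ler_pM.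
  - by rewrite exprn_ge0.
  - by apply: sumr_ge0 => v _; rewrite mulr_ge0 ?law_ge0 ?exprn_ge0.
  - by rewrite lerXn2r ?nnegrE ?mulr_ge0.
  - by apply: Am; rewrite /=; apply: leq_trans jm _; rewrite mulSn mul1n leq_addr.
(* This second term of [D] carries no power of [n]; the missing one is supplied by [1 <= n]. *)
rewrite ler_peMr ?exprn_ege1 // mulr_ge0 // mulr_ge0 // exprn_ge0 //.
by rewrite divr_ge0 ?mulr_ge0 // ltW.
Qed.

(** * Realizations of product laws *)

Lemma measurable_fun_bigsetU d (T : measurableType d) d' (T' : measurableType d')
    (I : Type) (r : seq I) (F : I -> set T) (f : T -> T') :
  (forall i, measurable (F i)) -> (forall i, measurable_fun (F i) f) ->
  measurable_fun (\big[setU/set0]_(i <- r) F i) f.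
Proof.
move=> mF mf; elim: r => [|i r IH]; first by rewrite big_nil; exact: measurable_fun_set0.
rewrite big_cons; apply/measurable_funU => //; exact: bigsetU_measurable.
Qed.

Section Cylinders.
Context {disp : measure_display} {Omega : measurableType disp} {R : realType}.
Variables (P : probability Omega R) (I : choiceType) (X : Type) (mu : law R X).
Variables (E : set I) (Y : I -> Omega -> law_idx mu).
Hypothesis mY : forall i a, E i -> measurable [set w | Y i w = a].
Hypothesis PY : forall (J : seq I) (v : I -> law_idx mu), uniq J -> {in J, forall i, E i} ->
  P [set w | {in J, forall i, Y i w = v i}] = (\prod_(i <- J) law_wt (v i))%:E.

Let cyl (J : seq I) (v : I -> law_idx mu) : set Omega := [set w | {in J, forall i, Y i w = v i}].

Let mcyl J v : {in J, forall i, E i} -> measurable (cyl J v).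
Proof.
elim: J => [|i J IH] JE; first by rewrite (_ : cyl _ _ = setT) // -subTset => w _ j.
have -> : cyl (i :: J) v = [set w | Y i w = v i] `&` cyl J v.
  apply/seteqP; split => w /= H; first by split => [|j jJ]; apply: H;
    rewrite ?mem_head // in_cons jJ orbT.
  by move=> j; rewrite in_cons => /predU1P[->|]; [case: H|move=> jJ; apply: (proj2 H)].
apply: measurableI; first by apply: mY; apply: JE; exact: mem_head.
by apply: IH => j jJ; apply: JE; rewrite in_cons jJ orbT.
Qed.

Definition cfg (w : Omega) : I -> X := fun i => law_val (Y i w).

Let cyl_split J v i : i \notin J ->
  cyl J v = \big[setU/set0]_(a <- enum (law_idx mu)) cyl (i :: J) (upd v i a).
Proof.
move=> iJ; apply/seteqP; split => w /=.
  move=> H; rewrite -bigcup_seq; exists (Y i w); first by rewrite /= mem_enum.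
  move=> j; rewrite in_cons => /predU1P[->|jJ]; first by rewrite upd_same.
  by rewrite upd_neq ?H //; apply: contraNneq iJ => <-.
rewrite -bigcup_seq => -[a _ H] j jJ; rewrite H ?in_cons ?jJ ?orbT //.
by rewrite upd_neq //; apply: contraNneq iJ => <-.
Qed.

(** Induction on the coordinates [s] still free: the cylinder that fixes those in [J] is split by
    the value of the next one, which mirrors the recursion of [Ex]. *)
Let cyl_integral (f : (I -> X) -> R) J s v : (forall x, 0 <= f x) ->
  dep (J ++ s) f -> uniq (J ++ s) -> {in J ++ s, forall i, E i} ->
  measurable_fun (cyl J v) (fun w => f (cfg w)) /\
  (\int[P]_(w in cyl J v) (f (cfg w))%:E =
    (\prod_(i <- J) law_wt (v i) * Ex mu s f (fun i => law_val (v i)))%:E)%E.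
Proof.
move=> f0; elim: s J v => [|i s IH] J v fd us Es.
  rewrite cats0 in fd us Es.
  have H w : cyl J v w -> f (cfg w) = f (fun i => law_val (v i)).
    by move=> Jw; apply: fd => i iJ; rewrite /cfg Jw.
  split.
    apply: (@eq_measurable_fun _ _ _ _ (cyl J v) (cst (f (fun i => law_val (v i))))).
      by move=> w; rewrite inE => /H.
    exact: measurable_cst.
  rewrite (eq_integral (cst (f (fun i => law_val (v i)))%:E)); last first.
    by move=> w; rewrite inE => /H ->.
  rewrite integral_cst; last exact: mcyl.
  transitivity ((f (fun i => law_val (v i)))%:E * (\prod_(i <- J) law_wt (v i))%:E)%E.
    by congr (_ * _)%E; exact: PY.
  by rewrite -EFinM mulrC.
have iJ : i \notin J.
  by move: us; rewrite cat_uniq /= negb_or => /and3P[_ /andP[iJ _] _].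
have fd' : dep ((i :: J) ++ s) f.
  move=> x y xy; apply: fd => j; rewrite mem_cat in_cons => jJ; apply: xy.
  by rewrite /= in_cons mem_cat; case/or3P: jJ => ->; rewrite ?orbT.
have us' : uniq ((i :: J) ++ s) by rewrite -(perm_uniq (s1 := J ++ i :: s)) // perm_catC /=
  perm_cons perm_catC.
have Es' : {in (i :: J) ++ s, forall i, E i}.
  move=> j jJ; apply: Es; move: jJ; rewrite /= in_cons !mem_cat in_cons.
  by case/or3P => ->; rewrite ?orbT.
have IH' a := IH (i :: J) (upd v i a) fd' us' Es'.
have mi a : measurable (cyl (i :: J) (upd v i a)).
  by apply: mcyl => j jJ; apply: Es'; rewrite mem_cat jJ.
have mf : measurable_fun (cyl J v) (fun w => f (cfg w)).
  rewrite (cyl_split v iJ); apply: measurable_fun_bigsetU => // a.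
  by have [] := IH' a.
split => //.
rewrite (cyl_split v iJ) ge0_integral_bigsetU //=.
- under eq_bigr do rewrite (IH' _).2.
  rewrite sumEFin big_enum /=; congr EFin; rewrite /E1 mulr_sumr.
  apply: eq_bigr => a _; rewrite big_cons upd_same -mulrA mulrCA; congr (_ * _);
    last congr (_ * Ex mu s f _).
    rewrite !big_seq; apply: eq_bigr => j jJ.
    by rewrite upd_neq //; apply: contraNneq iJ => <-.
  by apply/funext => j; rewrite /upd; case: ifP.
- exact: enum_uniq.
- apply/trivIsetP => a b _ _ ab; apply/seteqP; split => // w [/= wa wb]; move: ab.
  by have := wa i (mem_head _ _); have := wb i (mem_head _ _); rewrite !upd_same => -> ->;
    rewrite eqxx.
- by rewrite -(cyl_split v iJ); apply/measurable_realfun.measurable_EFinP.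
- by move=> w _; rewrite lee_fin.
Qed.

Lemma cylinder_expectation (f : (I -> X) -> R) (s : seq I) (x : I -> X) : (forall x, 0 <= f x) ->
  dep s f ->
  uniq s -> {in s, forall i, E i} ->
  measurable_fun [set: Omega] (fun w => f (cfg w)) /\
  (\int[P]_w (f (cfg w))%:E = (Ex mu s f x)%:E)%E.
Proof.
move=> f0 fd us Es.
(* A default index exists because the weights sum to 1. *)
have a0 : law_idx mu.
  have : 0 < \sum_v @law_wt _ _ mu v by rewrite law_sum.
  case: (pickP (@predT (law_idx mu))) => [a _ //|/(_ _) no].
  by rewrite big1 ?ltxx // => a; have := no a.
have [] := @cyl_integral f [::] s (fun=> a0) f0 fd us Es.
have -> : cyl [::] (fun=> a0) = setT by rewrite -subTset => w _ j.
by rewrite big_nil mul1r (Ex_dep_cst mu fd _ x).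
Qed.

End Cylinders.

(** * Percolation below the critical point *)

Section IndependentEvents.
Context {disp : measure_display} {Omega : measurableType disp} {R : realType}.
Variables (P : probability Omega R) (I : choiceType) (A : set I) (E : I -> set Omega).

Lemma indep_events_seq (J : seq I) : indep_events P A E -> uniq J -> {in J, forall i, A i} ->
  P [set w | {in J, forall i, E i w}] = (\prod_(i <- J) P (E i))%E.
Proof.
move=> [_ indep] uJ JA; have := indep [fset i in J]%fset.
have -> : (\prod_(i <- [fset i in J]%fset) P (E i) = \prod_(i <- J) P (E i))%E.
  by apply: perm_big; apply: uniq_perm => // i; rewrite !inE.
have -> : \bigcap_(i in [set` [fset i in J]%fset]) E i = [set w | {in J, forall i, E i w}].
  apply/seteqP; split => w H i; first by move=> iJ; apply: H; rewrite /= !inE.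
  by rewrite /= !inE; exact: H.
by apply => i; rewrite /= !inE; exact: JA.
Qed.

Variables (p : R) (p01 : 0 <= p <= 1).
Hypothesis indep : indep_events P A E.
Hypothesis PE : forall i, A i -> P (E i) = p%:E.

Let sgn (J1 J : seq I) (v : I -> bool) : set Omega :=
  [set w | {in J1, forall i, E i w} /\ {in J, forall i, `[< E i w >] = v i}].

Let msgn J1 J v : {in J1 ++ J, forall i, A i} -> measurable (sgn J1 J v).
Proof.
have mE i : A i -> measurable (E i) by case: indep => + _; apply.
elim: J1 => [|i J1 IH] JA.
  elim: J JA => [|i J IH] JA; first by rewrite (_ : sgn _ _ _ = setT) // -subTset => w _; split.
  have -> : sgn [::] (i :: J) v = (if v i then E i else ~` E i) `&` sgn [::] J v.
    apply/seteqP; split => w.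
      move=> [_ H]; split; last by split => // j jJ; apply: H; rewrite in_cons jJ orbT.
      by have := H i (mem_head _ _); case: (v i) => /asboolP.
    move=> [Hi [_ H]]; split => // j; rewrite in_cons => /predU1P[->|]; last exact: H.
    by move: Hi; case: (v i) => /= Hi; [apply/asboolP|apply/asboolP].
  apply: measurableI; last by apply: IH => j jJ; apply: JA; rewrite in_cons jJ orbT.
  by case: (v i); [|apply: measurableC]; apply: mE; apply: JA; exact: mem_head.
have -> : sgn (i :: J1) J v = E i `&` sgn J1 J v.
  apply/seteqP; split => w.
    move=> [H1 H2]; split; first by apply: H1; exact: mem_head.
    by split => // j jJ; apply: H1; rewrite in_cons jJ orbT.
  by move=> [H0 [H1 H2]]; split => // j; rewrite in_cons => /predU1P[->//|]; exact: H1.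
apply: measurableI; first by apply: mE; apply: JA; exact: mem_head.
by apply: IH => j jJ; apply: JA; rewrite /= in_cons jJ orbT.
Qed.

(** The hypothesis speaks of events that occur. One that fails is treated by a subtraction: the
    cylinder without the condition minus the cylinder where it occurs; [J1] collects the latter
    conditions. *)
Let Psgn J1 J v : uniq (J1 ++ J) -> {in J1 ++ J, forall i, A i} ->
  P (sgn J1 J v) = (p ^+ size J1 * \prod_(i <- J) (if v i then p else 1 - p))%:E.
Proof.
elim: J J1 => [|i J IH] J1.
  rewrite cats0 big_nil mulr1 => uJ JA.
  have -> : sgn J1 [::] v = [set w | {in J1, forall i, E i w}].
    by apply/seteqP; split => w; [case|split].
  rewrite indep_events_seq // big_seq.
  under eq_bigr => i iJ do rewrite (PE (JA _ iJ)).
  rewrite -big_seq prodEFin; congr EFin.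
  by rewrite big_const_seq count_predT iter_mulr_1.
move=> uJ JA.
have uJ' : uniq ((i :: J1) ++ J).
  by move: uJ; rewrite -(perm_uniq (s1 := J1 ++ i :: J)) // perm_catC /= perm_cons perm_catC.
have JA' : {in (i :: J1) ++ J, forall i, A i}.
  move=> j jJ; apply: JA; move: jJ; rewrite /= in_cons !mem_cat in_cons.
  by case/or3P => ->; rewrite ?orbT.
have Pi := IH (i :: J1) uJ' JA'.
rewrite big_cons; case vi : (v i).
  have -> : sgn J1 (i :: J) v = sgn (i :: J1) J v.
    apply/seteqP; split => w [H1 H2]; split => j.
    - rewrite in_cons => /predU1P[->|]; last exact: H1.
      by apply/asboolP; rewrite H2 ?mem_head.
    - by move=> jJ; apply: H2; rewrite in_cons jJ orbT.
    - by move=> jJ; apply: H1; rewrite in_cons jJ orbT.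
    - rewrite in_cons => /predU1P[->|]; last exact: H2.
      by rewrite vi; apply/asboolP; apply: H1; exact: mem_head.
  by rewrite Pi /= exprS; congr EFin; ring.
have JA0 : {in J1 ++ J, forall i, A i}.
  by move=> j jJ; apply: JA'; rewrite /= in_cons jJ orbT.
have P0 := IH J1 _ JA0.
have -> : sgn J1 (i :: J) v = sgn J1 J v `\` sgn (i :: J1) J v.
  apply/seteqP; split => w.
    move=> [H1 H2]; split.
      by split => // j jJ; apply: H2; rewrite in_cons jJ orbT.
    move=> [H3 _]; have := H2 i (mem_head _ _); rewrite vi => /asboolP; apply.
    by apply: H3; exact: mem_head.
  move=> [[H1 H2] H3]; split => // j; rewrite in_cons => /predU1P[->|]; last exact: H2.
  rewrite vi; apply/asboolP => Ei; apply: H3; split => // k.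
  by rewrite in_cons => /predU1P[->|]; last exact: H1.
rewrite measureD //; last 3 first.
- exact: msgn.
- exact: msgn.
- by rewrite ltey_eq fin_num_measure //; exact: msgn.
rewrite (_ : sgn J1 J v `&` sgn (i :: J1) J v = sgn (i :: J1) J v); last first.
  apply/setIidPr => w [H1 H2]; split => // j jJ; apply: H1; by rewrite in_cons jJ orbT.
rewrite [X in (X - _)%E]P0; last by move: uJ'; rewrite /= => /andP[].
rewrite [X in (_ - X)%E]Pi -EFinB /= exprS; congr EFin; ring.
Qed.

Lemma bernoulli_expectation (f : (I -> bool) -> R) (s : seq I) (x : I -> bool) :
  (forall x, 0 <= f x) -> dep s f -> uniq s -> {in s, forall i, A i} ->
  measurable_fun [set: Omega] (fun w => f (fun i => `[< E i w >])) /\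
  (\int[P]_w (f (fun i => `[< E i w >]))%:E = (Ex (bern p01) s f x)%:E)%E.
Proof.
apply: (@cylinder_expectation _ _ _ P I bool (bern p01) A (fun i w => `[< E i w >])).
  move=> i a Ai; have -> : [set w | `[< E i w >] = a] = sgn [::] [:: i] (fun=> a).
    apply/seteqP; split => w /=; first by move=> H; split => // j; rewrite inE => /eqP ->.
    by move=> [_ H]; apply: H; rewrite inE.
  by apply: msgn => j; rewrite inE => /eqP ->.
move=> J v uJ JA; have := @Psgn [::] J v uJ JA; rewrite expr0 mul1r => <-.
by congr (P _); apply/seteqP; split => w /=; [split|case].
Qed.

End IndependentEvents.

Section Subcritical.
Variables (R : realType) (d : nat).
Local Notation vtx := 'rV[int]_d.
Local Notation edge := {fset vtx}.

Lemma touching_edges (S : {fset vtx}) : {in touching S, forall e, edges e}.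
Proof.
move=> e; rewrite mem_undup => /allpairsPdep[x [y [xS xy ->]]].
by exists x, y; split => //; rewrite -mem_nbrs.
Qed.

Lemma escapes_path (L : {fset vtx}) (x : vtx) p w : path (@adj d) x p -> last x p \notin L ->
  all w (path_edges x p) -> escapes L x w.
Proof.
elim: p x => [|v p IH] x /=; first by move=> _ /escapes_out.
by move=> /andP[yv vp] lp /andP[wyv wp]; apply: escapes_cons yv wyv (IH _ vp lp wp).
Qed.

(** An increasing exhaustion of the lattice by finite sets, taken from the countable enumeration;
    its shape is irrelevant. *)
Let ball (n : nat) : {fset vtx} := [fset v in pmap (@choice.unpickle vtx) (iota 0 n)]%fset.

Let ballP n v : (choice.pickle v < n)%N -> v \in ball n.
Proof.
move=> vn; rewrite !inE mem_pmap; apply/mapP; exists (choice.pickle v); first by rewrite mem_iota.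
by rewrite choice.pickleK.
Qed.

Let ballS m n : (m <= n)%N -> (ball m `<=` ball n)%fset.
Proof.
move=> mn; apply/fsubsetP => v; rewrite !inE !mem_pmap => /mapP[k].
rewrite mem_iota /= => km vE; apply/mapP; exists k => //.
by rewrite mem_iota /=; exact: leq_trans km mn.
Qed.

(** Take p > r without infinite cluster and p1 halfway. If every phi were at least 1 at p1,
    sharpness would bound the probability at p of leaving a finite set below, uniformly. But these
    events decrease to the existence of an infinite cluster of the origin, which is null. *)
Lemma subcritical (r : R) : 0 <= r -> r < p_c R d ->
  exists (p1 : R) (h : 0 <= p1 <= 1) (S : {fset vtx}),
    [/\ r < p1, 0 \in S & phi (bern h) S < 1].
Proof.
move=> r0; rewrite /p_c; set C := [set p | _] => rC.
(* The supremum of the empty set is 0 by convention, which [0 <= r] excludes. *)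
have C0 : C !=set0.
  by apply/set0P/negP => /eqP C0; move: rC; rewrite C0 sup0 ltNge r0.
have [p Cp rp] := sup_gt C0 rC.
move: Cp => [p01 [dsp [W [P [opn [[indE Popn] Pinf]]]]]].
pose p1 := (r + p) / 2.
have h : 0 <= p1 <= 1 by rewrite /p1; move: p01; lra.
have rp1 : r < p1 by rewrite /p1; lra.
have p1p : p1 < p by rewrite /p1; lra.
exists p1, h; apply: contrapT => noS.
have phi1 (S : {fset vtx}) : 0 \in S -> 1 <= phi (bern h) S.
  by move=> S0; rewrite leNgt; apply/negP => Slt; apply: noS; exists S.
pose cf (w : W) : edge -> bool := fun e => `[< opn e w >].
pose A n : set W := [set w | escapes (ball n) 0 (cf w)].
have AE n : measurable (A n) /\ P (A n) =
    (Ex (bern p01) (touching (ball n)) (fun w => ind R (escapes (ball n) 0 w)) (@closed_cfg _))%:E.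
  have [mf <-] := @bernoulli_expectation _ _ _ P _ _ opn p p01 indE Popn _ _ (@closed_cfg _)
     (fun w => @ind_ge0 R _) (@escapes_dep R d (ball n) 0) (undup_uniq _) (@touching_edges _).
  have AE : A n = (fun w => ind R (escapes (ball n) 0 (cf w))) @^-1` [set 1].
    apply/seteqP; split => w /=; first exact: ind_true.
    by apply: contraPP => nw; rewrite ind_false // => /esym/eqP; rewrite oner_eq0.
  have mA : measurable (A n) by rewrite AE -[X in measurable X]setTI; exact: mf.
  split => //; transitivity (\int[P]_w (\1_(A n) w)%:E)%E.
    by rewrite integral_indic // setIT.
  apply: eq_integral => w _; rewrite indicE; have [Aw|nAw] := pselect (A n w).
    by rewrite mem_set // ind_true.
  by rewrite memNset // ind_false.
have clusterE n w : A n w <-> exists2 v, open_cluster opn w v & v \notin ball n.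
  split=> [[q [q1 _ q3 q4]]|[v [q [q1 q2 q3]] vn]].
    exists (last 0 q) => //; exists q; split => // e eq; exact/asboolP/(allP q4).
  apply: (escapes_path (p := q)) => //; first by rewrite q2.
  by apply/allP => e eq; apply/asboolP/q3.
have capA : \bigcap_n A n = [set w | infinite_set (open_cluster opn w)].
  apply/seteqP; split => w /=.
    move=> H /finite_fsetP[X CX].
    have [n Hn] : exists n, {in enum_fset X, forall v, (choice.pickle v < n)%N}.
      elim: (enum_fset X) => [|a s [n Hn]]; first by exists 0%N.
      exists (maxn (choice.pickle a).+1 n) => v; rewrite in_cons leq_max.
      by case/predU1P => [->|/Hn ->]; rewrite ?leqnn ?orbT.
    have [v + /negP] := (clusterE n w).1 (H _ I); rewrite CX /= => vX; apply.
    by apply: ballP; exact: Hn.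
  move=> inf n _; apply/clusterE; apply: contrapT => no; apply: inf.
  apply: (sub_finite_set (B := [set` ball n])); last exact: finite_fset.
  move=> v vC /=; apply: contrapT => /negP vn; apply: no; by exists v.
have cvA : (P \o A) n @[n --> \oo] --> P (\bigcap_n A n).
  apply: nonincreasing_cvg_mu.
  - by rewrite ltey_eq fin_num_measure //; case: (AE 0%N).
  - by move=> n; case: (AE n).
  - by apply: bigcapT_measurable => n; case: (AE n).
  - move=> m n mn; apply/subsetPset => w /clusterE[v vC vn]; apply/clusterE; exists v => //.
    by apply: contra vn; exact/fsubsetP/ballS.
rewrite capA Pinf in cvA.
pose c := (p - p1) / (1 + (p - p1)).
have c0 : 0 < c by apply: divr_gt0; lra.
have : (c%:E <= 0)%E.
  apply: (cvge_ge _ cvA); exists (choice.pickle (0 : vtx)).+1 => // n /= n0.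
  have [_ PA] := AE n; rewrite /= [P (A n)]PA lee_fin; apply: sharpness => //; first exact: ballP.
  by move=> S S0 _; exact: phi1.
by rewrite lee_fin leNgt c0.
Qed.

End Subcritical.

(** * Rounded passage times *)

Lemma saw_exponential_decay (R : realType) (d : nat) (S : {fset 'rV[int]_d}) (p1 : R)
    (h1 : 0 <= p1 <= 1) : 0 \in S -> phi (bern h1) S < 1 ->
  exists c E0 : R, [/\ 0 < c, 0 <= E0 & forall p (p01 : 0 <= p <= 1), p <= p1 ->
    forall s k, uniq s ->
    Ex (bern p01) s (fun w => ind R (saw_open (0 : 'rV[int]_d) k w)) (@closed_cfg _) <=
      E0 * expR (- (c * k%:R))].
Proof.
move=> S0 phi1; pose f := Num.max (phi (bern h1) S) 2^-1.
(* The maximum with 1/2 keeps [ln f] meaningful when [phi] vanishes. *)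
have f0 : 0 < f by rewrite /f lt_max invr_gt0 ltr0n orbT.
have f1 : f < 1 by rewrite /f gt_max phi1 /=; lra.
have phif : phi (bern h1) S <= f by rewrite /f le_max lexx.
pose b := #|` S|; have b0 : (0 < b)%N by rewrite /b cardfs_gt0; apply/fset0Pn; exists 0.
have bR : 0 < b%:R :> R by rewrite ltr0n.
pose D := - ln f; have D0 : 0 < D by rewrite /D oppr_gt0 ln_lt0 // f0.
have fE : f = expR (- D) by rewrite /D opprK lnK.
(* The prefactor exp D compensates for rounding k / b down to an integer. *)
exists (D / b%:R), (expR D); split; [by rewrite divr_gt0|exact: expR_ge0|].
move=> p p01 pp1 s k us.
have phi0 : 0 <= phi (bern p01) S.
  by apply: sumr_ge0 => x _; apply: sumr_ge0 => z _; apply: Ex_ge0 => w; exact: ind_ge0.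
have phip : phi (bern p01) S <= f.
  apply: le_trans phif; apply: ler_sum => x _; apply: ler_sum => z _.
  rewrite !Ex_bern; apply: Bx_le_incr; [by have /andP[] := p01|by []|by have /andP[] := h1|].
  exact: exits_through_incr.
apply: le_trans (saw_decay _ (k := (k %/ b)%N) _ S0 us _) _; first exact: leq_divM.
apply: (@le_trans _ _ (f ^+ (k %/ b))); first by rewrite lerXn2r // nnegrE // ltW.
rewrite fE -expRM_natl -expRD ler_expR.
have H : k%:R <= b%:R * ((k %/ b)%:R + 1) :> R.
  by rewrite natr1 -natrM ler_nat mulnC ltnW // ltn_ceil.
have -> : D / b%:R * k%:R = D * (k%:R / b%:R) by field; rewrite gt_eqF.
have {}H : k%:R / b%:R <= (k %/ b)%:R + 1 :> R by rewrite ler_pdivrMr // mulrC.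
nra.
Qed.

Section Levels.
Variable R : realType.
Implicit Types (r y : R) (K M a : nat).

(* [min (ceil y) M] *)
Definition capped_ceil M y : nat := find (fun i : nat => y <= i%:R) (iota 0 M).

Lemma capped_ceil_le M y : (capped_ceil M y <= M)%N.
Proof. by rewrite -[leqRHS](size_iota 0 M) find_size. Qed.

Lemma capped_ceil_lt M y i : (i < capped_ceil M y)%N -> i%:R < y.
Proof.
move=> iM; have := before_find 0%N iM; rewrite nth_iota ?add0n => [/negbT|].
  by rewrite -ltNge.
by apply: leq_trans iM _; exact: capped_ceil_le.
Qed.

Lemma capped_ceil_ge M y : capped_ceil M y = M \/ y <= (capped_ceil M y)%:R.
Proof.
have [cM|] := ltnP (capped_ceil M y) M; last first.
  by move=> H; left; apply/eqP; rewrite eqn_leq H capped_ceil_le.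
right; have : has (fun i : nat => y <= i%:R) (iota 0 M) by rewrite has_find size_iota.
by move/(nth_find 0%N); rewrite nth_iota.
Qed.

Lemma capped_ceil_leq M y a : (capped_ceil M y <= a)%N = (M <= a)%N || (y <= a%:R).
Proof.
apply/idP/orP => [ca|[Ma|ya]].
- case: (capped_ceil_ge M y) => [<-|yc]; [by left|right].
  by apply: le_trans yc _; rewrite ler_nat.
- exact: leq_trans (capped_ceil_le _ _) Ma.
- by rewrite leqNgt; apply/negP => /capped_ceil_lt; rewrite ltNge ya.
Qed.

Definition level K r : 'I_(K ^ 2).+1 :=
  Ordinal (capped_ceil_le (K ^ 2) (r * K%:R) : (capped_ceil (K ^ 2) (r * K%:R) < (K ^ 2).+1)%N).

Definition dval K (v : 'I_(K ^ 2).+1) : R := (v : nat)%:R / K%:R.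

Lemma dval_ge0 K v : 0 <= @dval K v.
Proof. by rewrite divr_ge0. Qed.

Lemma dval_level_le K r : (0 < K)%N -> 0 <= r -> dval (level K r) <= r + K%:R^-1.
Proof.
move=> K0 r0; have KR : 0 < K%:R :> R by rewrite ltr0n.
rewrite /dval ler_pdivrMr // mulrDl mulVf ?gt_eqF //=.
case E : (capped_ceil (K ^ 2) (r * K%:R)) => [|c]; first by rewrite addr_ge0 // mulr_ge0.
by rewrite -natr1 lerD2r ltW // (@capped_ceil_lt (K ^ 2)) // E.
Qed.

Lemma dval_level_ge K r : (0 < K)%N -> K%:R <= dval (level K r) \/ r <= dval (level K r).
Proof.
move=> K0; have KR : 0 < K%:R :> R by rewrite ltr0n.
rewrite /dval /=; case: (capped_ceil_ge (K ^ 2) (r * K%:R)) => [->|H]; [left|right].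
  by rewrite ler_pdivlMr // -natrM mulnn.
by rewrite ler_pdivlMr.
Qed.

Lemma level_le K r a : (0 < K)%N ->
  (level K r <= a)%N = (K ^ 2 <= a)%N || (r <= a%:R / K%:R).
Proof. by move=> K0; rewrite capped_ceil_leq ler_pdivlMr // ltr0n. Qed.

Definition sublevel K a : set R := [set r | (level K r <= a)%N].

Lemma sublevelE K a : (0 < K)%N ->
  sublevel K a = if (K ^ 2 <= a)%N then setT else [set` `]-oo, a%:R / K%:R]].
Proof.
move=> K0; apply/seteqP; split => r; rewrite /sublevel /= level_le //; case: ifP => //=;
  by rewrite in_itv.
Qed.

Lemma measurable_sublevel K a : (0 < K)%N -> measurable (sublevel K a).
Proof. by move=> K0; rewrite sublevelE //; case: ifP. Qed.

Lemma level_setE K (v : 'I_(K ^ 2).+1) : [set r | level K r = v] =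
  if (v : nat) is a.+1 then sublevel K a.+1 `\` sublevel K a else sublevel K 0.
Proof.
apply/seteqP; split => r /=.
  move=> /(congr1 val) /= E; rewrite /sublevel; case vE : (v : nat) => [|a] /=; rewrite E vE //.
  by split => //; rewrite ltnn.
case vE : (v : nat) => [|a]; rewrite /sublevel /=.
  by rewrite leqn0 => /eqP H; apply: val_inj; rewrite /= H vE.
move=> [H /negP]; rewrite -ltnNge => H'; apply: val_inj.
by apply/eqP; rewrite /= vE eqn_leq H.
Qed.

Lemma measurable_level_set K (v : 'I_(K ^ 2).+1) : (0 < K)%N ->
  measurable [set r | level K r = v].
Proof.
move=> K0; rewrite level_setE; case: (v : nat) => [|a]; first exact: measurable_sublevel.
by apply: measurableD; exact: measurable_sublevel.
Qed.

End Levels.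

(** * The law of a rounded passage time *)

Section DiscreteLaw.
Context {disp : measure_display} {Omega : measurableType disp} {R : realType}.
Variables (P : probability Omega R) (X : {RV P >-> R}).

Lemma measurable_level K (v : 'I_(K ^ 2).+1) : (0 < K)%N ->
  measurable [set w | level K (X w) = v].
Proof.
by move=> K0; have := measurable_funPTI X (measurable_level_set v K0); apply.
Qed.

(** Only the distribution function occurs on the right, so variables sharing it have the same
    rounded law even on different probability spaces. *)
Lemma level_prob K (v : 'I_(K ^ 2).+1) : (0 < K)%N ->
  P [set w | level K (X w) = v] =
  (let G a := if (K ^ 2 <= a)%N then 1 else cdf X (a%:R / K%:R) in
   if (v : nat) is a.+1 then G a.+1 - G a else G 0%N)%E.
Proof.
move=> K0.
have PG a : P (X @^-1` sublevel K a) = (if (K ^ 2 <= a)%N then 1 else cdf X (a%:R / K%:R))%E.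
  by rewrite sublevelE //; case: ifP => // _; rewrite preimage_setT probability_setT.
have mG a : measurable (X @^-1` sublevel K a).
  by apply: measurable_funPTI; exact: measurable_sublevel.
have -> : [set w | level K (X w) = v] = X @^-1` [set r | level K r = v] by [].
rewrite level_setE; case: (v : nat) => [|a]; first exact: PG.
rewrite (_ : _ @^-1` _ = X @^-1` sublevel K a.+1 `\` X @^-1` sublevel K a) //.
rewrite measureD //; last by rewrite ltey_eq fin_num_measure.
rewrite (_ : _ `&` _ = X @^-1` sublevel K a); last first.
  by apply/setIidPr => w /= H; exact: leqW.
by rewrite [X in (X - _)%E]PG [X in (_ - X)%E]PG.
Qed.

Let level_sum K : (0 < K)%N ->
  \sum_(v : 'I_(K ^ 2).+1) fine (P [set w | level K (X w) = v]) = 1.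
Proof.
move=> K0.
have H : (\int[P]_(w in \big[setU/set0]_(v <- enum 'I_(K ^ 2).+1) [set w | level K (X w) = v])
    (cst 1 w) = \sum_(v <- enum 'I_(K ^ 2).+1) \int[P]_(w in [set w | level K (X w) = v]) (cst 1
      w))%E.
  apply: ge0_integral_bigsetU => //.
  - by move=> v; exact: measurable_level.
  - exact: enum_uniq.
  - apply/trivIsetP => a b _ _ ab; apply/seteqP; split => // w [/= wa wb]; move: ab.
    by rewrite -wa -wb eqxx.
move: H; rewrite (_ : \big[setU/set0]_(v <- _) _ = setT); last first.
  by rewrite -subTset => w _; rewrite -bigcup_seq; exists (level K (X w)) => //=; rewrite mem_enum.
have I1 (A : set Omega) : measurable A -> (\int[P]_(w in A) cst 1 w = P A)%E.
  by move=> mA; rewrite integral_cst // mul1e.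
under eq_bigr do rewrite (I1 _ (measurable_level _ K0)).
rewrite I1 ?measurableT // probability_setT big_enum /=.
have -> : (\sum_(v : 'I_(K ^ 2).+1) P [set w | level K (X w) = v] =
   (\sum_(v : 'I_(K ^ 2).+1) fine (P [set w | level K (X w) = v]))%:E)%E.
  rewrite -sumEFin; apply: eq_bigr => v _; rewrite fineK // fin_num_measure //.
  exact: measurable_level.
by move=> [].
Qed.

Definition level_law K (K0 : (0 < K)%N) : law R 'I_(K ^ 2).+1 :=
  @Law R 'I_(K ^ 2).+1 'I_(K ^ 2).+1 (fun v => fine (P [set w | level K (X w) = v])) id
    (fun v => fine_ge0 (measure_ge0 P _)) (level_sum K0).

Lemma level_law_expectation K (K0 : (0 < K)%N) (g : 'I_(K ^ 2).+1 -> R) :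
  (forall v, 0 <= g v) ->
  measurable_fun [set: Omega] (fun w => g (level K (X w))) /\
  (\int[P]_w (g (level K (X w)))%:E =
    (\sum_v @law_wt _ _ (level_law K0) v * g v)%:E)%E.
Proof.
move=> g0.
have [] := @cylinder_expectation _ _ _ P unit _ (level_law K0) setT (fun _ w => level K (X w))
  _ _ (fun x => g (x tt)) [:: tt] (fun=> ord0) _ _ _ _ => //.
- by move=> i a _; exact: measurable_level.
- move=> [|[] [|[] J]] v //= _ _.
    rewrite big_nil (_ : [set _ | _] = setT) ?probability_setT // -subTset => w _ j.
    by [].
  rewrite big_seq1 /= fineK; last by rewrite fin_num_measure //; exact: measurable_level.
  congr (P _); apply/seteqP; split => w /=; first by apply; rewrite inE.
  by move=> H [] _.
- by move=> x y xy; rewrite xy // inE.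
Qed.

End DiscreteLaw.

Lemma probability_integral_cst (disp : measure_display) (Omega : measurableType disp)
    (R : realType) (P : probability Omega R) (c : R) : (\int[P]_w c%:E = c%:E)%E.
Proof.
by rewrite integral_cst // [X in (_ * X)%E](probability_setT P) mule1.
Qed.

Section DiscreteLawBounds.
Context {disp : measure_display} {Omega : measurableType disp} {R : realType}.
Variables (P : probability Omega R) (X : {RV P >-> R}).
Hypothesis X0 : forall w, 0 <= X w.

(** Rounding adds at most 1 / K <= 1, and (X + 1)^j <= 2^M (X^M + 1) for j <= M, uniformly in
    [K]. *)
Lemma level_law_moment_bound M : ('E_P[(fun w => X w ^+ M)%R] < +oo)%E ->
  exists A : R, 0 <= A /\ forall K (K0 : (0 < K)%N) j, (j <= M)%N ->
    law_moment (level_law X K0) (@dval R K) j <= A.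
Proof.
rewrite unlock => EX.
have mX : measurable_fun [set: Omega] (fun w => (X w ^+ M)%:E).
  apply/measurable_EFinP; apply: measurable_funX.
  exact: measurable_funPT.
have I0 : (0 <= \int[P]_w (X w ^+ M)%:E)%E.
  by apply: integral_ge0 => w _; rewrite lee_fin exprn_ge0.
have IE : (\int[P]_w (2 ^+ M * (X w ^+ M + 1))%:E =
    (2 ^+ M)%:E * (\int[P]_w (X w ^+ M)%:E + 1))%E.
  under eq_integral do rewrite EFinM EFinD.
  rewrite ge0_integralZl //; last 2 first.
  - by apply: emeasurable_funD => //; exact: measurable_cst.
  - by move=> w _; rewrite -EFinD lee_fin addr_ge0 // exprn_ge0.
  congr (_ * _)%E; rewrite ge0_integralD //.
    by rewrite probability_integral_cst.
  by move=> w _; rewrite lee_fin exprn_ge0.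
exists (fine (\int[P]_w (2 ^+ M * (X w ^+ M + 1))%:E)%E); split.
  apply: fine_ge0; apply: integral_ge0 => w _.
  by rewrite lee_fin mulr_ge0 ?exprn_ge0 // addr_ge0 // exprn_ge0.
move=> K K0 j jM.
have d0 (v : 'I_(K ^ 2).+1) : 0 <= dval R v ^+ j by rewrite exprn_ge0 // dval_ge0.
have [mf E] := @level_law_expectation _ _ _ P X K K0 (fun v => dval R v ^+ j) d0.
rewrite /law_moment -lee_fin -[leLHS]E fineK; last first.
  have p0 : (0 <= (2 ^+ M : R)%:E)%E by rewrite lee_fin exprn_ge0.
  rewrite IE ge0_fin_numE; last by apply: mule_ge0 => //; apply: adde_ge0.
  by apply: lte_mul_pinfty => //; apply: lte_add_pinfty => //; exact: ltry.
apply: ge0_le_integral => //.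
- by move=> w _; rewrite lee_fin.
- exact/measurable_EFinP.
- apply/measurable_EFinP; apply: measurable_funM => //.
  by apply: measurable_funD => //; apply: measurable_funX; exact: measurable_funPT.
move=> w _; rewrite lee_fin.
have K1 : K%:R^-1 <= 1 :> R by rewrite invf_le1 ?ler1n // ltr0n.
have Kv0 : 0 <= K%:R^-1 :> R by [].
have H := dval_level_le K0 (X0 w).
apply: (@le_trans _ _ ((X w + 1) ^+ j)).
  rewrite lerXn2r ?nnegrE ?dval_ge0 ?addr_ge0 //.
  by apply: le_trans H _; rewrite lerD2l.
apply: (@le_trans _ _ ((X w + 1) ^+ M)).
  by rewrite ler_weXn2l // lerDr.
by have := @exprD_le R M (X w) 1 (X0 w) ler01; rewrite expr1n.
Qed.

(** Split at [delta]: below it the exponential is at most 1; above it the rounded value is still at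
    least [delta], since rounding goes up and the cap [K] is not below [delta]. *)
Lemma level_law_laplace K (K0 : (0 < K)%N) (la delta : R) :
  0 <= la -> 0 <= delta -> delta <= K%:R ->
  \sum_v @law_wt _ _ (level_law X K0) v * expR (- (la * dval R v)) <=
    fine (cdf X delta) + expR (- (la * delta)).
Proof.
move=> la0 de0 deK.
have e0 (v : 'I_(K ^ 2).+1) : 0 <= expR (- (la * dval R v)) by exact: expR_ge0.
have [mf E] := @level_law_expectation _ _ _ P X K K0 (fun v => expR (- (la * dval R v))) e0.
have mA : measurable (X @^-1` `]-oo, delta]) by exact: measurable_funPTI.
rewrite -lee_fin -[leLHS]E EFinD fineK; last by rewrite fin_num_measure.
have IE : (\int[P]_w (\1_(X @^-1` `]-oo, delta]) w + expR (- (la * delta)))%:E =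
    cdf X delta + (expR (- (la * delta)))%:E)%E.
  under eq_integral do rewrite EFinD.
  rewrite ge0_integralD //; last by apply/measurable_EFinP; exact: measurable_indic.
  by rewrite integral_indic // setIT probability_integral_cst.
rewrite -IE; apply: ge0_le_integral => //.
- exact/measurable_EFinP.
- apply/measurable_EFinP; apply: measurable_funD; [exact: measurable_indic | exact: measurable_cst].
move=> w _; rewrite lee_fin indicE.
have [Xd|Xd] := leP (X w) delta.
  rewrite mem_set /=; last by rewrite in_itv.
  apply: (@le_trans _ _ 1); last by rewrite lerDl expR_ge0.
  by rewrite -(expR0 R) ler_expR oppr_le0 mulr_ge0 // dval_ge0.
rewrite memNset /=; last by rewrite in_itv /= leNgt Xd.
rewrite add0r ler_expR lerN2 ler_wpM2l //.
case: (dval_level_ge (X w) K0); first exact: le_trans.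
by apply: le_trans; exact: ltW.
Qed.

End DiscreteLawBounds.

Section IidLevels.
Context {disp : measure_display} {Omega : measurableType disp} {R : realType}.
Variables (d : nat) (P : probability Omega R) (F : R -> R).
Variable t : {fset 'rV[int]_d} -> {RV P >-> R}.
Hypothesis iid : iid_passage_times F t.
Context {disp0 : measure_display} {Omega0 : measurableType disp0}.
Variables (P0 : probability Omega0 R) (X0 : {RV P0 >-> R}).
Hypothesis X0F : forall r, cdf X0 r = (F r)%:E.

(** The finite law is that of the reference variable [X0], linked to the times [t] only through [F].
    Bounds obtained once for [X0] thus apply to every realization. *)
Lemma level_expectation K (K0 : (0 < K)%N)
    (f : ({fset 'rV[int]_d} -> 'I_(K ^ 2).+1) -> R) (s : seq {fset 'rV[int]_d}) x :
  (forall x, 0 <= f x) -> dep s f -> uniq s -> {in s, forall e, edges e} ->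
  measurable_fun [set: Omega] (fun w => f (fun e => level K (t e w))) /\
  (\int[P]_w (f (fun e => level K (t e w)))%:E = (Ex (level_law X0 K0) s f x)%:E)%E.
Proof.
have [indep cdfF _] := iid.
apply: (@cylinder_expectation _ _ _ P _ _ (level_law X0 K0) (@edges d)
  (fun e w => level K (t e w))).
  by move=> e a _; exact: measurable_level.
move=> J v uJ JE.
have ind : indep_events P (@edges d) (fun e => t e @^-1` [set r | level K r = v e]).
  by apply: indep => e _; exact: measurable_level_set.
have := indep_events_seq ind uJ JE; rewrite /= => ->.
rewrite -prodEFin !big_seq; apply: eq_bigr => e eJ /=.
rewrite fineK; last by rewrite fin_num_measure //; exact: measurable_level.
rewrite [LHS](level_prob (t e)) // (level_prob X0) //= !X0F.
by case: (v e : nat) => [|a]; rewrite ?X0F !cdfF //; exact: JE.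
Qed.

End IidLevels.

(** * Convergence of the rounded passage times *)

Section LevelConvergence.
Variables (R : realType) (d : nat).
Local Notation vtx := 'rV[int]_d.
Local Notation edge := {fset vtx}.
Variables (t : edge -> R) (z : vtx).
Hypothesis t0 : forall e, edges e -> 0 <= t e.

Let tinf : R := inf [set walk_time t p | p in [set p | path (@adj d) 0 p /\ last 0 p = z]].

Let rounded K e : R := dval R (level K (t e)).

Let walk_ge0 p : path (@adj d) 0 p -> 0 <= walk_time t p.
Proof.
move=> p1; rewrite /walk_time big_seq; apply: sumr_ge0 => e ep.
by apply: t0; exact: path_edges_edges ep.
Qed.

Let tinf_le p : path (@adj d) 0 p -> last 0 p = z -> tinf <= walk_time t p.
Proof.
move=> p1 p2; apply: ge_inf; last by exists p.
by exists 0 => _ [q [q1 _] <-]; exact: walk_ge0.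
Qed.

Lemma walk_to_saw p : path (@adj d) 0 p -> last 0 p = z ->
  exists q, q \in saws (size q) z /\ walk_time t q <= walk_time t p.
Proof.
move=> p1 p2; have [q [q1 qu ql _ qt]] := loop_erase p1.
exists q; split; first by apply/mem_saws; rewrite ql.
(* [loop_erase] wants a weight that is nonnegative everywhere; the absolute value agrees with [t]
   along lattice paths. *)
have tE r : path (@adj d) 0 r -> walk_time t r = walk_time (fun e => `|t e|) r.
  move=> r1; rewrite /walk_time !big_seq; apply: eq_bigr => e er.
  by rewrite ger0_norm // t0 //; exact: path_edges_edges er.
by rewrite !tE //; apply: qt.
Qed.

Lemma saws_widen N K p : (N <= K)%N -> p \in saws N z -> p \in saws K z.
Proof. by move=> NK /mem_saws[p1 pN pu pz]; apply/mem_saws; rewrite (leq_trans pN). Qed.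

Lemma fpp_level_le K q : (0 < K)%N -> q \in saws K z ->
  fpp K z (rounded K) <= walk_time t q + (size q)%:R / K%:R.
Proof.
move=> K0 qK; have [_ /(_ _ qK) H] := geodesicP (rounded K) qK.
apply: le_trans H _; have /mem_saws[q1 _ _ _] := qK.
have -> : (size q)%:R / K%:R = \sum_(e <- path_edges 0 q) K%:R^-1 :> R.
  by rewrite big_const_seq count_predT size_pairmap iter_addr_0 mulr_natl.
rewrite /walk_time -big_split !big_seq; apply: ler_sum => e eq /=.
by apply: dval_level_le => //; apply: t0; exact: path_edges_edges eq.
Qed.

(** Either the geodesic crosses an edge at the cap, and its time is at least [K], or each of its
    edges has truly been rounded up. *)
Lemma fpp_level_ge K q : (0 < K)%N -> q \in saws K z ->
  K%:R <= fpp K z (rounded K) \/ tinf <= fpp K z (rounded K).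
Proof.
move=> K0 qK; have [gK _] := geodesicP (rounded K) qK.
have r0 e : 0 <= rounded K e by exact: dval_ge0.
rewrite /fpp; set g := geodesic K z _ in gK *; have /mem_saws[g1 _ _ gz] := gK.
have [/hasP[e eg Ke]|/hasPn small] := boolP (has (fun e => K%:R <= rounded K e) (path_edges 0 g)).
  by left; apply: le_trans Ke _; rewrite /walk_time (big_rem e) //= lerDl sumr_ge0.
right; apply: le_trans (tinf_le g1 gz) _; rewrite /walk_time !big_seq; apply: ler_sum => e eg.
by case: (dval_level_ge (t e) K0) => // Ke; have := small e eg; rewrite Ke.
Qed.

Lemma fpp_level_cvg (K : nat -> nat) p : path (@adj d) 0 p -> last 0 p = z ->
  (forall k, (k < K k)%N) -> fpp (K k) z (rounded (K k)) @[k --> \oo] --> tinf.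
Proof.
move=> p1 p2 kK; apply/cvgrPdist_le => eps eps0.
have inf_t : has_inf [set walk_time t p | p in [set p | path (@adj d) 0 p /\ last 0 p = z]].
  split; first by exists (walk_time t p), p.
  by exists 0 => _ [q [q1 _] <-]; exact: walk_ge0.
have e20 : 0 < eps / 2 by rewrite divr_gt0.
have [_ [r [r1 r2] <-] rt] := inf_adherent e20 inf_t.
have [q [qs qr]] := walk_to_saw r1 r2.
(* Three demands on [K k], which exceeds [k]: [q] is admissible, the cap is at least [tinf], and the
   rounding error along [q] is at most eps / 2. *)
pose k0 := maxn (size q) (maxn (Num.bound tinf) (Num.bound ((size q)%:R / (eps / 2)))).
exists k0 => // k /= k0k.
have Kk : (k < K k)%N := kK k.
have K0 : (0 < K k)%N by exact: leq_ltn_trans Kk.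
have qK : q \in saws (K k) z.
  by apply: saws_widen qs; apply: leq_trans (ltnW Kk); apply: leq_trans k0k; rewrite leq_maxl.
have kR : k%:R < (K k)%:R :> R by rewrite ltr_nat.
have b1 : tinf <= (K k)%:R.
  have ti0 : 0 <= tinf by apply: lb_le_inf;
    [by exists (walk_time t p), p|move=> _ [q' [q'1 _] <-]; exact: walk_ge0].
  have := archi_boundP ti0 => /ltW/le_trans; apply; rewrite ler_nat.
  apply: leq_trans (ltnW Kk); apply: leq_trans k0k.
  by rewrite /k0 !leq_max leqnn !orbT.
have b2 : (size q)%:R / (K k)%:R <= eps / 2.
  have s0 : 0 <= (size q)%:R / (eps / 2) by rewrite divr_ge0 // ltW.
  rewrite ler_pdivrMr ?ltr0n // mulrC -ler_pdivrMr //.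
  have := archi_boundP s0 => /ltW/le_trans; apply; rewrite ler_nat.
  apply: leq_trans (ltnW Kk); apply: leq_trans k0k.
  by rewrite /k0 !leq_max leqnn !orbT.
have up := fpp_level_le K0 qK.
have lo : tinf <= fpp (K k) z (rounded (K k)).
  by case: (fpp_level_ge K0 qK) => //; exact: le_trans.
rewrite distrC ger0_norm ?subr_ge0 // lerBlDl.
rewrite -/tinf in rt; lra.
Qed.

End LevelConvergence.

(** * Passage to the limit in a central moment *)

Lemma limn_einf_le (R : realType) (u : (\bar R)^nat) (b : \bar R) :
  (forall n, (u n <= b)%E) -> (limn_einf u <= b)%E.
Proof.
move=> ub; rewrite limn_einf_lim; apply: lime_le; first exact: is_cvg_einfs.
apply: nearW => n; apply: le_trans (ub n).
by apply: ereal_inf_lbound; exists n => //=.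
Qed.

(** Domination is asked of [S] itself, which makes the centring constants converge; the powers then
    converge pointwise, and the uniform bound on their integrals passes through Fatou's lemma. *)
Lemma central_moment_limit (disp : measure_display) (Omega : measurableType disp) (R : realType)
    (P : probability Omega R) (T : Omega -> R) (S : nat -> Omega -> R) (G : Omega -> R)
    (M : nat) (b : R) :
  (forall k, measurable_fun [set: Omega] (S k)) ->
  (forall w, S k w @[k --> \oo] --> T w) ->
  P.-integrable [set: Omega] (EFin \o G) -> (forall k w, `|S k w| <= G w) ->
  (forall k, \int[P]_w ((S k w - fine (\int[P]_x (S k x)%:E)) ^+ (2 * M))%:E <= b%:E)%E ->
  (\int[P]_w ((T w - fine (\int[P]_x (T x)%:E)) ^+ (2 * M))%:E <= b%:E)%E.
Proof.
move=> mS ST iG SG Sb.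
have mT : measurable_fun [set: Omega] T.
  by apply: (measurable_fun_cvg mS) => w _; exact: ST.
have cvES w : (S k w)%:E @[k --> \oo] --> (T w)%:E.
  by apply: cvg_EFin; [exact: nearW|exact: ST].
have [iT _ cvI] := dominated_convergence (mu := P) (D := setT) measurableT
  (f_ := fun k w => (S k w)%:E) (f := EFin \o T) (g := EFin \o G)
  (fun k => (measurable_EFinP _ _).2 (mS k)) ((measurable_EFinP _ _).2 mT)
  (aeW _ (fun w _ => cvES w)) iG
  (aeW _ (fun w k _ => SG k w : (`|(S k w)%:E| <= (G w)%:E)%E)).
set c := fine (\int[P]_x (T x)%:E); pose ck k := fine (\int[P]_x (S k x)%:E).
have cvc : ck k @[k --> \oo] --> c.
  apply: fine_cvg; rewrite fineK //; exact: integrable_fin_num iT.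
have cvm w : ((S k w - ck k) ^+ (2 * M))%:E @[k --> \oo] --> ((T w - c) ^+ (2 * M))%:E.
  apply: cvg_EFin; first exact: nearW.
  apply: (continuous_cvg _ (f := fun k => S k w - ck k) (h := fun x => x ^+ (2 * M))).
    exact: exprn_continuous.
  by apply: cvgB; [exact: ST|exact: cvc].
have -> : (\int[P]_w ((T w - c) ^+ (2 * M))%:E =
    \int[P]_w limn_einf (fun k => ((S k w - ck k) ^+ (2 * M))%:E))%E.
  by apply: eq_integral => w _; rewrite (cvg_limn_einf_sup (cvm w)).1.
apply: le_trans (fatou _ _ _ _) _ => //.
- move=> k; apply/measurable_EFinP; apply: measurable_funX; apply: measurable_funB => //.
- by move=> k w _; rewrite lee_fin exprM exprn_ge0 // sqr_ge0.
by apply: limn_einf_le => k; exact: Sb.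
Qed.

(** * Nearest lattice points *)

Section NearestPoint.
Variables (R : realType) (d : nat) (le : rel 'rV[int]_d).

Lemma nearest_point0 : nearest_point le (0 : 'rV[R]_d) = 0.
Proof.
rewrite /nearest_point; set A := [set z | _].
have [[z Az]|nA] := pselect (exists z, A z); last first.
  by apply: xgetPN => z Az; apply: nA; exists z.
have [near _] := xgetPex 0 (ex_intro _ z Az).
have := near 0; rewrite [X in _ <= X]big1; last by move=> i _; rewrite !mxE subrr expr0n.
move=> H; apply/rowP => i; rewrite mxE.
have : (0 - ((xget 0 A) 0 i)%:~R : R) ^+ 2 <= 0.
  apply: le_trans H; rewrite /sqdist (bigD1 i) //= !mxE lerDl.
  by apply: sumr_ge0 => j _; exact: sqr_ge0.
rewrite sub0r sqrrN => H2; have : ((xget 0 A) 0 i)%:~R ^+ 2 == 0 :> R.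
  by rewrite eq_le H2 sqr_ge0.
by rewrite sqrf_eq0 intr_eq0 => /eqP.
Qed.

(** The coordinatewise floor is within squared distance d <= d^2, so a nearest point is too. The
    bound also covers the default value 0. *)
Lemma nearest_point_near (x : 'rV[R]_d) i :
  `|((nearest_point le x) 0 i)%:~R| <= `|x 0 i| + d%:R :> R.
Proof.
rewrite /nearest_point; set A := [set z | _].
have [[z Az]|nA] := pselect (exists z, A z); last first.
  rewrite xgetPN; last by move=> z Az; apply: nA; exists z.
  by rewrite mxE normr0 addr_ge0.
have [near _] := xgetPex 0 (ex_intro _ z Az); set y := xget 0 A in near *.
pose fl : 'rV[int]_d := \row_j Num.floor (x 0 j).
have H1 : sqdist x (map_mx intr fl) <= d%:R.
  apply: (@le_trans _ _ (\sum_(j < d) (1 : R))); last first.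
    by rewrite sumr_const card_ord.
  apply: ler_sum => j _; rewrite !mxE.
  have /andP[f1 f2] := floor_itv (x 0 j).
  rewrite intrD in f2; have f3 : 0 <= x 0 j - (Num.floor (x 0 j))%:~R by lra.
  by rewrite expr_le1 //; lra.
have d1 : (1 <= d)%N by apply: leq_ltn_trans (ltn_ord i).
have H2 : (x 0 i - (y 0 i)%:~R) ^+ 2 <= d%:R ^+ 2.
  apply: (@le_trans _ _ d%:R); last by rewrite expr2 -natrM ler_nat leq_pmulr.
  apply: le_trans H1; apply: le_trans (near fl); rewrite /sqdist (bigD1 i) //= !mxE lerDl.
  by apply: sumr_ge0 => j _; exact: sqr_ge0.
have H3 : `|x 0 i - (y 0 i)%:~R| <= d%:R by rewrite -ler_sqr ?nnegrE // real_normK ?num_real.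
have := ler_normB (x 0 i) (x 0 i - (y 0 i)%:~R); rewrite subKr => /le_trans; apply.
by rewrite lerD2l.
Qed.

Lemma nearest_point_norm1 (u : 'rV[R]_d) : exists B : R, 0 <= B /\
  forall n : nat, (1 <= n)%N ->
    (\sum_i `|(nearest_point le (n%:R *: u)) 0%R i|)%N%:R <= B * n%:R :> R.
Proof.
exists (\sum_i (`|u 0 i| + d%:R)); split.
  by apply: sumr_ge0 => i _; rewrite addr_ge0.
move=> n n1; rewrite natr_sum mulr_suml; apply: ler_sum => i _.
rewrite natr_absz intr_norm; apply: le_trans (nearest_point_near _ _) _.
rewrite mxE normrM ger0_norm // mulrDl mulrC lerD2l.
by rewrite ler_peMr // ler1n.
Qed.

End NearestPoint.

(** * From finite volume to the passage time *)

Section PassageTimeLimit.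
Context {disp : measure_display} {Omega : measurableType disp} {R : realType}.
Variables (d : nat) (P : probability Omega R) (F : R -> R).
Variable t : {fset 'rV[int]_d} -> {RV P >-> R}.
Hypothesis iid : iid_passage_times F t.
Context {disp0 : measure_display} {Omega0 : measurableType disp0}.
Variables (P0 : probability Omega0 R) (X0 : {RV P0 >-> R}).
Hypothesis X0F : forall r, cdf X0 r = (F r)%:E.

Lemma fpp_dep K (z : 'rV[int]_d) (g : R -> R) :
  dep (short_edges d K) (fun y : {fset 'rV[int]_d} -> 'I_(K ^ 2).+1 => g (fpp K z (@dval R K \o
    y))).
Proof.
move=> y y' yy'; congr g.
have tE p : p \in saws K z -> walk_time (@dval R K \o y) p = walk_time (@dval R K \o y') p.
  move=> /mem_saws[p1 pK _ _]; rewrite /walk_time !big_seq; apply: eq_bigr => e ep.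
  by rewrite /= yy' //; exact: mem_short_edges ep.
have [[p pK]|no] := pselect (exists p, p \in saws K z); last first.
  have gE (s : {fset 'rV[int]_d} -> R) : geodesic K z s = [::].
    by rewrite /geodesic xgetPN // => p [pK _]; apply: no; exists p.
  by rewrite /fpp !gE /walk_time !big_nil.
have [g1 m1] := geodesicP (@dval R K \o y) pK; have [g2 m2] := geodesicP (@dval R K \o y') pK.
apply/le_anti/andP; split.
  by have := m1 _ g2; rewrite tE.
by have := m2 _ g1; rewrite -tE.
Qed.

Lemma integrable_moment (X : Omega -> R) M : measurable_fun [set: Omega] X ->
  (forall w, 0 <= X w) -> ('E_P[(fun w => X w ^+ M)%R] < +oo)%E -> (1 <= M)%N ->
  P.-integrable [set: Omega] (EFin \o X).
Proof.
move=> mX X0' EX M1.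
have mXM : measurable_fun [set: Omega] (fun w => X w ^+ M) by exact: measurable_funX.
have iXM : P.-integrable [set: Omega] (EFin \o (fun w => X w ^+ M)).
  apply/integrableP; split; first exact/measurable_EFinP.
  move: EX; rewrite unlock; apply: le_lt_trans; rewrite le_eqVlt; apply/orP; left; apply/eqP.
  by apply: eq_integral => w _; rewrite /= ger0_norm // exprn_ge0.
apply: (@le_integrable _ _ _ P setT measurableT _ (EFin \o (fun w => 1 + X w ^+ M))).
- exact/measurable_EFinP.
- move=> w _; rewrite /= !ger0_norm ?addr_ge0 ?exprn_ge0 // lee_fin.
  have [X1|/ltW X1] := leP (X w) 1.
    by apply: le_trans X1 _; rewrite lerDl exprn_ge0.
  apply: (@le_trans _ _ (X w ^+ M)); last by rewrite lerDr.
  by rewrite -{1}[X w]expr1 ler_weXn2l.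
have -> : EFin \o (fun w => 1 + X w ^+ M) = (fun w => (cst 1 w + (EFin \o (fun w => X w ^+ M)%R)
  w)%E).
  by apply/funext => w; rewrite /= EFinD.
by apply: integrableD => //; exact: finite_measure_integrable_cst.
Qed.

Lemma passage_time_moment_le (M : nat) (z : 'rV[int]_d) q0 N0 k1 (b : R) : (1 <= M)%N ->
  (forall e, edges e -> ('E_P[(fun w => (t e w) ^+ (2 * M))%R] < +oo)%E) ->
  q0 \in saws N0 z ->
  (forall K (K0 : (0 < K)%N), (N0 <= K)%N -> (k1 <= K)%N ->
    let T (y : {fset 'rV[int]_d} -> 'I_(K ^ 2).+1) := fpp K z (@dval R K \o y) in
    Ex (level_law X0 K0) (short_edges d K)
      (fun y => (T y - Ex (level_law X0 K0) (short_edges d K) T (fun=> ord0)) ^+ (2 * M)) (fun=>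
        ord0)
    <= b) ->
  ('E_P[(fun w => (passage_time t 0 z w - fine 'E_P[passage_time t 0 z]) ^+ (2 * M))%R] <= b%:E)%E.
Proof.
move=> M1 mom q0z bound; have [_ _ t0] := iid.
(* Resolutions beyond both thresholds; the successor makes them positive and larger than [k]. *)
pose Kk k := (k + maxn N0 k1).+1.
have KkN k : (N0 <= Kk k)%N by rewrite /Kk; apply: leqW;
  apply: leq_trans (leq_maxl _ k1) (leq_addl _ _).
have Kkk k : (k1 <= Kk k)%N by rewrite /Kk; apply: leqW;
  apply: leq_trans (leq_maxr N0 _) (leq_addl _ _).
pose S k w := fpp (Kk k) z (fun e => dval R (level (Kk k) (t e w))).
have /mem_saws[q1 qN _ qz] := q0z.
(* Dominates every rounded time: each edge of [q0] is rounded up by at most 1 / K <= 1. *)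
pose G w := \sum_(e <- path_edges 0 q0) (1 + t e w).
have t0' w e : edges e -> 0 <= t e w by move=> /t0.
have se k : {in short_edges d (Kk k), forall e, edges e} by move=> e; exact: short_edges_edges.
have f0 k (y : {fset 'rV[int]_d} -> 'I_(Kk k ^ 2).+1) : 0 <= fpp (Kk k) z (@dval R (Kk k) \o y).
  by apply: walk_time_ge0 => e; exact: dval_ge0.
have ES k := level_expectation iid X0F (isT : (0 < Kk k)%N) (fun=> ord0) (@f0 k)
   (@fpp_dep (Kk k) z id) (undup_uniq _) (@se k).
rewrite unlock; apply: (@central_moment_limit _ _ _ P _ S G M b).
- by move=> k; have [] := ES k.
- move=> w; apply: (fpp_level_cvg (t := fun e => t e w) (t0' w) q1 qz).
  by move=> k; rewrite ltnS leq_addr.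
- rewrite /G.
  have -> : EFin \o (fun w => \sum_(e <- path_edges 0 q0) (1 + t e w)) =
      fun w => (\sum_(e <- path_edges 0 q0 | e \in path_edges 0 q0) (cst 1 w + (EFin \o t e) w))%E.
    by apply/funext => w; rewrite /= -big_seq -sumEFin; apply: eq_bigr => e _; rewrite EFinD.
  apply: integrable_sum => // e eq; have ee := path_edges_edges q1 eq.
  apply: integrableD => //; first exact: finite_measure_integrable_cst.
  apply: (integrable_moment (M := (2 * M)%N)) => //; last by rewrite muln_gt0.
  + by move=> w; exact: t0'.
  + exact: mom.
- move=> k w; rewrite ger0_norm; last by apply: walk_time_ge0 => e; exact: dval_ge0.
  have qK := saws_widen (KkN k) q0z.
  apply: le_trans (fpp_level_le (t := fun e => t e w) (t0' w) _ qK) _ => //.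
  rewrite /G big_split /= big_const_seq count_predT size_pairmap iter_addr_0 [leLHS]addrC.
  by rewrite lerD2r ler_piMr // invf_le1 ?ler1n // ltr0n.
- move=> k; have [_ Ek] := ES k.
  have := bound (Kk k) isT (KkN k) (Kkk k); rewrite /=.
  set c := Ex _ _ (fun y => fpp _ _ (_ \o y)) _ => Hb.
  have -> : fine (\int[P]_x (S k x)%:E)%E = c by exact: (congr1 fine Ek).
  have f20 (y : {fset 'rV[int]_d} -> 'I_(Kk k ^ 2).+1) :
      0 <= (fpp (Kk k) z (@dval R (Kk k) \o y) - c) ^+ (2 * M).
    by rewrite exprM exprn_ge0 // sqr_ge0.
  have [_ ->] := level_expectation iid X0F (isT : (0 < Kk k)%N) (fun=> ord0) f20
    (@fpp_dep (Kk k) z (fun r => (r - c) ^+ (2 * M))) (undup_uniq _) (@se k).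
  by rewrite lee_fin.
Qed.

End PassageTimeLimit.

(** * Choice of the constants and conclusion *)

Lemma exists_edge (d : nat) : (1 <= d)%N -> exists e : {fset 'rV[int]_d}, edges e.
Proof.
move=> d1; have i0 := Ordinal d1; pose x : 'rV[int]_d := \row_j (j == i0)%:R.
exists [fset 0; x]%fset, 0, x; split => //.
rewrite /adj /sqdist (bigD1 i0) //= big1 => [|j ji].
  by rewrite !mxE eqxx sub0r sqrrN expr1n addr0.
by rewrite !mxE (negPf ji) subrr expr0n.
Qed.

Lemma cdf_right_near (R : realType) (disp : measure_display) (Omega : measurableType disp)
    (P : probability Omega R) (X : {RV P >-> R}) (F : R -> R) (p : R) :
  (forall r, cdf X r = (F r)%:E) -> F 0 < p -> exists delta, 0 < delta /\ F delta < p.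
Proof.
move=> XF F0p.
have cv : cdf X r @[r --> (0 : R)^'+] --> (F 0)%:E by rewrite -XF; exact: cdf_right_continuous.
have FE : (F : R -> R) = fine \o cdf X by apply/funext => r; rewrite /= XF.
have cvF : F r @[r --> (0 : R)^'+] --> F 0 by rewrite {1}FE; exact: fine_cvg.
have H : \forall r \near (0 : R)^'+, 0 < r /\ F r < p.
  apply: filterI; first exact: nbhs_right_gt.
  exact: (cvgr_lt (F 0) cvF).
by have [r] := filter_ex H; exists r.
Qed.

Lemma passage_time_central_moment (R : realType) (d m : nat) (le : rel 'rV[int]_d) (F : R -> R)
    (u : 'rV[R]_d) : (1 <= d)%N -> (1 <= m)%N -> F 0 < p_c R d ->
  exists C : R, 0 <= C /\
    forall (disp : measure_display) (Omega : measurableType disp)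
           (P : probability Omega R) (t : {fset 'rV[int]_d} -> {RV P >-> R}),
      iid_passage_times F t ->
      (forall e, edges e -> ('E_P[(fun w => (t e w) ^+ (2 * m))%R] < +oo)%E) ->
      forall n : nat, (1 <= n)%N ->
        let T := passage_timeR le t 0 (n%:R *: u) in
        ('E_P[(fun w => (T w - fine 'E_P[T]) ^+ (2 * m))%R] <= (C * n%:R ^+ m)%:E)%E.
Proof.
move=> d1; case: m => // m _ hF0.
(* [C] must precede the realization, so one realization is fixed to extract the constants from [F];
   if there is none, the claim is vacuous. *)
have [[d0 [W0 [P0 [t0 [iid0 mom0]]]]]|no] := pselect (exists (disp : measure_display)
    (Omega : measurableType disp) (P : probability Omega R)
    (t : {fset 'rV[int]_d} -> {RV P >-> R}), iid_passage_times F t /\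
    (forall e, edges e -> ('E_P[(fun w => (t e w) ^+ (2 * m.+1))%R] < +oo)%E)); last first.
  exists 0; split => // disp Omega P t iid mom; exfalso; apply: no.
  by exists disp, Omega, P, t.
have [e0 ee0] := exists_edge d1.
pose X0 := t0 e0; have [_ cdf0 pos0] := iid0.
have X0F r : cdf X0 r = (F r)%:E by exact: cdf0.
have X00 w : 0 <= X0 w by exact: pos0.
have F00 : 0 <= F 0 by rewrite -lee_fin -X0F.
have [p1 [h1 [S [Fp1 S0 phiS]]]] := subcritical F00 hF0.
have [c [E0 [c0 E00 dec]]] := saw_exponential_decay S0 phiS.
have [delta [de0 Fde]] := cdf_right_near X0F Fp1.
pose eps := p1 - F delta; have eps0 : 0 < eps by rewrite /eps; lra.
(* Then exp(- la delta) = exp(- 1 / eps) <= eps because exp y >= y, and the mean density is at most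
   F(delta) + eps = p1. *)
pose la := 1 / (delta * eps).
have la0 : 0 < la by rewrite divr_gt0 // mulr_gt0.
have lade : expR (- (la * delta)) <= eps.
  have -> : la * delta = eps^-1 by rewrite /la; field; rewrite !gt_eqF.
  rewrite expRN -[leRHS]invrK lef_pV2 ?posrE ?expR_gt0 ?invr_gt0 //.
  by have := expR_ge1Dx eps^-1; lra.
have [A [A0 HA]] := level_law_moment_bound X00 (mom0 e0 ee0).
have [B [B0 HB]] := nearest_point_norm1 le u.
have [C [C0 HC]] := fpp_concentration d m la0 c0 E00 A0 B0.
exists C; split => // disp Omega P t iid mom n ngt0 /=.
have n1 : 1 <= n%:R :> R by rewrite ler1n.
rewrite /passage_timeR nearest_point0; set z := nearest_point le _.
have [p [pp pz psz]] := path_to z.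
have [q0 [q1 qu ql qsz _]] := loop_erase pp.
have q0z : q0 \in saws (size q0) z by apply/mem_saws; rewrite ql pz.
have q0B : (size q0)%:R <= B * n%:R :> R.
  by apply: le_trans (HB n ngt0); rewrite ler_nat -psz.
apply: (passage_time_moment_le iid X0F (k1 := Num.bound delta) _ _ q0z) => //.
move=> K K0 qK dK /=; have qKz := saws_widen qK q0z.
apply: (HC _ (level_law X0 K0) _ K z q0) => //.
- by move=> v; exact: dval_ge0.
- by move=> j /andP[_ jm]; apply: HA.
move=> k kK; pose pe := \sum_v @law_wt _ _ (level_law X0 K0) v * expR (- (la * dval R v)).
have deK : delta <= K%:R.
  have := archi_boundP (ltW de0) => /ltW/le_trans; apply; by rewrite ler_nat.
have pe1 : pe <= p1.
  apply: le_trans (level_law_laplace X0 K0 (ltW la0) (ltW de0) deK) _.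
  by rewrite X0F /=; move: lade; rewrite /eps; lra.
have pe01 : 0 <= pe <= 1.
  apply/andP; split; last by have := h1; lra.
  by apply: sumr_ge0 => v _; rewrite mulr_ge0 ?law_ge0 // expR_ge0.
apply: le_trans (dec pe pe01 pe1 (short_edges d K) k (undup_uniq _)).
by apply: (Ex_geodesic_size _ qKz) => //; [move=> v; exact: dval_ge0|exact: ltW].
Qed.

Theorem theorem1 (R : realType) (d m : nat) (le : rel 'rV[int]_d) (F : R -> R)
    (hd : (2 <= d)%N) (hm : (1 <= m)%N)
    (le_refl : reflexive le) (le_anti : antisymmetric le)
    (le_trans : transitive le) (le_total : total le)
    (hF0 : F 0 < p_c R d) (u : 'rV[R]_d) :
  exists C : R,
    forall (disp : measure_display) (Omega : measurableType disp)
           (P : probability Omega R)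
           (t : {fset 'rV[int]_d} -> {RV P >-> R}),
      iid_passage_times F t ->
      (forall e, edges e ->
         ('E_P[(fun w => (t e w) ^+ (2 * m))%R] < +oo)%E) ->
      forall n : nat, (2 <= n)%N ->
        let T := passage_timeR le t 0 (n%:R *: u) in
        ('E_P[(fun w => (T w - fine 'E_P[T]) ^+ (2 * m))%R]
           <= (C * n%:R ^+ m * ln n%:R ^+ (10 * m))%:E)%E.
Proof.
have [C [C0 HC]] := passage_time_central_moment le u (ltnW hd) hm hF0.
have ln2 : 0 < ln 2 :> R by rewrite ln_gt0 // ltr1n.
(* For n >= 2 the ratio ln n / ln 2 is at least 1, so its power can be inserted freely. *)
exists (C / ln 2 ^+ (10 * m)) => disp Omega P t iid mom n n2 /=.
have H := HC disp Omega P t iid mom n (ltnW n2).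
apply: (Order.POrderTheory.le_trans H).
rewrite lee_fin -subr_ge0.
have -> : C / ln 2 ^+ (10 * m) * n%:R ^+ m * ln n%:R ^+ (10 * m) - C * n%:R ^+ m =
    C * n%:R ^+ m * ((ln n%:R / ln 2) ^+ (10 * m) - 1).
  by rewrite expr_div_n; ring.
rewrite mulr_ge0 ?subr_ge0 //; first by rewrite mulr_ge0 // exprn_ge0.
by rewrite exprn_ege1 // ler_pdivlMr // mul1r ler_ln ?posrE ?ltr0n ?ler_nat // ltnW.
Qed.
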